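(* Let $G_{n,p}$ be an Erdős–Rényi graph with parameters $n$ and $p=p(n)\in[0,1]$. Then the following hold. (1) If $p=o(n^{-1})$, then $G_{n,p}$ is diagonal asymptotically almost surely. (2) If $p=cn^{-1}$ for a fixed constant $c>0$, then $$\lim_{n\to\infty}\mathbb{P}(G_{n,p}\text{ is non-diagonal})=\begin{cases}1-\sqrt{1-c}\,\exp\left(\frac{c}{2}+\frac{c^2}{4}+\frac{c^3}{6}+\frac{c^4}{8}\right), & 0<c<1,\\ 1, & c>1.\end{cases}$$ (3) If $p=\omega(n^{-1})$ and $p=o(n^{-3/4})$, then $G_{n,p}$ is non-diagonal asymptotically almost surely.
   Context: The Erdős–Rényi graph $G_{n,p}$ is the random graph on $n$ labelled vertices in which each pair of distinct vertices is joined by an edge independently with probability $p$; $p=p(n)$ may depend on $n$. A property holds asymptotically almost surely if its probability tends to $1$ as $n\to\infty$. Asymptotic notation refers to $n\to\infty$, and $f(n)=\omega(g(n))$ means $g(n)=o(f(n))$. A graph means a finite simple undirected graph without loops. In a graph $G$ with vertex set $V(G)$, let $d(x,y)$ be the length of a shortest path between $x$ and $y$ ($\infty$ if there is none), and $L(x_0,\dots,x_k)=\sum_{i=1}^k d(x_{i-1},x_i)$. For integers $k,\ell\ge 0$, $\mathrm{MC}_{k,\ell}(G)$ is the free $\mathbb{Z}$-module generated by the tuples $(x_0,\dots,x_k)\in V(G)^{k+1}$ with $x_{i-1}\ne x_i$ for all $1\le i\le k$ and $L(x_0,\dots,x_k)=\ell$; $\mathrm{MC}_{-1,\ell}(G)=0$.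 The boundary map $\partial_{k,\ell}:\mathrm{MC}_{k,\ell}(G)\to\mathrm{MC}_{k-1,\ell}(G)$ is given for $k\ge1$ by $\partial_{k,\ell}(x_0,\dots,x_k)=\sum_{i} (-1)^i (x_0,\dots,\hat{x}_i,\dots,x_k)$, the sum over those $1\le i\le k-1$ with $d(x_{i-1},x_{i+1})=d(x_{i-1},x_i)+d(x_i,x_{i+1})$ (the hat means deletion), and $\partial_{0,\ell}=0$. The magnitude homology is $\mathrm{MH}_{k,\ell}(G)=\ker\partial_{k,\ell}/\mathrm{Im}\,\partial_{k+1,\ell}$. A graph $G$ is diagonal if $\mathrm{MH}_{k,\ell}(G)=0$ for all $k\ne\ell$, and non-diagonal otherwise. *)

(* Defs.v *)
From HB Require Import structures.
From mathcomp Require Import all_boot all_order all_algebra zify.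
From mathcomp Require Import boolp classical_sets reals topology normedtype.
From mathcomp Require Import landau sequences exp.

Set Implicit Arguments.
Unset Strict Implicit.
Unset Printing Implicit Defensive.

Import Order.TTheory GRing.Theory Num.Theory.
Import numFieldNormedType.Exports.

Local Open Scope ring_scope.

Record sgraph (V : finType) := SGraph {
  edges : {set {set V}};
  edges_card : [forall e in edges, #|e| == 2]
}.

HB.instance Definition _ (V : finType) := [isSub for @edges V].
HB.instance Definition _ (V : finType) := [Finite of sgraph V by <:].

(* [None] stands for an infinite length. *)
Definition len_add (a b : option nat) : option nat :=
  if (a, b) is (Some m, Some n) then Some (m + n)%N else None.

Fact len_addA : associative len_add.
Proof. by move=> [a|] [b|] [c|] //; rewrite /len_add addnA. Qed.
Fact len_addC : commutative len_add.
Proof. by move=> [a|] [b|] //; rewrite /len_add addnC. Qed.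
Fact len_add0 : left_id (Some 0%N) len_add.
Proof. by case. Qed.
HB.instance Definition _ :=
  Monoid.isComLaw.Build (option nat) (Some 0%N) len_add
    len_addA len_addC len_add0.

Section Magnitude.
Variables (V : finType) (G : sgraph V).

Definition adj : rel V := fun x y => [set x; y] \in edges G.

Lemma adj_sym : symmetric adj.
Proof. by move=> x y; rewrite /adj finset.setUC. Qed.

Lemma adj_irrefl : irreflexive adj.
Proof.
move=> x; apply/negP => xx; have /forall_inP/(_ _ xx) := edges_card G.
by rewrite finset.setUid cards1.
Qed.

Definition has_path (x y : V) (n : nat) : bool :=
  [exists s : n.-tuple V, [&& path adj x s, uniq (x :: s) & last x s == y]].

Definition dist (x y : V) : option nat :=
  if pselect (exists n, has_path x y n) is left xy then Some (ex_minn xy)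
  else None.

Definition vtx k (x : k.+1.-tuple V) (i : nat) : V := nth (thead x) x i.

Definition walk_length k (x : k.+1.-tuple V) : option nat :=
  \big[len_add/Some 0%N]_(1 <= i < k.+1) dist (vtx x i.-1) (vtx x i).

Definition is_gen k (l : nat) (x : k.+1.-tuple V) : bool :=
  all (fun i => vtx x i.-1 != vtx x i) (iota 1 k)
  && (walk_length x == Some l).

Definition MC_gen k l := {x : k.+1.-tuple V | is_gen l x}.

(* Since [MC_gen k l] is finite, the free module on it consists of all integer
   functions on it. *)
Definition MC k l : zmodType := {ffun MC_gen k l -> int}.

(* The basis vector indexed by [s], or 0 if [s] is not a generator; the latter
   does not occur in [bdry_gen] by [delete_gen]. *)
Definition MC_basis k l (s : seq V) : MC k l :=
  [ffun y : MC_gen k l => (tval (val y) == s)%:R].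

Definition delete (i : nat) (s : seq V) : seq V := take i s ++ drop i.+1 s.

Definition smooth k (x : k.+1.-tuple V) (i : nat) : bool :=
  dist (vtx x i.-1) (vtx x i.+1)
  == len_add (dist (vtx x i.-1) (vtx x i)) (dist (vtx x i) (vtx x i.+1)).

Local Open Scope nat_scope.

Lemma dist0 x y : (dist x y == Some 0) = (x == y).
Proof.
rewrite /dist; case: pselect => [h|h].
  case: ex_minnP => m /existsP[s /and3P[_ _ e]] hm.
  apply/eqP/eqP => [[m0]|xy].
    by subst m; move: e; rewrite tuple0 /= => /eqP.
  congr Some; apply/eqP; rewrite -leqn0; apply: hm.
  by apply/existsP; exists [tuple]; rewrite /= xy eqxx.
apply/esym/negbTE/eqP => xy; case: h; exists 0.
by apply/existsP; exists [tuple]; rewrite /= xy eqxx.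
Qed.

Lemma vtx_delete k (x : k.+2.-tuple V) i (y : k.+1.-tuple V) j :
  tval y = delete i x -> (i <= k.+1)%N -> j <= k ->
  vtx y j = vtx x (if j < i then j else j.+1).
Proof.
move=> yE ik jk; rewrite /vtx.
rewrite (set_nth_default (thead x)) ?size_tuple // yE /delete nth_cat.
rewrite size_takel ?size_tuple; last lia.
case: ltnP => ji; first by rewrite nth_take.
by rewrite nth_drop; congr nth; lia.
Qed.

Lemma delete_gen k l (x : k.+2.-tuple V) i (y : k.+1.-tuple V) :
  0 < i < k.+1 -> is_gen l x -> smooth x i -> tval y = delete i x ->
  is_gen l y.
Proof.
move=> /andP[i0 ik] /andP[/allP xne /eqP xl] /eqP sm yE.
have vE j := @vtx_delete _ x i y j yE (ltnW ik).
have ne j : 0 < j <= k.+1 -> vtx x j.-1 != vtx x j.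
  by move=> h; apply: xne; rewrite mem_iota; lia.
have split n a b F : a < b.+1 <= n ->
    \big[len_add/Some 0]_(a <= j < n) F j =
    len_add (\big[len_add/Some 0]_(a <= j < b) F j)
      (len_add (F b) (\big[len_add/Some 0]_(b.+1 <= j < n) F j)).
  move=> h; have ab : a <= b by lia. have bn : b < n by lia.
  by rewrite (@big_cat_nat _ _ _ b) //= ?(ltnW bn) // (@big_ltn _ _ _ b).
apply/andP; split.
  apply/allP => j; rewrite mem_iota => jk; rewrite !vE; try lia.
  have [ji|ij|ji] := ltngtP j i.
  - by rewrite ifT; [apply: ne|]; lia.
  - by rewrite ifF; [have := ne j.+1; rewrite /= prednK; [apply|]|]; lia.
  subst j; rewrite ifT; last lia.
  apply/eqP => e; move: sm; rewrite e.
  have /eqP -> : dist (vtx x i.+1) (vtx x i.+1) == Some 0 by rewrite dist0.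
  have : dist (vtx x i.+1) (vtx x i) != Some 0.
    by rewrite dist0 -e; apply: ne; lia.
  by move=> d0 sm; move: sm d0; case: (dist _ (vtx x i)) => [[|a]|] //; case: dist.
rewrite -xl /walk_length; apply/eqP.
rewrite (@split k.+1 1 i); last lia.
rewrite (@split k.+2 1 i); last lia.
congr len_add.
  apply: eq_big_nat => j jk; rewrite !vE; try lia.
  by rewrite !ifT //; lia.
rewrite [in RHS]big_ltn; last lia.
rewrite len_addA; congr len_add.
  rewrite !vE; try lia; rewrite ltnn ifT; last lia.
  exact: sm.
rewrite [RHS]big_add1; apply: eq_big_nat => j jk; rewrite !vE; try lia.
by rewrite ifF ?ifF /= ?prednK //; lia.
Qed.

Local Close Scope nat_scope.

(* For k = 0 the sum is empty: this is the zero map, here with codomain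
   [MC 0 l] in place of the zero module MC_{-1,l}. *)
Definition bdry_gen k l (x : MC_gen k l) : MC k.-1 l :=
  \sum_(1 <= i < k | smooth (val x) i)
    MC_basis k.-1 l (delete i (val x)) *~ (-1) ^+ i.

Definition bdry k l (f : MC k l) : MC k.-1 l :=
  \sum_(x : MC_gen k l) bdry_gen x *~ f x.

Fact bdry_is_zmod_morphism k l : zmod_morphism (@bdry k l).
Proof.
move=> f g; rewrite -sumrB; apply: eq_bigr => x _.
by rewrite !ffunE mulrzBr.
Qed.
HB.instance Definition _ k l :=
  GRing.isZmodMorphism.Build (MC k l) (MC k.-1 l) (@bdry k l)
    (@bdry_is_zmod_morphism k l).

Definition cycle_pred k l : {pred MC k l} := fun f => bdry f == 0.

Fact cycle_zmod_closed k l : zmod_closed (@cycle_pred k l).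
Proof.
split=> [|f g]; rewrite !unfold_in ?raddf0 // => /eqP f0 /eqP g0.
by rewrite raddfB /= f0 g0 subr0.
Qed.
HB.instance Definition _ k l :=
  GRing.isZmodClosed.Build (MC k l) (@cycle_pred k l) (@cycle_zmod_closed k l).

Record MZ k l := MkMZ { MZ_chain : MC k l; MZ_chainP : MZ_chain \in @cycle_pred k l }.

HB.instance Definition _ k l := [isSub for @MZ_chain k l].
HB.instance Definition _ k l := [Choice of MZ k l by <:].
HB.instance Definition _ k l := [SubChoice_isSubZmodule of MZ k l by <:].

Definition MB k l : {pred MZ k l} :=
  fun z => `[< exists f : MC k.+1 l, bdry f = MZ_chain z >].

Fact MB_zmod_closed k l : zmod_closed (@MB k l).
Proof.
split=> [|z t]; rewrite !unfold_in; first by apply/asboolP; exists 0; rewrite raddf0.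
move=> /asboolP[f fz] /asboolP[g gt]; apply/asboolP; exists (f - g).
by rewrite raddfB /= fz gt.
Qed.
HB.instance Definition _ k l :=
  GRing.isZmodClosed.Build (MZ k l) (@MB k l) (@MB_zmod_closed k l).

Definition MH k l : zmodType := Quotient.quot (@MB k l : zmodClosed (MZ k l)).

Definition diagonal_graph : Prop := forall k l : nat, k <> l -> forall a : MH k l, a = 0.

Lemma MH_eq0P k l :
  (forall a : MH k l, a = 0) <->
  (forall f : MC k l, bdry f = 0 -> exists g : MC k.+1 l, bdry g = f).
Proof.
split=> [H f /eqP f0|H].
  have [] := (asboolP (exists g : MC k.+1 l, bdry g = f)) => // nf.
  pose z := @MkMZ k l f f0.
  have := H (\pi_(MH k l) z)%qT.
  rewrite -[0](raddf0 (\pi_(MH k l))%qT) => /eqP.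
  by rewrite -Quotient.idealrBE subr0 unfold_in => /asboolP.
elim/quotW => z; apply/eqP; rewrite -[0](raddf0 (\pi_(MH k l))%qT).
rewrite -Quotient.idealrBE subr0 unfold_in; apply/asboolP.
by apply: H; apply/eqP; exact: (MZ_chainP z).
Qed.

End Magnitude.

Section ErdosRenyi.
Variable R : realType.

Definition Gnp_weight n (p : R) (G : sgraph 'I_n) : R :=
  \prod_(e : {set 'I_n} | #|e| == 2) (if e \in edges G then p else 1 - p).

Definition Gnp_prob n (p : R) (A : sgraph 'I_n -> Prop) : R :=
  \sum_(G : sgraph 'I_n | `[< A G >]) Gnp_weight p G.

Definition aas (p : nat -> R) (A : forall n, sgraph 'I_n -> Prop) : Prop :=
  (Gnp_prob (p n) (A n) @[n --> \oo] --> (1 : R))%classic.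

End ErdosRenyi.

(* Main.v *)
(* The magnitude complex is analysed on two kinds of graphs.
   If every cycle has length at most 4 and distinct cycles have no common vertex, then
   inserting a canonical first vertex of a geodesic into the first step of length at
   least 2 of a tuple is an acyclic matching, in the sense of discrete Morse theory,
   which leaves only tuples with k = l: the graph is diagonal. If an edge ab lies on a
   cycle but on no cycle of length 3 or 4, let m >= 5 be the length of a shortest
   cycle through ab and l = m/2 rounded up; counting the tuples (a, y, w) of length l
   that avoid the edge ab, for w at distance l from a around the cycle, is a functional
   on MC_{2,l} that vanishes on boundaries but not on a suitable cycle: the graph is
   not diagonal.
   For p = c/n, two distinct short cycles with a common vertex do not occur asymptotically
   almost surely, so diagonality is decided by the existence of a cycle of length at
   least 5. As P (S <= G and A) = p^|S| P (G + S in A), the probability that there is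
   none is bounded below by the product of the 1 - p^|C| (Harris) and above by
   Janson's inequality applied to the cycles of length at most K, where K tends to
   infinity after n. Both bounds tend to exp (- sum_{k >= 5} c^k / (2k)) for c < 1,
   and the upper one tends to 0 for c > 1.
   If np tends to infinity but p = o(n^(-3/4)), there are at least 2n edges, of which
   only o(n) lie on cycles of length 3 or 4; the other ones contain a cycle. *)
Require Import Defs.
From mathcomp Require Import all_boot all_order all_algebra zify ring lra.
From mathcomp Require Import boolp classical_sets reals topology normedtype.
From mathcomp Require Import landau sequences derive realfun exp.
From mathcomp Require functions.
Import Order.TTheory GRing.Theory Num.Theory.
Import numFieldNormedType.Exports.

(** * Graph distance *)

(** Vanishing of homology is obtained over the integers without a chain homotopy. Partners meet with
    coefficient 1 or -1, and the other coefficients are triangular for a rank. So a cycle with k < l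
    is cleared on the insertable tuples by a boundary, and the rest, supported on deletable tuples,
    dies by injectivity one degree lower. The obstacle is the choice of the canonical first vertex.
    With short disjoint cycles, two geodesics can start differently only along a 4-cycle, and
    inserting a vertex must not change whether the vertex before it counts as inserted. Preferring
    one perfect matching of each 4-cycle is coherent, because both ends of an edge then agree on it.
    In the random part, the mean number of k-cycles tends to c^k / (2k). Dropping k = 1, ..., 4 from
    the series of - ln (1 - c) / 2 produces the square root and the polynomial in the exponent. The
    lower bound on the probability of diagonality involves cycles of all lengths up to n and needs
    an estimate uniform in n; Janson's overlap term is small only for lengths up to a fixed K. The
    exponent -3/4 is where the mean number of 4-cycles, of order (np)^4, reaches order n. *)

Section GraphDistance.
Set Implicit Arguments.
Unset Strict Implicit.
Unset Printing Implicit Defensive.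
Local Open Scope nat_scope.
Variables (V : finType) (G : sgraph V).
Implicit Types (x y z : V) (s : seq V) (m n : nat).

Lemma shortest_path x s : path (adj G) x s ->
  exists2 n, n <= size s & has_path G x (last x s) n.
Proof.
move=> ps; case: (shortenP ps) => s' ps' us' sub.
exists (size s').
  apply: uniq_leq_size => //; first by have /andP[] := us'.
by apply/existsP; exists (in_tuple s'); rewrite ps' us' /= eqxx.
Qed.

Lemma dist_walk x s : path (adj G) x s ->
  exists2 n, n <= size s & dist G x (last x s) = Some n.
Proof.
move=> /shortest_path[n ns hn]; rewrite /dist; case: pselect => [h|]; last first.
  by case; exists n.
by case: ex_minnP => m _ /(_ _ hn) mn; exists m => //; apply: leq_trans mn ns.
Qed.

Lemma dist_path x y n : dist G x y = Some n ->
  exists s, [/\ path (adj G) x s, uniq (x :: s), last x s = y & size s = n].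
Proof.
rewrite /dist; case: pselect => // h; case: ex_minnP => m /existsP[s].
by case/and3P=> ps us /eqP ls _ [<-]; exists s; rewrite size_tuple.
Qed.

(* The infinite distance is capped to #|V|. *)
Definition ds x y : nat := odflt #|V| (dist G x y).

Lemma dsE x y : ds x y = odflt #|V| (dist G x y).
Proof. by []. Qed.

(** A shortest path has distinct vertices, one more than its length. Finite distances thus stay
    strictly below the cap of [ds], and [ds x y < #|V|] is how connectedness is expressed from here
    on. *)
Lemma dist_lt x y n : dist G x y = Some n -> n < #|V|.
Proof.
move=> /dist_path[s [_ us _ <-]].
by have := card_uniqP us; rewrite /= => <-; apply: max_card.
Qed.

Lemma ds_dist x y : ds x y < #|V| -> dist G x y = Some (ds x y).
Proof. by rewrite /ds; case: dist => //=; rewrite ltnn. Qed.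

Lemma ds_le x y : ds x y <= #|V|.
Proof. by rewrite /ds; case E: dist => [n|] //=; rewrite ltnW // (dist_lt E). Qed.

Lemma ds_walk x s : path (adj G) x s -> ds x (last x s) <= size s.
Proof. by move=> /dist_walk[n ns e]; rewrite /ds e. Qed.

Lemma ds_connected x s : path (adj G) x s -> ds x (last x s) < #|V|.
Proof. by move=> /dist_walk[n ns e]; rewrite /ds e; apply: dist_lt e. Qed.

Lemma ds_path x y : ds x y < #|V| ->
  exists s, [/\ path (adj G) x s, uniq (x :: s), last x s = y & size s = ds x y].
Proof. by move=> /ds_dist/dist_path. Qed.

Lemma ds_eq0 x y : (ds x y == 0) = (x == y).
Proof.
rewrite -(dist0 G); case E : (dist G x y) => [n|]; rewrite /ds E //=.
by apply/negbTE; rewrite -lt0n; apply/card_gt0P; exists x.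
Qed.

Lemma dsxx x : ds x x = 0.
Proof. by apply/eqP; rewrite ds_eq0. Qed.

Lemma ds_sym x y : ds x y = ds y x.
Proof.
suff H a b : ds a b <= ds b a by apply/eqP; rewrite eqn_leq !H.
have [/ds_path[s [ps _ ls <-]]|] := ltnP (ds b a) #|V|; last exact: leq_trans (ds_le a b).
have pr : path (adj G) a (rev (belast b s)).
  rewrite -ls rev_path (eq_path (e' := adj G)) // => u v; exact: adj_sym.
have := ds_walk pr; rewrite size_rev size_belast.
by case: s ps ls pr => [_ <-|c s _ _ _] //=; rewrite rev_cons last_rcons.
Qed.

Lemma ds_tri y x z : ds x z <= ds x y + ds y z.
Proof.
have [/ds_path[s [ps _ ls <-]]|h] := ltnP (ds x y) #|V|; last first.
  by apply: leq_trans (ds_le _ _) _; apply: leq_trans h _; apply: leq_addr.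
have [/ds_path[t [pt _ lt <-]]|h] := ltnP (ds y z) #|V|; last first.
  by apply: leq_trans (ds_le _ _) _; apply: leq_trans h _; apply: leq_addl.
by rewrite -size_cat -lt -ls -last_cat ds_walk // cat_path ps ls.
Qed.

Lemma conn_trans y x z : ds x y < #|V| -> ds y z < #|V| -> ds x z < #|V|.
Proof.
move=> /ds_path[s [ps _ ls _]] /ds_path[t [pt _ lt _]].
by rewrite -lt -ls -last_cat ds_connected // cat_path ps ls.
Qed.

Lemma adj_neq x y : adj G x y -> x != y.
Proof. by apply: contraTneq => ->; rewrite adj_irrefl. Qed.

Lemma ds1 x y : adj G x y -> ds x y = 1.
Proof.
move=> xy; apply/eqP; rewrite eqn_leq (@ds_walk x [:: y]) /= ?xy //.
by rewrite lt0n ds_eq0 adj_neq.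
Qed.

Lemma conn1 x y : adj G x y -> ds x y < #|V|.
Proof. by move=> xy; apply: (@ds_connected x [:: y]); rewrite /= xy. Qed.

Lemma ds1_adj x y : ds x y = 1 -> ds x y < #|V| -> adj G x y.
Proof.
move=> e /ds_path[[|a [|b s]] [ps _ ls]]; rewrite e //=.
by move: ps; rewrite -ls /= andbT.
Qed.

Lemma ds_first x z n : ds x z = n.+1 -> n.+1 < #|V| ->
  exists2 u, adj G x u & ds u z = n.
Proof.
move=> e h; have /ds_path[s] : ds x z < #|V| by rewrite e.
rewrite e; case: s => [[]|u s [/= /andP[xu ps] _ ls [sn]]] //.
exists u => //; apply/eqP; rewrite eqn_leq; apply/andP; split.
  by rewrite -sn -ls; apply: ds_walk.
by have := ds_tri u x z; rewrite e (ds1 xu).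
Qed.

End GraphDistance.

(** * Integer matrices that are triangular along a matching *)

Section TriangularMatching.
Set Implicit Arguments.
Unset Strict Implicit.
Unset Printing Implicit Defensive.
Local Open Scope ring_scope.
Variables (X Y : finType) (M : Y -> X -> int).
Variables (I : pred X) (D : pred Y) (P : X -> Y -> bool) (r : Y -> nat).
Hypothesis P_fun : forall x, I x -> exists2 y, D y & P x y.
Hypothesis P_onto : forall y, D y -> exists2 x, I x & P x y.
Hypothesis P_inj : forall x x' y, I x -> I x' -> D y -> P x y -> P x' y -> x = x'.
Hypothesis P_det : forall x y y', I x -> D y -> D y' -> P x y -> P x y' -> y = y'.
Hypothesis P_unit : forall x y, I x -> D y -> P x y -> M y x * M y x = 1.
Hypothesis P_tri : forall x y, I x -> D y -> M y x != 0 -> ~~ P x y ->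
  exists y', [/\ D y', P x y' & (r y' < r y)%N].

(** Back substitution by decreasing rank: by [P_tri], a [y] that meets [x] without being its partner
    has larger rank than the partner. A value fixed at [y] therefore disturbs only equations whose
    partner has smaller rank, which are solved later. *)
Lemma matching_surj (z : X -> int) : exists g : Y -> int,
  (forall y, ~~ D y -> g y = 0) /\
  (forall x, I x -> \sum_y g y * M y x = z x).
Proof.
have [N rN] : exists N, forall y, (r y < N)%N.
  by exists (\max_y r y).+1 => y; rewrite ltnS; apply: leq_bigmax.
suff H m : exists g : Y -> int, (forall y, ~~ D y -> g y = 0) /\
    (forall x y, I x -> D y -> P x y -> (N <= r y + m)%N ->
       \sum_y g y * M y x = z x).
  have [g [g0 gz]] := H N; exists g; split=> // x Ix.
  by have [y Dy Pxy] := P_fun Ix; apply: (gz x y) => //; rewrite leq_addl.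
elim: m => [|m [g [g0 gz]]].
  exists (fun=> 0); split=> // x y _ _ _.
  by rewrite addn0 leqNgt rN.
(* The defect at the partner of [y], divided by [M y x]; as the square of this coefficient is 1,
   dividing by it is multiplying by it. *)
pose c y := if D y && (r y + m.+1 == N)%N then
  \sum_(x | I x && P x y) M y x * (z x - \sum_y' g y' * M y' x) else 0.
have cE x y : I x -> D y -> P x y -> (r y + m.+1 = N)%N ->
    c y = M y x * (z x - \sum_y' g y' * M y' x).
  move=> Ix Dy Pxy ry; rewrite /c Dy ry eqxx /= (bigD1 x) ?Ix //= [X in _ + X]big1 ?addr0 //.
  move=> x' /andP[/andP[Ix' Pxy'] ne].
  by rewrite (P_inj Ix Ix' Dy Pxy Pxy') eqxx in ne.
exists (fun y => g y + c y); split=> [y Dy|x y Ix Dy Pxy hr].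
  by rewrite /c (negbTE Dy) addr0 g0.
under eq_bigr do rewrite mulrDl.
rewrite big_split /=.
(* the correction meets x only through the partner of x *)
have c0 y' : y' != y -> c y' * M y' x = 0.
  move=> ne; case: (boolP (D y' && (r y' + m.+1 == N)%N)) => [/andP[Dy' /eqP ry']|n].
    have [->|M0] := eqVneq (M y' x) 0; first by rewrite mulr0.
    have nP : ~~ P x y' by apply/negP => /(P_det Ix Dy Dy' Pxy)/esym/eqP; apply/negP.
    have [y2 [Dy2 Pxy2]] := P_tri Ix Dy' M0 nP.
    by rewrite -(P_det Ix Dy Dy2 Pxy Pxy2); lia.
  by rewrite /c (negbTE n) mul0r.
rewrite [X in _ + X](bigD1 y) //= [X in _ + (_ + X)]big1 ?addr0 => [|y' /c0//].
have [ry|ry] := eqVneq (r y + m.+1)%N N.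
  rewrite (cE x y) // mulrC mulrA [_ * M y x]P_unit // mul1r.
  by rewrite addrC subrK.
rewrite /c (negbTE ry) andbF mul0r addr0; apply: (gz x y) => //; lia.
Qed.

(** Evaluate at the partner of a [y] of maximal rank in the support of [g]: any other [y']
    contributing there would have larger rank. *)
Lemma matching_inj (g : Y -> int) : (forall y, ~~ D y -> g y = 0) ->
  (forall x, I x -> \sum_y g y * M y x = 0) -> forall y, g y = 0.
Proof.
move=> g0 gM y1; apply/eqP; apply/negPn/negP => y1g.
have [y gy ymax] := @arg_maxnP _ y1 (fun y => g y != 0) r y1g.
have Dy : D y by apply: contraNT gy => /g0 ->.
have [x Ix Pxy] := P_onto Dy.
have := gM x Ix; rewrite (bigD1 y) //= big1 => [|y' ne]; last first.
  have [->|gy'] := eqVneq (g y') 0; first by rewrite mul0r.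
  have Dy' : D y' by apply: contraNT gy' => /g0 ->.
  have [->|M0] := eqVneq (M y' x) 0; first by rewrite mulr0.
  have nP : ~~ P x y' by apply/negP => /(P_det Ix Dy Dy' Pxy)/esym/eqP; apply/negP.
  have [y2 [Dy2 Pxy2]] := P_tri Ix Dy' M0 nP.
  by rewrite -(P_det Ix Dy Dy2 Pxy Pxy2); have := ymax _ gy'; lia.
rewrite addr0 => /(congr1 (fun a => a * M y x)).
by rewrite -mulrA P_unit // mulr1 mul0r => /eqP; apply/negP.
Qed.

(** The sign bookkeeping of double deletions: the terms with j < i are those with i <= j, reindexed
    by (i, j) -> (j + 1, i) with a change of sign. *)
Lemma sum_antisym (F : nat -> nat -> int) n :
  (forall i j, (0 < i <= j)%N -> (j < n.+1)%N -> F j.+1 i = - F i j) ->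
  \sum_(1 <= i < n.+2) \sum_(1 <= j < n.+1) F i j = 0.
Proof.
move=> FE.
transitivity (\sum_(1 <= i < n.+2) \sum_(1 <= j < n.+1) ((if (i <= j)%N then F i j else 0) +
   (if (j < i)%N then F i j else 0))).
  apply: eq_bigr => i _; apply: eq_bigr => j _.
  by case: leqP; rewrite ?addr0 ?add0r.
under eq_bigr do rewrite big_split /=.
rewrite big_split /= [X in _ + X]exchange_big /=.
have -> : \sum_(1 <= i < n.+2) \sum_(1 <= j < n.+1) (if (i <= j)%N then F i j else 0) =
    \sum_(1 <= i < n.+1) \sum_(1 <= j < n.+1) (if (i <= j)%N then F i j else 0).
  rewrite big_nat_recr //= [X in _ + X]big_nat [X in _ + X]big1 ?addr0 // => j jn.
  by rewrite ifF //; lia.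
rewrite -big_split big_nat /= big1 // => i hi.
rewrite [X in _ + X]big_nat_recl //= ifF ?add0r; last lia.
rewrite -big_split big_nat /= big1 // => j hj; rewrite ltnS.
by case: leqP => ij; rewrite ?addr0 // FE ?subrr //; lia.
Qed.

End TriangularMatching.

(** * The magnitude complex *)

Section Generators.
Set Implicit Arguments.
Unset Strict Implicit.
Unset Printing Implicit Defensive.
Local Open Scope nat_scope.
Variables (V : finType) (G : sgraph V).
Implicit Types (v : nat -> V) (s : seq V) (k l i j : nat).
Local Notation ds := (ds G).

Definition vlen v k := \sum_(1 <= i < k.+1) ds (v i.-1) (v i).

(** Tuples are treated as functions on [nat], read only up to [k]: deletion becomes composition with
    [bump], and no dependent length intervenes. The bound by [#|V|] says that the steps are
    finite. *)
Definition vgen l v k := [/\ forall i, 0 < i <= k -> v i.-1 != v i,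
  forall i, 0 < i <= k -> ds (v i.-1) (v i) < #|V| & vlen v k = l].

Lemma big_len_add (d : nat -> option nat) (c : nat) k :
  (\big[len_add/Some 0]_(1 <= i < k.+1) d i == Some c) <->
  (forall i, 0 < i <= k -> d i <> None) /\
  \sum_(1 <= i < k.+1) odflt 0 (d i) = c.
Proof.
elim: k c => [|k IH] c.
  rewrite !big_nil; split=> [/eqP[<-]|[_ <-]//]; split=> // i; lia.
rewrite !(@big_nat_recr _ _ _ k.+1) //=; split.
  case E : (\big[_/_]_(_ <= _ < _) _) => [a|//].
  case dE : (d k.+1) => [b|//] /eqP[<-].
  have [IH1 aE] := (IH a).1 (introT eqP E).
  split; last by rewrite aE /=.
  move=> i ik; have [->|] := eqVneq i k.+1; first by rewrite dE.
  move=> ne; apply: IH1; lia.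
move=> [dN <-]; set a := \sum_(_ <= _ < _) _.
have /eqP -> : \big[len_add/Some 0]_(1 <= i < k.+1) d i == Some a.
  apply/IH; split=> // i ik; apply: dN; lia.
by case E : (d k.+1) => [b|] //=; case: (dN k.+1); rewrite ?E //; lia.
Qed.

Lemma is_genP k l (x : k.+1.-tuple V) : reflect (vgen l (vtx x) k) (is_gen G l x).
Proof.
apply: (iffP andP).
  move=> [/allP ne /big_len_add[dN dl]]; split.
  - by move=> i ik; apply: ne; rewrite mem_iota; lia.
  - move=> i ik; have := dN i ik; case E: (dist _ _ _) => [a|] // _.
    by rewrite dsE E /=; apply: dist_lt E.
  - rewrite -dl; apply: eq_big_nat => i ik; rewrite dsE.
    by have := dN i; case: dist => //= [[]//]; lia.
move=> [ne cn vl]; split; first by apply/allP => i; rewrite mem_iota => ik; apply: ne; lia.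
apply/big_len_add; split=> [i ik|]; first by rewrite (ds_dist (cn i ik)).
by rewrite -vl; apply: eq_big_nat => i ik; rewrite (ds_dist (cn i _)) //; lia.
Qed.

Lemma vgen_k0 l v : vgen l v 0 -> l = 0.
Proof. by case=> _ _; rewrite /vlen big_nil. Qed.

Lemma vlen_ge l v k : vgen l v k -> k <= l.
Proof.
case=> ne _ <-; rewrite /vlen.
have : \sum_(1 <= i < k.+1) 1 <= \sum_(1 <= i < k.+1) ds (v i.-1) (v i).
  rewrite big_nat [X in _ <= X]big_nat; apply: leq_sum => i ik.
  by rewrite lt0n ds_eq0; apply: ne; lia.
by rewrite sum_nat_const_nat; lia.
Qed.

Lemma vlen_delete v k i : 0 < i < k.+1 ->
  vlen v k.+1 + ds (v i.-1) (v i.+1) =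
  vlen (v \o bump i) k + ds (v i.-1) (v i) + ds (v i) (v i.+1).
Proof.
move=> ik; rewrite /vlen.
rewrite (@big_cat_nat _ _ _ i) /=; try lia.
rewrite (@big_ltn _ _ _ i) /=; last lia.
rewrite (@big_ltn _ _ _ i.+1) /=; last lia.
rewrite [\sum_(1 <= j < k.+1) _](@big_cat_nat _ _ _ i) /=; try lia.
rewrite [\sum_(i <= j < k.+1) _]big_ltn /=; last lia.
have -> : \sum_(1 <= j < i) ds (v (bump i j.-1)) (v (bump i j)) =
          \sum_(1 <= j < i) ds (v j.-1) (v j).
  apply: eq_big_nat => j hj; rewrite /bump.
  have -> : (i <= j.-1) = false by lia.
  have -> : (i <= j) = false by lia.
  by rewrite /= !add0n.
have -> : \sum_(i.+1 <= j < k.+1) ds (v (bump i j.-1)) (v (bump i j)) =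
          \sum_(i.+2 <= j < k.+2) ds (v j.-1) (v j).
  rewrite [RHS]big_add1 /=; apply: eq_big_nat => j hj; rewrite /bump.
  have -> : (i <= j.-1) by lia.
  have -> : (i <= j) by lia.
  by rewrite /= !add1n prednK //; lia.
rewrite /bump leqnn add1n.
have -> : (i <= i.-1) = false by lia.
by rewrite add0n; lia.
Qed.

Lemma vlen_delete_le v k i : 0 < i < k.+1 -> vlen (v \o bump i) k <= vlen v k.+1.
Proof. by move=> ik; have := vlen_delete v ik; have := ds_tri G (v i) (v i.-1) (v i.+1); lia. Qed.

Lemma eq_vlen v w k : (forall j, j <= k -> v j = w j) -> vlen v k = vlen w k.
Proof. by move=> e; apply: eq_big_nat => i ik; rewrite !e //; lia. Qed.

Lemma eq_vgen l v w k : (forall j, j <= k -> v j = w j) -> vgen l v k -> vgen l w k.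
Proof.
move=> e [ne cn vl]; split=> [i ik|i ik|]; rewrite -?(eq_vlen e) // -!e; try lia.
  exact: ne.
exact: cn.
Qed.

Definition vsmooth v i := ds (v i.-1) (v i.+1) == ds (v i.-1) (v i) + ds (v i) (v i.+1).

Lemma vgen_delete l v k i : 0 < i < k.+1 -> vgen l v k.+1 -> vsmooth v i ->
  vgen l (v \o bump i) k.
Proof.
move=> ik [ne cn vl] /eqP sm; split=> [j jk|j jk|]; last first.
- by have := vlen_delete v ik; rewrite vl; lia.
- rewrite /=; have [ji|ji|ji] := ltngtP j i.
  + have [-> ->] : bump i j.-1 = j.-1 /\ bump i j = j by rewrite /bump; lia.
    by apply: cn; lia.
  + have [-> ->] : bump i j.-1 = j.+1.-1 /\ bump i j = j.+1 by rewrite /bump; lia.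
    by apply: cn; lia.
  + have [-> ->] : bump i j.-1 = i.-1 /\ bump i j = i.+1 by rewrite /bump; lia.
    by apply: (conn_trans (y := v i)); [apply: cn|apply: (cn i.+1)]; lia.
- rewrite /=; have [ji|ji|ji] := ltngtP j i.
  + have [-> ->] : bump i j.-1 = j.-1 /\ bump i j = j by rewrite /bump; lia.
    by apply: ne; lia.
  + have [-> ->] : bump i j.-1 = j.+1.-1 /\ bump i j = j.+1 by rewrite /bump; lia.
    by apply: ne; lia.
  + have [-> ->] : bump i j.-1 = i.-1 /\ bump i j = i.+1 by rewrite /bump; lia.
    rewrite -(ds_eq0 G) sm addn_eq0 !ds_eq0 negb_and.
    by rewrite ne //; lia.
Qed.

Lemma vgen_delete_smooth l v k i : 0 < i < k.+1 -> vgen l v k.+1 ->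
  vlen (v \o bump i) k = l -> vsmooth v i.
Proof.
move=> ik [_ _ vl] dl; apply/eqP.
by have := vlen_delete v ik; rewrite vl dl; lia.
Qed.

Lemma smoothE l k (x : k.+2.-tuple V) i : 0 < i < k.+1 -> vgen l (vtx x) k.+1 ->
  smooth G x i = vsmooth (vtx x) i.
Proof.
move=> ik [ne cn vl]; rewrite /smooth /vsmooth.
have c1 : ds (vtx x i.-1) (vtx x i) < #|V| by apply: cn; lia.
have c2 : ds (vtx x i) (vtx x i.+1) < #|V| by apply: (cn i.+1); lia.
by rewrite !(ds_dist c1, ds_dist c2, ds_dist (conn_trans c1 c2)).
Qed.

Definition tup k v : k.+1.-tuple V := [tuple v i | i < k.+1].

Lemma vtx_tup k v j : j <= k -> vtx (tup k v) j = v j.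
Proof. by move=> jk; rewrite /vtx -[j]/(val (Ordinal (jk : j < k.+1))) -tnth_nth tnth_mktuple. Qed.

Lemma vtx_inj k (x y : k.+1.-tuple V) : (forall j, j <= k -> vtx x j = vtx y j) -> x = y.
Proof.
move=> e; apply: eq_from_tnth => i; rewrite !(tnth_nth (thead x)).
have := e i; rewrite -ltnS ltn_ord => /(_ isT) ei.
rewrite [RHS](set_nth_default (thead y)) ?size_tuple //; exact: ei.
Qed.

Lemma delete_tup k (x : k.+2.-tuple V) i : i <= k.+1 ->
  delete i x = tup k (vtx x \o bump i).
Proof.
move=> ik.
have sz : size (delete i x) == k.+1.
  by rewrite /delete size_cat size_takel ?size_drop ?size_tuple; lia.
pose y := Tuple sz; rewrite -[LHS]/(tval y); congr tval; apply: vtx_inj => j jk.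
rewrite vtx_tup //= (@vtx_delete _ _ x i y) // /bump.
by case: ltnP => h /=.
Qed.

Lemma eq_deleteP k (x : k.+2.-tuple V) (w : k.+1.-tuple V) i : i <= k.+1 ->
  reflect (forall j, j <= k -> vtx w j = vtx x (bump i j)) (tval w == delete i x).
Proof.
move=> ik; rewrite delete_tup //; apply: (iffP eqP).
  by move=> /val_inj -> j jk; rewrite vtx_tup.
by move=> e; congr tval; apply: vtx_inj => j jk; rewrite vtx_tup // e.
Qed.

Local Open Scope ring_scope.

(** No smoothness condition appears, since [vgen_delete_smooth] forces it as soon as a deletion
    yields a generator of the same length. *)
Definition bdry_coef k l (x : MC_gen G k.+1 l) (w : MC_gen G k l) : int :=
  \sum_(1 <= i < k.+1) (if tval (val w) == delete i (val x) then (-1) ^+ i else 0).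

Lemma MC_mulrz k l (f : MC G k l) (n : int) w : (f *~ n) w = f w *~ n.
Proof. by case: n => n; rewrite ?NegzE ?mulrNz -?pmulrn -?nmulrn ?ffunE ?ffunMnE. Qed.

Lemma bdryE k l (f : MC G k.+1 l) (w : MC_gen G k l) :
  bdry f w = \sum_x f x * bdry_coef x w.
Proof.
rewrite /bdry sum_ffunE; apply: eq_bigr => x _; rewrite MC_mulrz mulrzz mulrC; congr (_ * _).
rewrite /bdry_gen sum_ffunE /bdry_coef big_mkcond /=.
apply: eq_big_nat => i ik.
have [gx gw] : vgen l (vtx (val x)) k.+1 /\ vgen l (vtx (val w)) k.
  by split; apply/is_genP; apply: valP.
rewrite (smoothE (l := l)) //.
case: ifP => sm; last first.
  case: eq_deleteP => [|e|//]; first by lia.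
  move: sm; rewrite (@vgen_delete_smooth l _ k) //.
  have [_ _ wl] := gw; rewrite -[RHS]wl; apply: eq_vlen => j jk; by rewrite e.
rewrite MC_mulrz ffunE; case: eqP => _; rewrite ?mul0rz // mulrzz mul1r //.
Qed.

End Generators.

(** * The boundary map squares to zero *)

Section BoundarySquare.
Set Implicit Arguments.
Unset Strict Implicit.
Unset Printing Implicit Defensive.
Local Open Scope ring_scope.
Variables (V : finType) (G : sgraph V).

Lemma bump_bump i j t : (i <= j)%N -> bump j.+1 (bump i t) = bump i (bump j t).
Proof. by rewrite /bump; lia. Qed.

Lemma bdry_coef_sq k l (x : MC_gen G k.+2 l) (z : MC_gen G k l) :
  \sum_(w : MC_gen G k.+1 l) bdry_coef x w * bdry_coef w z = 0.
Proof.
pose F i j : int := if val z == tup k (vtx (val x) \o bump i \o bump j) then (-1) ^+ (i + j) else 0.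
have gz : vgen G l (vtx (val z)) k by apply/is_genP; apply: valP.
have gx : vgen G l (vtx (val x)) k.+2 by apply/is_genP; apply: valP.
transitivity (\sum_(1 <= i < k.+2) \sum_(1 <= j < k.+1) F i j); last first.
  apply: sum_antisym => i j ij jk; rewrite /F.
  have -> : tup k (vtx (val x) \o bump j.+1 \o bump i) =
            tup k (vtx (val x) \o bump i \o bump j).
    by apply: vtx_inj => t tk; rewrite !vtx_tup //= bump_bump //; case/andP: ij.
  by case: ifP => _; rewrite ?oppr0 // addSn exprS mulN1r addnC.
rewrite /bdry_coef; under eq_bigr do rewrite mulr_suml.
rewrite exchange_big /=; apply: eq_big_nat => i ik.
under eq_bigr do rewrite mulr_sumr.
rewrite exchange_big /=; apply: eq_big_nat => j jk; rewrite /F.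
case: eqP => [zE|zN]; last first.
  rewrite big1 // => w _; case: eq_deleteP => [|wE|_]; first by lia.
    case: eq_deleteP => [|zE|_]; [by lia| |by rewrite mulr0].
    case: zN; apply: vtx_inj => t tk; rewrite vtx_tup // zE // wE //.
    by rewrite /bump; lia.
  by rewrite mul0r.
(* Deletions never increase the length, and both ends have length [l]; so the intermediate tuple has
   length [l] too and is a generator. *)
have gw : is_gen G l (tup k.+1 (vtx (val x) \o bump i)).
  apply/is_genP; apply: (@eq_vgen _ _ _ (vtx (val x) \o bump i)).
    by move=> t tk; rewrite vtx_tup.
  apply: vgen_delete => //; apply: (@vgen_delete_smooth _ _ l _ k.+1) => //.
  have [_ _ xl] := gx; have [_ _ zl] := gz.
  have := vlen_delete_le G (vtx (val x)) ik.
  have := vlen_delete_le G (vtx (val x) \o bump i) jk.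
  have -> : vlen G (vtx (val x) \o bump i \o bump j) k = vlen G (vtx (val z)) k.
    by apply: eq_vlen => t tk; rewrite zE vtx_tup.
  by rewrite xl zl; lia.
rewrite (bigD1 (exist (fun t => is_gen G l t) _ gw : MC_gen G k.+1 l)) //= big1 ?addr0 => [|w wN].
  rewrite ifT; last by rewrite delete_tup //; lia.
  rewrite ifT ?exprD //.
  apply: (introT (@eq_deleteP _ _ (tup k.+1 (vtx (val x) \o bump i)) (val z) j _)); first by lia.
  move=> t tk; rewrite zE !vtx_tup //=.
  by rewrite /bump; lia.
case: eqP => [wE|_]; last by rewrite mul0r.
case/eqP: wN; apply: val_inj => /=; apply: val_inj; rewrite /= wE delete_tup //; lia.
Qed.

Lemma bdry_bdry k l (f : MC G k.+2 l) : bdry (bdry f : MC G k.+1 l) = 0.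
Proof.
apply/ffunP => z; rewrite bdryE ffunE.
under eq_bigr do rewrite bdryE mulr_suml.
rewrite exchange_big big1 // => x _.
under eq_bigr do rewrite -mulrA.
by rewrite -mulr_sumr bdry_coef_sq mulr0.
Qed.

End BoundarySquare.

(** * Diagonality from an acyclic matching *)

Section DiagonalCertificate.
Set Implicit Arguments.
Unset Strict Implicit.
Unset Printing Implicit Defensive.
Local Open Scope nat_scope.
Variables (V : finType) (G : sgraph V).
(* u x z is a canonical first vertex on a geodesic from x to z. A tuple all of whose
   steps have length 1 up to the first step (x, z) of length at least 2 is matched
   with the tuple where u x z is inserted in that step, unless an inserted vertex
   occurs earlier. A boundary term of a tuple that is not its partner is the partner
   of a tuple agreeing with it up to a step that changes from being in [cross] to
   not being in [cross], so that the matching is acyclic. *)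
Variables (u : V -> V -> V) (cross : rel V).
Local Notation ds := (ds G).
Local Notation adj := (adj G).

Hypothesis uP : forall x z, 1 < ds x z < #|V| -> adj x (u x z) /\ (ds (u x z) z).+1 = ds x z.
(** Inserting [u b z] after [b] replaces the successor [z] of [b]. The equality says that this does
    not affect the removability of [b], which makes insertion and deletion inverse to each other. *)
Hypothesis u_step : forall a b z, adj a b -> 1 < ds b z < #|V| ->
  (ds a (u b z) == 2) && (b == u a (u b z)) = (ds a z == (ds b z).+1) && (b == u a z).
(** For the deletion of the vertex [c] that follows a removable [b]: if [b] stops being removable,
    the step out of [b] must leave [cross] once the canonical vertex towards [w] is inserted. *)
Hypothesis u_cut : forall a b c w, adj a b -> ds b c < #|V| -> ds c w < #|V| ->
  b != c -> c != w -> ds a c = (ds b c).+1 -> b = u a c -> ds b w = ds b c + ds c w ->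
  ~~ ((ds a w == (ds b w).+1) && (b == u a w)) -> cross b c /\ ~~ cross b (u b w).
Hypothesis u_cross : forall a b c, adj a b -> adj b c -> ds a c = 2 -> b != u a c ->
  cross a b /\ ~~ cross a (u a c).

Implicit Types (v x y : nat -> V) (i j k l t : nat).

Definition removable v j :=
  [&& ds (v j.-1) (v j) == 1, ds (v j.-1) (v j.+1) == (ds (v j) (v j.+1)).+1
    & v j == u (v j.-1) (v j.+1)].

(** The guard [j < k] excludes the last vertex, which has no successor: [v k.+1] lies outside the
    tuple. *)
Definition quiet v k i := forall j, 0 < j < i ->
  ds (v j.-1) (v j) = 1 /\ ~~ ((j < k) && removable v j).

Definition insT v k i := [/\ 0 < i <= k, quiet v k i & ds (v i.-1) (v i) != 1].
Definition delT v k i := [/\ 0 < i < k, quiet v k i & removable v i].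

Lemma insT_uniq v k i j : insT v k i -> insT v k j -> i = j.
Proof.
move=> [ik qi di] [jk qj dj]; have [ij|ji|//] := ltngtP i j.
  by have [|e _] := qj i; [lia|rewrite e eqxx in di].
by have [|e _] := qi j; [lia|rewrite e eqxx in dj].
Qed.

Lemma delT_uniq v k i j : delT v k i -> delT v k j -> i = j.
Proof.
move=> [ik qi di] [jk qj dj]; have [ij|ji|//] := ltngtP i j.
  by have [|_] := qj i; [lia|rewrite di; lia].
by have [|_] := qi j; [lia|rewrite dj; lia].
Qed.

Lemma insT_delT v k i j : insT v k i -> delT v k j -> False.
Proof.
move=> [ik qi di] [jk qj dj]; have [ij|ji|ij] := ltngtP i j.
- by have [|e _] := qj i; [lia|rewrite e eqxx in di].
- by have [|_] := qi j; [lia|rewrite dj; lia].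
- by case/and3P: dj => e _ _; subst j; rewrite e in di.
Qed.

(** Unit steps alone would give length [k], so some step is longer; hence there is a first index at
    which a long step or a removable vertex occurs. *)
Lemma ins_or_del l v k : vgen G l v k -> k < l ->
  (exists i, insT v k i) \/ (exists i, delT v k i).
Proof.
move=> [ne cn vl] kl.
pose stop i := (0 < i <= k) && ((ds (v i.-1) (v i) != 1) || ((i < k) && removable v i)).
have [i0 si0] : exists i, stop i.
  apply: contrapT => ns; move: vl kl; rewrite /vlen.
  have -> : \sum_(1 <= i < k.+1) ds (v i.-1) (v i) = \sum_(1 <= i < k.+1) 1.
    apply: eq_big_nat => i ik; apply/eqP/negPn/negP => di; apply: ns; exists i.
    by rewrite /stop di; lia.
  by rewrite sum_nat_const_nat; lia.
have [i si mini] := ex_minnP (ex_intro stop i0 si0).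
have qi : quiet v k i.
  move=> j ji; have : ~~ stop j by apply/negP => /mini; lia.
  rewrite /stop negb_and negb_or negbK => /orP[|/andP[/eqP -> ->] //].
  by move: si; rewrite /stop; lia.
move: si; rewrite /stop => /andP[ik /orP[di|/andP[ik' di]]].
  by left; exists i.
by right; exists i; split=> //; lia.
Qed.

Lemma vgen_step l v k i : vgen G l v k -> 0 < i <= k -> 0 < ds (v i.-1) (v i) < #|V|.
Proof. by move=> [ne cn _] ik; rewrite cn // lt0n ds_eq0 ne. Qed.

Lemma delT_delete l x y k i : vgen G l y k.+1 -> delT y k.+1 i ->
  (forall j, j <= k -> x j = y (bump i j)) ->
  vgen G l x k /\ insT x k i.
Proof.
move=> gy [ik qi /and3P[/eqP e1 /eqP e2 /eqP e3]] xE.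
have xl j : j < i -> x j = y j by move=> ji; rewrite xE ?/bump; [congr y|]; lia.
have xr j : i <= j -> j <= k -> x j = y j.+1.
  by move=> ji jk; rewrite xE ?/bump //; congr y; lia.
split.
  apply: (@eq_vgen _ _ _ (y \o bump i)) => [j jk|]; first by rewrite xE.
  by apply: vgen_delete => //; rewrite /vsmooth e1 e2.
have c : 0 < ds (y i) (y i.+1) < #|V| by apply: (vgen_step gy (i := i.+1)); lia.
split; [lia| |by rewrite xl ?xr ?e2; lia].
move=> j ji; have [d1 nr] := qi j ji; split; first by rewrite !xl //; lia.
(* Only the vertex at [i.-1] gets a new successor; for it [u_step] compares removability before and
   after. *)
have [jE|jn] := eqVneq j i.-1; last first.
  by move: nr; rewrite /removable !xl; lia.
apply: contra nr => /andP[_]; rewrite /removable d1.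
rewrite (xl j.-1) ?(xl j) ?(xr j.+1); try lia.
have -> : j.+1 = i by lia.
have jE' : y j = y i.-1 by rewrite jE.
rewrite jE' => /and3P[_ r1 r2]; have ad : adj (y j.-1) (y i.-1).
  by apply: ds1_adj; rewrite -jE' d1 //; lia.
have /andP[s1 s2] : (ds (y j.-1) (y i) == 2) && (y i.-1 == u (y j.-1) (y i)).
  rewrite e3 u_step ?r1 // (conn_trans (y := y i)) ?e1 ?e2; lia.
by rewrite eqxx e1 s1 s2; lia.
Qed.

Definition ins i a v : nat -> V := fun j => if j < i then v j else if j == i then a else v j.-1.

Lemma ins_bump i a v j : ins i a v (bump i j) = v j.
Proof.
rewrite /ins /bump; case: (leqP i j) => ij.
  by rewrite !ifF ?add1n //; lia.
by rewrite add0n ij.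
Qed.

Lemma insT_insert l x k i : vgen G l x k -> insT x k i ->
  vgen G l (ins i (u (x i.-1) (x i)) x) k.+1 /\ delT (ins i (u (x i.-1) (x i)) x) k.+1 i.
Proof.
move=> gx [ik qi di]; set a := u _ _; set y := ins i a x.
have c := vgen_step gx ik.
have yl j : j < i -> y j = x j by move=> ji; rewrite /y /ins ji.
have yi : y i = a by rewrite /y /ins ltnn eqxx.
have yr j : i <= j -> y j.+1 = x j by move=> ij; rewrite /y /ins !ifF //; lia.
have [aa ad] : adj (x i.-1) a /\ (ds a (x i)).+1 = ds (x i.-1) (x i) by apply: uP; lia.
have gy : vgen G l y k.+1.
  have [ne cn xl] := gx; split.
  - move=> j jk; have [ji|ji|ji] := ltngtP j i.
    + by rewrite !yl; try lia; apply: ne; lia.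
    + have [->|ji'] := eqVneq j i.+1; last first.
        have jE : j = j.-2.+2 by lia.
        by rewrite jE /= !yr; try lia; apply: (ne j.-2.+1); lia.
      by rewrite /= yi yr // -(ds_eq0 G); lia.
    + by rewrite ji yi yl; [apply: adj_neq aa|lia].
  - move=> j jk; have [ji|ji|ji] := ltngtP j i.
    + by rewrite !yl; try lia; apply: cn; lia.
    + have [->|ji'] := eqVneq j i.+1; last first.
        have jE : j = j.-2.+2 by lia.
        by rewrite jE /= !yr; try lia; apply: (cn j.-2.+1); lia.
      rewrite succnK yi yr //; case/andP: c => _; apply: leq_ltn_trans; by rewrite -ad leqnSn.
    + by rewrite ji yi yl; [apply: conn1 aa|lia].
  - have e : vlen G (y \o bump i) k = l.
      by rewrite -xl; apply: eq_vlen => j _; apply: ins_bump.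
    have ik' : 0 < i < k.+1 by lia.
    by have := vlen_delete G y ik'; rewrite e yi yr // yl ?(ds1 aa); lia.
split=> //; split; [lia| |]; last first.
  by rewrite /removable yi yr // yl ?(ds1 aa) ?eqxx //= ?ad ?eqxx //; lia.
move=> j ji; have [d1 nr] := qi j ji; split; first by rewrite !yl //; lia.
have [jE|jn] := eqVneq j i.-1; last first.
  by move: nr; rewrite /removable !yl; lia.
apply: contra nr => /andP[_]; rewrite /removable (yl j.-1) ?(yl j); try lia.
have -> : j.+1 = i by lia.
rewrite yi d1 eqxx /=.
have jE' : x j = x i.-1 by rewrite jE.
rewrite jE' (ds1 aa).
have : adj (x j.-1) (x i.-1).
  by apply: ds1_adj; rewrite -jE' d1 //; lia.
move=> /u_step - /(_ (x i)); rewrite -/a => -> //; last by lia.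
by move=> ->; rewrite andbT; lia.
Qed.

(** The pattern of [cross] along the tuple read as a binary number, the first step being the most
    significant digit: leaving [cross] at one step outweighs everything after it. *)
Definition rank k v := \sum_(1 <= t < k.+1) cross (v t.-1) (v t) * 2 ^ (k - t).

Lemma rank_lt k v w t : 0 < t <= k -> (forall s, s < t -> w s = v s) ->
  cross (v t.-1) (v t) -> ~~ cross (w t.-1) (w t) -> rank k w < rank k v.
Proof.
move=> tk e cv cw; rewrite /rank.
rewrite (@big_cat_nat _ _ _ t) /=; try lia.
rewrite [X in _ < X](@big_cat_nat _ _ _ t) /=; try lia.
have -> : \sum_(1 <= s < t) cross (w s.-1) (w s) * 2 ^ (k - s) =
          \sum_(1 <= s < t) cross (v s.-1) (v s) * 2 ^ (k - s).
  by apply: eq_big_nat => s st; rewrite !e //; lia.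
rewrite ltn_add2l !(@big_ltn _ _ _ t); try lia.
rewrite cv (negbTE cw) mul0n mul1n add0n.
apply: leq_trans (leq_addr _ _).
have pow m : m <= k -> \sum_(m.+1 <= s < k.+1) 2 ^ (k - s) = (2 ^ (k - m)).-1.
  move=> mk; have -> : m = k - (k - m) by lia.
  move: (k - m) (leq_subr m k) => d; elim: d => [|d IH] dk.
    by rewrite subn0 big_geq // subnn.
  rewrite big_ltn; last lia.
  have -> : (k - d.+1).+1 = k - d by lia.
  rewrite IH; last lia.
  have -> : k - (k - d) = d by lia.
  have -> : k - (k - d.+1) = d.+1 by lia.
  by rewrite expnS; have := expn_gt0 2 d; lia.
apply: (@leq_ltn_trans (\sum_(t.+1 <= s < k.+1) 2 ^ (k - s))).
  by apply: leq_sum => s _; case: cross; rewrite ?mul1n.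
by rewrite pow; [have := expn_gt0 2 (k - t)|]; lia.
Qed.

(** Acyclicity, by the position [j] of the deleted vertex. Before [i] it lies between two unit steps
    and is not canonical, so [u_cross] applies. Beyond [i.+1] the removable vertex at [i] survives,
    so the tuple is not insertable. At [i.+1] it either survives as well, or [u_cut] applies. When
    [u_cross] or [u_cut] applies, the first step to change leaves [cross]. *)
Lemma delT_other l x y k i j t : vgen G l y k.+1 -> delT y k.+1 i ->
  0 < j < k.+1 -> j != i -> vgen G l x k -> (forall s, s <= k -> x s = y (bump j s)) ->
  insT x k t -> rank k.+1 (ins t (u (x t.-1) (x t)) x) < rank k.+1 y.
Proof.
move=> gy dT jk ji gx xE xT.
have [ik qi /and3P[/eqP e1 /eqP e2 /eqP e3]] := dT.
have xl s : s < j -> x s = y s by move=> sj; rewrite xE ?/bump; [congr y|]; lia.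
have xr s : j <= s -> s <= k -> x s = y s.+1.
  by move=> sj sk; rewrite xE ?/bump //; congr y; lia.
have /eqP sm : vsmooth G y j.
  apply: (vgen_delete_smooth jk gy); case: gx => _ _ <-.
  by apply: eq_vlen => s sk; rewrite xE.
have [ij|ij|/eqP] := ltngtP j i; last by rewrite (negbTE ji).
- have d1 : ds (y j.-1) (y j) = 1 by have [|-> _] := qi j; first lia.
  have d2 : ds (y j) (y j.+1) = 1.
    have [jE|n] := eqVneq j.+1 i; first by move: e1; rewrite -jE.
    by have [|-> _] := qi j.+1; first lia.
  have nr : y j != u (y j.-1) (y j.+1).
    have [|_] := qi j; first lia.
    by rewrite /removable sm d1 d2; lia.
  have c1 := @vgen_step _ _ _ j gy; have c2 := @vgen_step _ _ _ j.+1 gy.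
  have [cr ncr] := u_cross (ds1_adj d1 ltac:(lia)) (ds1_adj d2 ltac:(lia)) ltac:(by rewrite sm d1 d2) nr.
  have tj : t = j.
    have [tk qt dt] := xT; have [tj|jt|//] := ltngtP t j.
      move: dt; rewrite !xl; try lia.
      by have [|-> _] := qi t; first lia.
    have [|] := qt j; first lia.
    by rewrite xl ?xr ?sm; lia.
  rewrite tj xl ?xr; try lia.
  apply: (rank_lt (t := j)) => //; first lia.
    by move=> s sj; rewrite /ins sj xl.
  by rewrite /ins ltnn eqxx ifT ?xl //; lia.
have xle s : s <= i -> x s = y s by move=> si; apply: xl; lia.
have [ji1|jn] := eqVneq j i.+1; last first.
  case: (@insT_delT x k t i xT); split; [lia| |].
    move=> s si; have [d nr] := qi s si; rewrite !xle; try lia; split=> //.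
    by move: nr; rewrite /removable !xl; lia.
  by rewrite /removable !xl ?e1 ?e2 -?e3 ?eqxx //; lia.
subst j; rewrite /= in sm.
have [ne cn _] := gy.
have xi1 : x i.+1 = y i.+2 by apply: xr; lia.
have ad : adj (y i.-1) (y i) by apply: ds1_adj; rewrite // cn; lia.
have c1 : ds (y i) (y i.+1) < #|V| by apply: (cn i.+1); lia.
have c2 : ds (y i.+1) (y i.+2) < #|V| by apply: (cn i.+2); lia.
have n1 : y i != y i.+1 by apply: (ne i.+1); lia.
have n2 : y i.+1 != y i.+2 by apply: (ne i.+2); lia.
have qx : quiet x k i.
  move=> s si; have [d nr] := qi s si; rewrite !xle; try lia; split=> //.
  by move: nr; rewrite /removable !xle; lia.
case: (boolP (removable x i)) => [rm|nrm].
  by case: (@insT_delT x k t i xT); split=> //; lia.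
have nr : ~~ ((ds (y i.-1) (y i.+2) == (ds (y i) (y i.+2)).+1) && (y i == u (y i.-1) (y i.+2))).
  by move: nrm; rewrite /removable xi1 !xle ?e1; lia.
have [cr ncr] := u_cut ad c1 c2 n1 n2 e2 e3 sm nr.
have xI : insT x k i.+1.
  split; [lia| |].
    move=> s si; have [->|sn] := eqVneq s i; last by apply: qx; lia.
    split; first by rewrite !xle ?e1 //; lia.
    apply: contra nr => /andP[_]; rewrite /removable xi1 !xle; try lia; by case/and3P=> _ ->.
  rewrite /= xi1 xle // sm.
  by move: n1 n2; rewrite -!(ds_eq0 G); lia.
rewrite (insT_uniq xT xI) xi1 xle //.
apply: (rank_lt (t := i.+1)) => //; first lia.
  by move=> s si; rewrite /ins si xl.
by rewrite /ins /= ltnSn ltnn eqxx xle.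
Qed.

Local Open Scope ring_scope.

Let I k l : pred (MC_gen G k l) := fun x : MC_gen G k l => `[< exists i, insT (vtx (val x)) k i >].
Let D k l : pred (MC_gen G k l) := fun x : MC_gen G k l => `[< exists i, delT (vtx (val x)) k i >].
Let P k l (x : MC_gen G k l) (y : MC_gen G k.+1 l) : bool :=
  `[< exists i, delT (vtx (val y)) k.+1 i /\
      forall j, (j <= k)%N -> vtx (val x) j = vtx (val y) (bump i j) >].
Let r k l (y : MC_gen G k l) := rank k (vtx (val y)).

Let gen k l (x : MC_gen G k l) : vgen G l (vtx (val x)) k.
Proof. by apply/is_genP; apply: valP. Qed.

Let mk k l v : vgen G l v k -> {x : MC_gen G k l | forall j, (j <= k)%N -> vtx (val x) j = v j}.
Proof.
move=> gv; have gt : is_gen G l (tup k v).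
  by apply/is_genP; apply: eq_vgen gv => j jk; rewrite vtx_tup.
by exists (exist (fun w => is_gen G l w) _ gt) => j jk; rewrite /= vtx_tup.
Qed.

Lemma eq_quiet v w k i : (forall j, (j <= k)%N -> v j = w j) -> (i <= k)%N ->
  quiet v k i -> quiet w k i.
Proof.
move=> e ik q j ji; have [d nr] := q j ji; rewrite -!e; try lia; split=> //.
apply: contra nr => /andP[jk]; rewrite jk /removable !e //; lia.
Qed.

Lemma eq_insT v w k i : (forall j, (j <= k)%N -> v j = w j) -> insT v k i -> insT w k i.
Proof.
by move=> e [ik q d]; split=> //; [apply: (eq_quiet e _ q)|rewrite -!e //]; lia.
Qed.

Lemma eq_delT v w k i : (forall j, (j <= k)%N -> v j = w j) -> delT v k i -> delT w k i.
Proof.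
move=> e [ik q]; rewrite /removable !e; try lia.
by split=> //; apply: (eq_quiet e _ q); lia.
Qed.

Let P_ins k l (x : MC_gen G k l) (y : MC_gen G k.+1 l) i : 
  insT (vtx (val x)) k i -> P x y -> forall j, (j <= k.+1)%N ->
  vtx (val y) j = ins i (u (vtx (val x) i.-1) (vtx (val x) i)) (vtx (val x)) j.
Proof.
move=> xI /asboolP[t [yD xE]].
have [_ xI'] := delT_delete (gen y) yD xE.
rewrite (insT_uniq xI xI') => j jk.
have [tk _ /and3P[_ _ /eqP e]] := yD.
rewrite /ins; case: ltngtP => jt.
- by rewrite xE ?/bump; [congr vtx|]; lia.
- by rewrite xE ?/bump; [congr vtx|]; lia.
- have [b1 b2] : bump t t.-1 = t.-1 /\ bump t t = t.+1 by rewrite /bump; lia.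
  by rewrite jt e (xE t.-1) ?(xE t) ?b1 ?b2 //; lia.
Qed.

Let P_fun k l (x : MC_gen G k l) : I x -> exists2 y, D y & P x y.
Proof.
move=> /asboolP[i xI]; have [gy yD] := insT_insert (gen x) xI.
have [y yE] := mk gy; have yD' := eq_delT (fun j jk => esym (yE j jk)) yD.
exists y; first by apply/asboolP; exists i.
apply/asboolP; exists i; split=> // j jk.
by rewrite yE ?ins_bump // /bump; lia.
Qed.

Let P_onto k l (y : MC_gen G k.+1 l) : D y -> exists2 x, I x & P x y.
Proof.
move=> /asboolP[i yD].
have [|gx xI] := @delT_delete _ (vtx (val y) \o bump i) _ _ _ (gen y) yD; first by [].
have [x xE] := mk gx; exists x; apply/asboolP; exists i => //.
by apply: eq_insT xI => j jk; rewrite xE.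
Qed.

Let P_inj k l (x x' : MC_gen G k l) (y : MC_gen G k.+1 l) : P x y -> P x' y -> x = x'.
Proof.
move=> /asboolP[i [yD xE]] /asboolP[i' [yD' xE']].
by do 2!apply: val_inj; congr tval; apply: vtx_inj => j jk; rewrite xE // xE' // (delT_uniq yD yD').
Qed.

Let P_det k l (x : MC_gen G k l) (y y' : MC_gen G k.+1 l) : I x -> P x y -> P x y' -> y = y'.
Proof.
move=> /asboolP[i xI] Py Py'; apply: val_inj; apply: vtx_inj => j jk.
by rewrite (P_ins xI Py) // (P_ins xI Py').
Qed.

(** Consecutive vertices differ, so deletions at two different positions never give the same tuple
    and a single sign survives in the coefficient. *)
Let P_unit k l (x : MC_gen G k l) (y : MC_gen G k.+1 l) : P x y ->
  bdry_coef y x * bdry_coef y x = 1.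
Proof.
move=> /asboolP[i [yD xE]]; have [ik _ _] := yD.
suff -> : bdry_coef y x = (-1) ^+ i by rewrite -expr2 sqrr_sign.
rewrite /bdry_coef (bigD1_seq i) /= ?iota_uniq ?mem_index_iota //.
rewrite ifT; last by apply/eq_deleteP; [lia|].
rewrite big_nat_cond big1 ?addr0 // => j /andP[jk ji].
case: eq_deleteP => [|e|//]; first by lia.
have [ne _ _] := gen y.
have [ij|ij|/eqP] := ltngtP i j; last by rewrite eq_sym (negbTE ji).
  have := e i; rewrite xE; try lia.
  have [-> ->] : bump i i = i.+1 /\ bump j i = i by rewrite /bump; lia.
  move=> /(_ ltac:(lia)) yi; have := ne i.+1 ltac:(lia).
  by rewrite /= yi eqxx.
have := e j; rewrite xE; try lia.
have [-> ->] : bump i j = j /\ bump j j = j.+1 by rewrite /bump; lia.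
move=> /(_ ltac:(lia)) yi; have := ne j.+1 ltac:(lia).
by rewrite /= yi eqxx.
Qed.

Let P_tri k l (x : MC_gen G k l) (y : MC_gen G k.+1 l) : I x -> D y ->
  bdry_coef y x != 0 -> ~~ P x y ->
  exists y' : MC_gen G k.+1 l, [/\ D y', P x y' & (r y' < r y)%N].
Proof.
move=> /asboolP[t xI] /asboolP[i yD] M0 nP.
have [j jk xE] : exists2 j, (0 < j < k.+1)%N &
    forall s, (s <= k)%N -> vtx (val x) s = vtx (val y) (bump j s).
  apply: contrapT => n; case/eqP: M0; rewrite /bdry_coef big_nat big1 // => j jk.
  by case: eq_deleteP => [|e|//]; [lia|case: n; exists j].
have ji : j != i.
  by apply: contraNneq nP => ji; apply/asboolP; exists i; rewrite -{2}ji.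
have lt := delT_other (gen y) yD jk ji (gen x) xE xI.
have [y' Dy' Py'] := P_fun (asboolT (ex_intro (insT (vtx (val x)) k) t xI) : I x).
exists y'; split=> //; apply: leq_ltn_trans lt.
rewrite /r /rank leq_eqVlt; apply/orP; left; apply/eqP; apply: eq_big_nat => s sk.
by rewrite !(P_ins xI Py') //; lia.
Qed.

Theorem certificate_diagonal : diagonal_graph G.
Proof.
move=> k l kl; apply/MH_eq0P => f f0.
have empty : (forall x : MC_gen G k l, False) -> exists g : MC G k.+1 l, bdry g = f.
  by move=> e; exists 0; apply/ffunP => x; case: (e x).
have [lk|kl'|lk] := ltngtP l k; last by case: kl.
  by apply: empty => x; have := vlen_ge (gen x); lia.
case: k kl kl' f f0 empty => [|k] kl kl' f f0 empty.
  by apply: empty => x; have := vgen_k0 (gen x); lia.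
have [g [_ gf]] := matching_surj (@P_fun _ _) (fun a b c _ _ _ => @P_inj _ _ a b c)
  (fun a b c Ia _ _ => @P_det _ _ a b c Ia) (fun a b _ _ => @P_unit _ _ a b)
  (@P_tri k.+1 l) f.
exists [ffun y => g y]; apply/esym/eqP; rewrite -subr_eq0; apply/eqP.
(* As k < l, every generator is insertable or deletable; vanishing on the former leaves [h]
   supported on the latter, where [matching_inj] applies to the pairing with the degree below. *)
set h := f - _; have hI (x : MC_gen G k.+1 l) : I x -> h x = 0.
  move=> Ix; rewrite /h !ffunE bdryE -[f x]gf //; apply/eqP; rewrite subr_eq0; apply/eqP.
  by apply: eq_bigr => y _; rewrite ffunE.
have hc : bdry h = 0 by rewrite /h raddfB /= f0 bdry_bdry subrr.
apply/ffunP => x; rewrite [RHS]ffunE; move: x.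
apply: (matching_inj (@P_onto _ _)
  (fun a b c Ia _ _ => @P_det _ _ a b c Ia) (fun a b _ _ => @P_unit _ _ a b)
  (@P_tri k l)).
- move=> x nD; apply: hI; have [[i xI]|[i xD]] := ins_or_del (gen x) kl'.
    by apply/asboolP; exists i.
  by case/negP: nD; apply/asboolP; exists i.
- by move=> x _; rewrite -bdryE hc ffunE.
Qed.

End DiagonalCertificate.

(** * Graphs with only short, disjoint cycles *)

Section CycleEdges.
Set Implicit Arguments.
Unset Strict Implicit.
Unset Printing Implicit Defensive.
Local Open Scope nat_scope.
Variable V : finType.
Implicit Types (x y a b : V) (c s : seq V).

Lemma set2_inj x y a b : [set x; y] = [set a; b] ->
  (x = a /\ y = b) \/ (x = b /\ y = a).
Proof.
move=> e; have := set21 x y; have := set22 x y.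
have := set21 a b; have := set22 a b; rewrite {1 2}e -{1 2}e !inE.
by do 4!(case/orP=> /eqP ?); subst; auto.
Qed.

(** The edge set forgets the starting point and the direction of the list [c]; two cycles count as
    distinct when their edge sets differ. *)
Definition cyc_edges c : {set {set V}} := [set [set x; next c x] | x in c].

Lemma mem_cyc_edges c x y : uniq c -> x \in c ->
  ([set x; y] \in cyc_edges c) = (y == next c x) || (y == prev c x).
Proof.
move=> uc xc; apply/imsetP/orP => [[z zc /set2_inj[[-> ->]|[-> ->]]]|[]/eqP->].
- by rewrite eqxx; left.
- by right; rewrite prev_next.
- by exists x.
- by exists (prev c x); rewrite ?mem_prev // next_prev // finset.setUC.
Qed.

Definition is_cycle (G : sgraph V) c := [&& 2 < size c, cycle (adj G) c & uniq c].

End CycleEdges.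

(** * A coherent choice of first steps of geodesics *)

Section ShortCycles.
Set Implicit Arguments.
Unset Strict Implicit.
Unset Printing Implicit Defensive.
Local Open Scope nat_scope.
Variables (V : finType) (G : sgraph V).
Local Notation ds := (ds G).
Local Notation adj := (adj G).
Hypothesis short : forall c, is_cycle G c -> size c <= 4.
Hypothesis disj : forall c c' x, is_cycle G c -> is_cycle G c' -> x \in c -> x \in c' ->
  cyc_edges c = cyc_edges c'.
Implicit Types (a b d p q x y z w : V).

(* p is the first vertex after x on some geodesic from x to z. *)
Definition geo_step x z p := adj x p && ((ds p z).+1 == ds x z).

Lemma geo_stepP x z p : reflect (adj x p /\ (ds p z).+1 = ds x z) (geo_step x z p).
Proof. by apply: (iffP andP) => [[? /eqP]|[? ->]]. Qed.

Lemma geo_step_ex x z : 0 < ds x z < #|V| -> exists p, geo_step x z p.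
Proof.
case E : (ds x z) => [|n] //= h; have [p xp pz] := ds_first E h.
by exists p; rewrite /geo_step xp pz E eqxx.
Qed.

(** Both geodesics descend one level of distance to [z] at a time and are followed until they merge.
    Hence the branches have equal length, and everything below [p] and [q] is distinct from them by
    its level. The last clause locates the meeting point when it comes at once. *)
Lemma merging_geodesics m p q z : p != q -> ds p z = m -> ds q z = m -> m < #|V| ->
  exists y s1 s2, [/\ path adj p (rcons s1 y), path adj q (rcons s2 y),
    uniq [:: p, q, y & s1 ++ s2] && all (fun v => ds v z < m) (y :: s1 ++ s2),
    size s1 = size s2 & (s1 = [::] -> (ds y z).+1 = m)].
Proof.
elim: m p q => [|m IH] p q pq pm qm mV.
  by move/eqP: pm; move/eqP: qm; rewrite !ds_eq0 => /eqP qz /eqP pz; rewrite pz qz eqxx in pq.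
have [p' pp' p'm] := ds_first pm mV; have [q' qq' q'm] := ds_first qm mV.
have neq s : all (fun v => ds v z <= m) s -> (p \notin s) && (q \notin s).
  move/allP=> al; apply/andP; split; apply/negP => /al; rewrite ?pm ?qm; lia.
have [e|ne] := eqVneq p' q'.
  exists p', [::], [::]; split=> //=; rewrite ?pp' ?e ?qq' // -?e ?p'm //.
  have /andP[] := neq [:: p'] ltac:(by rewrite /= p'm leqnn).
  by rewrite !inE negb_or pq ltnSn => -> ->.
have [y [s1 [s2 [h1 h2 /andP[u al] e _]]]] := IH p' q' ne p'm q'm ltac:(lia).
exists y, (p' :: s1), (q' :: s2); split=> //; rewrite /= ?pp' ?qq' ?h1 ?h2 ?e //.
set s := [:: y, p' & s1 ++ q' :: s2].
have ps : perm_eq s [:: p', q', y & s1 ++ s2].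
  by apply/permP => P; rewrite /s /= !count_cat /=; clear; lia.
have als : all (fun v => ds v z <= m) s.
  rewrite (perm_all _ ps) /= p'm q'm leqnn /=; apply: sub_all al => v; lia.
have /andP[pn qn] := neq s als.
have us : uniq [:: p, q & s].
  by rewrite 2!cons_uniq inE negb_or pq pn qn (perm_uniq ps) u.
exact/andP.
Qed.

Lemma path_rev a b s : path adj a (rcons s b) -> path adj b (rcons (rev s) a).
Proof.
move=> p; have := rev_path (fun x y => adj y x) a (rcons s b).
rewrite last_rcons belast_rcons rev_cons -[RHS]/(path adj a (rcons s b)) p => e.
by rewrite (eq_path (e' := fun x y => adj y x)) // => u v; apply: adj_sym.
Qed.

Definition C4 a b c d := [&& uniq [:: a; b; c; d], adj a b, adj b c, adj c d & adj d a].

Lemma C4_cycle a b c d : C4 a b c d -> is_cycle G [:: a; b; c; d].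
Proof. by case/and5P=> u ab bc cd da; rewrite /is_cycle u /= ab bc cd da. Qed.

Lemma C4_rot a b c d : C4 a b c d -> C4 b c d a.
Proof.
case/and5P=> u ab bc cd da; rewrite /C4 ab bc cd da !andbT.
by rewrite -(rot_uniq 1) in u.
Qed.

Lemma C4_rev a b c d : C4 a b c d -> C4 a d c b.
Proof.
case/and5P=> u ab bc cd da; rewrite /C4 ![adj a d]adj_sym ![adj d c]adj_sym ![adj c b]adj_sym ![adj b a]adj_sym.
rewrite ab bc cd da !andbT.
by rewrite -(rot_uniq 1) -rev_uniq in u.
Qed.

(** Merging the geodesics through [p] and [q] closes a cycle of length 4 + 2 * size s1 through [x];
    by [short], [s1] is empty. *)
Lemma square x z p q : geo_step x z p -> geo_step x z q -> p != q -> 1 < ds x z < #|V| ->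
  exists2 s, C4 x p s q & (ds s z).+2 = ds x z.
Proof.
move=> /geo_stepP[xp pz] /geo_stepP[xq qz] pq xz.
have [y [s1 [s2 [h1 h2 /andP[u al] e s1n]]]] :=
  @merging_geodesics (ds x z).-1 p q z pq ltac:(lia) ltac:(lia) ltac:(lia).
have c : is_cycle G [:: x, p & s1 ++ y :: rcons (rev s2) q].
  apply/and3P; split=> //.
    by rewrite /= size_cat /=; clear; lia.
    rewrite /= xp /=; have := path_rev h2; move: h1.
    rewrite !rcons_path !cat_path /= !rcons_path /= => /andP[-> ->] /andP[-> ->] /=.
    by rewrite last_cat /= last_rcons adj_sym.
  have ps : perm_eq [:: x, p & s1 ++ y :: rcons (rev s2) q] (x :: [:: p, q, y & s1 ++ s2]).
    apply/permP => P; rewrite /= !count_cat /= -cats1 count_cat count_rev /=; clear; lia.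
  rewrite (perm_uniq ps) cons_uniq u andbT; apply/negP.
  rewrite !inE; case/or4P => [/eqP xe|/eqP xe|/eqP xe|xe].
  - by rewrite -xe in pz; lia.
  - by rewrite -xe in qz; lia.
  - by move: al; rewrite /= -xe; lia.
  - by move: al => /= /andP[_ /allP/(_ _ xe)]; lia.
have := short c; rewrite /= size_cat /= size_rcons size_rev -e.
case: s1 s2 e {al u} h1 h2 s1n c => [|? s1] [|? s2] //= _; last by lia.
rewrite !andbT => py qy /(_ erefl) yz c _.
exists y; last by lia.
by rewrite /C4; case/and3P: c => _ + ->; rewrite /= andbT.
Qed.

(** The same merging, started from the two ends of an edge, closes a cycle of odd length 3 + 2 *
    size s1; again [s1] is empty. *)
Lemma triangle a b w : adj a b -> ds a w = ds b w -> 0 < ds b w < #|V| ->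
  exists s, is_cycle G [:: a; b; s] /\ (ds s w).+1 = ds b w.
Proof.
move=> ab aw bw.
have [y [s1 [s2 [h1 h2 /andP[u al] e s1n]]]] :=
  @merging_geodesics (ds b w) b a w ltac:(by rewrite eq_sym; apply: adj_neq ab) erefl aw ltac:(lia).
have c : is_cycle G [:: a, b & s1 ++ y :: rev s2].
  apply/and3P; split=> //.
    by rewrite /= size_cat /=; clear; lia.
    move: h1; rewrite /= ab /= rcons_path rcons_cat cat_path /= => /andP[-> ->] /=.
    exact: path_rev h2.
  have ps : perm_eq [:: a, b & s1 ++ y :: rev s2] [:: b, a, y & s1 ++ s2].
    apply/permP => P; rewrite /= !count_cat /= count_rev /=; clear; lia.
  by rewrite (perm_uniq ps).
have := short c; rewrite /= size_cat /= size_rev -e.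
case: s1 s2 e {al u} h1 h2 s1n c => [|? s1] [|? s2] //= _; last by lia.
by move=> _ _ /(_ erefl) yz c _; exists y.
Qed.

Lemma next4 a b c d : uniq [:: a; b; c; d] ->
  [/\ next [:: a; b; c; d] a = b, next [:: a; b; c; d] b = c,
      next [:: a; b; c; d] c = d & next [:: a; b; c; d] d = a].
Proof.
move=> uc; split; first by rewrite /= eqxx.
- by rewrite -(next_rot 1 uc) /= eqxx.
- by rewrite -(next_rot 2 uc) /= eqxx.
- by rewrite -(next_rot 3 uc) /= eqxx.
Qed.

(** By [disj] the edge sets agree, and following the neighbours from [a] leaves only the two
    directions of travel. *)
Lemma C4_uniq a b c d b' c' d' : C4 a b c d -> C4 a b' c' d' ->
  [/\ b' = b, c' = c & d' = d] \/ [/\ b' = d, c' = c & d' = b].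
Proof.
move=> h h'; have e : cyc_edges [:: a; b; c; d] = cyc_edges [:: a; b'; c'; d'].
  by apply: (disj (x := a)); rewrite ?C4_cycle // mem_head.
have uc : uniq [:: a; b; c; d] by case/and5P: h.
have uc' : uniq [:: a; b'; c'; d'] by case/and5P: h'.
have nxt x : x \in [:: a; b'; c'; d'] -> x \in [:: a; b; c; d] ->
    (next [:: a; b'; c'; d'] x == next [:: a; b; c; d] x) ||
    (next [:: a; b'; c'; d'] x == prev [:: a; b; c; d] x).
  by move=> xc' xc; rewrite -mem_cyc_edges // e mem_cyc_edges // eqxx.
have [na nb nc nd] := next4 uc; have [na' nb' nc' nd'] := next4 uc'.
have pn x y : next [:: a; b; c; d] x = y -> prev [:: a; b; c; d] y = x.
  by move=> <-; apply: prev_next.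
have [ac' bd'] : a != c' /\ b' != d'.
  move: uc'; rewrite /= !inE !negb_or => /and3P[/and3P[_ -> _] /andP[_ ->]].
  by [].
have := nxt a; rewrite na' na (pn _ _ nd) !mem_head => /(_ isT isT)/orP[]/eqP e1; subst b'.
  have := nxt b; rewrite nb' nb (pn _ _ na) !inE !eqxx !orbT => /(_ isT isT)/orP[]/eqP e2; subst c'.
    have := nxt c; rewrite nc' nc (pn _ _ nb) !inE !eqxx !orbT => /(_ isT isT)/orP[]/eqP e3; subst d'.
      by left.
    by rewrite eqxx in bd'.
  by rewrite eqxx in ac'.
have := nxt d; rewrite nb' nd (pn _ _ nc) !inE !eqxx !orbT => /(_ isT isT)/orP[]/eqP e2; subst c'.
  by rewrite eqxx in ac'.
have := nxt c; rewrite nc' nc (pn _ _ nb) !inE !eqxx !orbT => /(_ isT isT)/orP[]/eqP e3; subst d'.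
  by rewrite eqxx in bd'.
by right.
Qed.

Lemma C4_triangle a b c d b' c' : C4 a b c d -> is_cycle G [:: a; b'; c'] -> False.
Proof.
move=> h h'; have e : cyc_edges [:: a; b; c; d] = cyc_edges [:: a; b'; c'].
  by apply: (disj (x := a)); rewrite ?C4_cycle // mem_head.
have uc : uniq [:: a; b; c; d] by case/and5P: h.
have uc' : uniq [:: a; b'; c'] by case/and3P: h'.
have [na nb nc nd] := next4 uc.
have nxt x : x \in [:: a; b; c; d] -> x \in [:: a; b'; c'].
  move=> xc; have : [set x; next [:: a; b; c; d] x] \in cyc_edges [:: a; b'; c'].
    by rewrite -e mem_cyc_edges // eqxx.
  by case/imsetP=> z zc /set2_inj[[-> _]|[-> _]] //; rewrite mem_next.
have : size [:: a; b; c; d] <= size [:: a; b'; c'] by apply: uniq_leq_size.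
by [].
Qed.

(* Among the two perfect matchings of a 4-cycle, [matched] is the one containing
   its edge of least rank; by [disj] an edge lies in at most one 4-cycle. *)
Let rk a b := enum_rank [set a; b].

Definition matched a b := [exists c, exists d, C4 a b c d &&
  (minn (rk a b) (rk c d) < minn (rk b c) (rk d a))].

Lemma matchedE a b c d : C4 a b c d ->
  matched a b = (minn (rk a b) (rk c d) < minn (rk b c) (rk d a)).
Proof.
move=> h; apply/idP/idP => [|m].
  move=> /existsP[c' /existsP[d' /andP[h' m]]].
  have [[_ e1 e2]|[e0 e1 e2]] := C4_uniq h h'; subst; first by [].
  by case/and5P: h' => /=; rewrite !inE eqxx !orbT !andbF.
by apply/existsP; exists c; apply/existsP; exists d; rewrite h.
Qed.

Let rkC a b : rk a b = rk b a.
Proof. by rewrite /rk finset.setUC. Qed.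

Lemma matchedC a b c d : C4 a b c d -> matched b a = matched a b.
Proof.
move=> h; rewrite (matchedE h) (matchedE (C4_rot (C4_rot (C4_rot (C4_rev h))))).
by rewrite (rkC b a) (rkC d c) (rkC a d) (rkC c b) [minn (rk d a) _]minnC.
Qed.

(** The four edges have distinct ranks, so the least one lies in exactly one of the two perfect
    matchings. *)
Lemma matched_opp a b c d : C4 a b c d -> matched a d = ~~ matched a b.
Proof.
move=> h; rewrite (matchedE h) (matchedE (C4_rev h)).
rewrite (rkC a d) (rkC c b) (rkC d c) (rkC b a) [minn (rk d a) _]minnC [minn (rk c d) _]minnC.
have /= : uniq [:: a; b; c; d] by case/and5P: h.
rewrite !inE !negb_or => /and4P[/and3P[ab ac ad] /andP[bc bd] cd _].
have ne x y z t : (x != z) || (y != t) -> (x != t) || (y != z) -> rk x y != rk z t :> nat.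
  move=> n1 n2; apply/eqP => /val_inj/enum_rank_inj/set2_inj[[e1 e2]|[e1 e2]].
    by move: n1; rewrite e1 e2 !eqxx.
  by move: n2; rewrite e1 e2 !eqxx.
have n1 : rk a b != rk b c :> nat by apply: ne; rewrite ?ab ?ac.
have n2 : rk a b != rk d a :> nat by apply: ne; rewrite ?ad ?bd ?orbT.
have n3 : rk c d != rk b c :> nat by apply: ne; rewrite ?(eq_sym c b) ?(eq_sym d b) ?bc ?bd ?orbT.
have n4 : rk c d != rk d a :> nat by apply: ne; rewrite ?cd // (eq_sym c a) ac.
move: n1 n2 n3 n4; move: (nat_of_ord (rk a b)) (nat_of_ord (rk b c)) (nat_of_ord (rk c d)) (nat_of_ord (rk d a)).
by clear => n1 n2 n3 n4; lia.
Qed.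

(* When two geodesics from x to z start differently, their first steps are the two
   neighbours of x on a 4-cycle, and the matched one is taken. *)
Definition cstep x z :=
  if [pick p | geo_step x z p && matched x p] is Some p then p
  else if [pick p | geo_step x z p] is Some p then p else x.

(** This is the relation used for [cross]: whenever the canonical choice overrides another first
    step, a matched edge replaces an unmatched one. *)
Definition unmatched a b := [exists c, exists d, C4 a b c d] && ~~ matched a b.

Lemma cstepP x z : 0 < ds x z < #|V| -> geo_step x z (cstep x z).
Proof.
move=> /geo_step_ex[p0 hp0]; rewrite /cstep; case: pickP => [p /andP[]//|_].
by case: pickP => // /(_ p0); rewrite hp0.
Qed.

(** By [square], [p] and the canonical step are the two neighbours of [x] on a 4-cycle, and exactly
    one of these edges is matched; [cstep] looks for a matched one before any other. *)
Lemma cstep_other x z p : 1 < ds x z < #|V| -> geo_step x z p -> p != cstep x z ->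
  exists s, [/\ C4 x p s (cstep x z), (ds s z).+2 = ds x z, matched x (cstep x z) & ~~ matched x p].
Proof.
move=> xz xp ne; have xu := cstepP (z := z) (x := x) ltac:(lia).
have [s h sz] := square xp xu ne xz; exists s.
have mx : matched x (cstep x z).
  move: xu ne h; rewrite /cstep; case: pickP => [q /andP[]//|nm].
  case: pickP => [q xq _ _ h|nn]; last by rewrite nn in xp.
  by have := matched_opp h; have := nm p; rewrite xp => /= -> ->.
by split=> //; have := matched_opp h; rewrite mx; case: matched.
Qed.


Lemma adj_ds a b z : adj a b -> ds a z <= (ds b z).+1 /\ ds b z <= (ds a z).+1.
Proof.
move=> ab; have := ds_tri G b a z; have := ds_tri G a b z.
by rewrite [ds b a]ds_sym (ds1 ab) !add1n.
Qed.

Lemma adj_conn a b z : adj a b -> ds b z < #|V| -> ds a z < #|V|.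
Proof. by move=> ab; apply: conn_trans; apply: conn1 ab. Qed.

Lemma cstep_cross a b c : adj a b -> adj b c -> ds a c = 2 -> b != cstep a c ->
  unmatched a b /\ ~~ unmatched a (cstep a c).
Proof.
move=> ab bc ac ne.
have ac1 : 1 < ds a c < #|V| by rewrite {1}ac (adj_conn ab (conn1 bc)).
have Nacb : geo_step a c b by apply/geo_stepP; rewrite (ds1 bc) ac.
have [s [h _ m nm]] := cstep_other ac1 Nacb ne.
split; last by rewrite /unmatched m andbF.
by rewrite /unmatched nm andbT; apply/existsP; exists s; apply/existsP; exists (cstep a c).
Qed.

(** Let [c] be the canonical step from [b] to [z]. If [ds a z] is [ds b z] plus 1, a canonical step
    from [a] other than [b] gives a 4-cycle that contradicts the matching or disjointness. If the
    distances are equal, a triangle shares [b] with a 4-cycle. If [ds a z] is smaller, [a] and [c]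
    are both first steps from [b], and the edge ab would be matched as seen from [a] and not matched
    as seen from [b]. *)
Lemma cstep_down a b z : adj a b -> 1 < ds b z < #|V| ->
  ds a (cstep b z) = 2 -> b = cstep a (cstep b z) ->
  ds a z = (ds b z).+1 /\ b = cstep a z.
Proof.
move=> ab bz; have /geo_stepP := cstepP (x := b) (z := z) ltac:(lia).
move cE : (cstep b z) => c [bc cz] ac bu.
have azV : ds a z < #|V| by apply: adj_conn ab _; lia.
have ac1 : 1 < ds a c < #|V| by rewrite {1}ac (adj_conn ab (conn1 bc)).
have [u1 u2] := adj_ds z ab.
have Nacb : geo_step a c b by apply/geo_stepP; rewrite (ds1 bc) ac.
have Nbzc : geo_step b z c by apply/geo_stepP.
have other e : geo_step a c e -> e != b -> matched a b.
  by move=> h1; rewrite {1}bu => h2; have [_ [_ _ + _]] := cstep_other ac1 h1 h2; rewrite -bu.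
have [az|az] := eqVneq (ds a z) (ds b z).+1.
  split=> //; apply/eqP/negPn/negP => ne.
  have az1 : 1 < ds a z < #|V| by clear -az azV bz; lia.
  have Nazb : geo_step a z b by apply/geo_stepP; rewrite az.
  have [s [h sz m nm]] := cstep_other az1 Nazb ne.
  move: h m ne; move: (cstep a z) => e h m ne.
  have [_ _ bs se ea] := and5P h.
  have [sc|sc] := eqVneq s c.
    case/negP: nm; apply: (other e); last by rewrite eq_sym.
    have es : adj e c by rewrite -sc adj_sym.
    by apply/geo_stepP; rewrite adj_sym ea (ds1 es) ac.
  have Nbzs : geo_step b z s by apply/geo_stepP; split=> //; clear -sz az; lia.
  rewrite -cE in sc; have [s' [h' _ _ _]] := cstep_other bz Nbzs sc.
  rewrite cE in h'; have [[e1 _ e3]|[e1 _ e3]] := C4_uniq (C4_rot h) h'.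
    by move: ac; rewrite e3 dsxx.
  by case/and5P: h; rewrite e1 /= !inE eqxx !orbT.
have [azb|azb] := eqVneq (ds a z) (ds b z).
  have [s [h sz]] := triangle ab azb ltac:(lia).
  have [_ + _] := and3P h; rewrite /= => /and4P[_ bs sa _].
  have Nbzs : geo_step b z s by apply/geo_stepP.
  have sc : s != c.
    apply/eqP => e; move: ac; rewrite -e ds_sym (ds1 sa); lia.
  rewrite -cE in sc; have [s' [h' _ _ _]] := cstep_other bz Nbzs sc.
  case: (C4_triangle h' (b' := s) (c' := a)).
  by move: h; rewrite /is_cycle -(rot_cycle 1) -(rot_uniq 1).
have Nbza : geo_step b z a by apply/geo_stepP; rewrite adj_sym; split=> //; clear -u1 u2 az azb; lia.
have ac' : a != cstep b z by rewrite cE -(ds_eq0 G) ac.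
have [s [h sz m nm]] := cstep_other bz Nbza ac'; rewrite cE in h m.
have [_ _ as_ sc cb] := and5P h.
have h2 := C4_rot h.
have sb : s != b by rewrite eq_sym; move: h; rewrite /C4 /= !inE !negb_or => /and5P[/and4P[/and3P[_ -> _]]].
have mab : matched a b.
  apply: (other s) => //; apply/geo_stepP; rewrite (ds1 sc) ac.
  by case/and5P: h2.
have h3 : C4 b a s c by exact: h.
by case/negP: nm; rewrite (matchedC (C4_rev (C4_rot h))).
Qed.

(** If the canonical step from [a] to [c] were some [e] other than [b], then [e] would also start a
    geodesic from [a] to [z], and both ab and ae would be matched edges of one 4-cycle. *)
Lemma cstep_up a b z : adj a b -> 1 < ds b z < #|V| ->
  ds a z = (ds b z).+1 -> b = cstep a z ->
  ds a (cstep b z) = 2 /\ b = cstep a (cstep b z).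
Proof.
move=> ab bz; have /geo_stepP := cstepP (x := b) (z := z) ltac:(lia).
move cE : (cstep b z) => c [bc cz] az bu.
have azV : ds a z < #|V| by apply: adj_conn ab _; lia.
have ac : ds a c = 2.
  have [_ u2] := adj_ds c ab; have [u3 _] := adj_ds c ab.
  by have := ds_tri G c a z; have := ds1 bc; lia.
split=> //; apply/eqP/negPn/negP => ne.
have ac1 : 1 < ds a c < #|V| by rewrite {1}ac (adj_conn ab (conn1 bc)).
have Nacb : geo_step a c b by apply/geo_stepP; rewrite (ds1 bc) ac.
have [s [h sc m nm]] := cstep_other ac1 Nacb ne.
have s0 : s = c by apply/eqP; rewrite -(ds_eq0 G); clear -sc ac; lia.
move: h m ne; rewrite s0; move: (cstep a c) => e h m ne.
have [_ _ _ ce ea] := and5P h.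
have Naze : geo_step a z e.
  apply/geo_stepP; rewrite adj_sym ea; split=> //.
  have [u1 v1] := adj_ds z ea; have [u2 v2] := adj_ds z ce; clear -u1 v1 u2 v2 az cz; lia.
have az1 : 1 < ds a z < #|V| by clear -az azV bz; lia.
rewrite bu eq_sym in ne.
have [_ [_ _ mb _]] := cstep_other az1 Naze ne.
by move: (matched_opp h); rewrite m bu mb.
Qed.

Lemma cstep_step a b z : adj a b -> 1 < ds b z < #|V| ->
  (ds a (cstep b z) == 2) && (b == cstep a (cstep b z)) = (ds a z == (ds b z).+1) && (b == cstep a z).
Proof.
move=> ab bz; apply/idP/idP => /andP[/eqP h1 /eqP h2].
  by have [e1 e2] := cstep_down ab bz h1 h2; rewrite e1 -e2 !eqxx.
by have [e1 e2] := cstep_up ab bz h1 h2; rewrite e1 -e2 !eqxx.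
Qed.

(** The only configuration that survives is a 4-cycle b, a, s, c with [w] behind [s], where [a] is a
    first step from [b] to [w]. The edge ab is matched, because [s] is another first step from [a]
    to [c] while [b] is canonical; so bc is not matched, and [cstep b w] is [a]. *)
Lemma cstep_cut a b c w : adj a b -> ds b c < #|V| -> ds c w < #|V| ->
  b != c -> c != w -> ds a c = (ds b c).+1 -> b = cstep a c -> ds b w = ds b c + ds c w ->
  ~~ ((ds a w == (ds b w).+1) && (b == cstep a w)) ->
  unmatched b c /\ ~~ unmatched b (cstep b w).
Proof.
move=> ab bcV cwV; rewrite -(ds_eq0 G) -lt0n => bc0; rewrite -(ds_eq0 G) -lt0n => cw0 ac bu bw na.
have acV : ds a c < #|V| by apply: adj_conn ab _.
have bwV : ds b w < #|V| by apply: conn_trans bcV cwV.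
have awV : ds a w < #|V| by apply: adj_conn ab _.
have ac1 : 1 < ds a c < #|V| by clear -ac bc0 acV; lia.
have bw1 : 1 < ds b w < #|V| by clear -bw bc0 cw0 bwV; lia.
have [u1 u2] := adj_ds w ab.
have other e : geo_step a c e -> e != b -> matched a b.
  by move=> h1; rewrite {1}bu => h2; have [_ [_ _ + _]] := cstep_other ac1 h1 h2; rewrite -bu.
have [f Nbcf] : exists f, geo_step b c f by apply: geo_step_ex; rewrite bc0.
have [bf fc] := geo_stepP _ _ _ Nbcf.
have fw : (ds f w).+1 = ds b w.
  by have [v1 v2] := adj_ds w bf; have := ds_tri G c f w; lia.
have Nbwf : geo_step b w f by apply/geo_stepP.
have far s : adj a s -> ds b c <= ds s c by move=> as_; have [v1 _] := adj_ds c as_; lia.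
have [aw|aw] := eqVneq (ds a w) (ds b w).+1.
  rewrite aw eqxx /= in na.
  have aw1 : 1 < ds a w < #|V| by clear -aw awV bw1; lia.
  have Nawb : geo_step a w b by apply/geo_stepP; rewrite aw.
  have [s [h sw m nm]] := cstep_other aw1 Nawb na.
  move: h m na; move: (cstep a w) => e h m na.
  have [_ _ bs se ea] := and5P h.
  have [fs|fs] := eqVneq f s.
    case/negP: nm; apply: (other e); last by rewrite eq_sym.
    apply/geo_stepP; rewrite adj_sym ea; split=> //.
    have [v1 v3] := adj_ds c ea.
    by have [_ v2] := adj_ds c se; rewrite -fs in v2; clear -v1 v2 v3 ac fc; lia.
  have Nbws : geo_step b w s by apply/geo_stepP; split=> //; clear -sw aw; lia.
  have [s' h' _] := square Nbwf Nbws fs bw1.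
  have fa : f != a by apply/eqP => e'; move: fc; rewrite e' ac; clear; lia.
  have [[e1 _ e3]|[e1 _ e3]] := C4_uniq (C4_rot h) h'.
    by rewrite e1 eqxx in fs.
  by rewrite e1 eqxx in fa.
have [awb|awb] := eqVneq (ds a w) (ds b w).
  have [s [h sw]] := triangle ab awb ltac:(lia).
  have [_ + _] := and3P h; rewrite /= => /and4P[_ bs sa _].
  have Nbws : geo_step b w s by apply/geo_stepP.
  have fs : f != s.
    by apply/eqP => e; have := far s; rewrite adj_sym sa -e => /(_ isT); clear -fc; lia.
  have [s' h' _] := square Nbwf Nbws fs bw1.
  case: (C4_triangle (C4_rev h') (b' := s) (c' := a)).
  by move: h; rewrite /is_cycle -(rot_cycle 1) -(rot_uniq 1).
have Nbwa : geo_step b w a by apply/geo_stepP; rewrite adj_sym; split=> //; clear -u1 u2 aw awb; lia.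
have fa : f != a by apply/eqP => e'; move: fc; rewrite e' ac; clear; lia.
have [s h sw] := square Nbwa Nbwf ltac:(by rewrite eq_sym) bw1.
have [_ _ as_ sf _] := and5P h.
(* If the geodesic from [f] to [c] went on through some [g], then [g] and [s] would be two first
   steps from [f] to [w] and would span a second 4-cycle at [f]. *)
have fc1 : f = c.
  apply/eqP/negPn/negP; rewrite -(ds_eq0 G) -lt0n => fc0.
  have [g Nfcg] : exists g, geo_step f c g by apply: geo_step_ex; clear -fc0 fc bcV; lia.
  have [fg gc] := geo_stepP _ _ _ Nfcg.
  have Nfwg : geo_step f w g.
    by apply/geo_stepP; split=> //; have [v1 v2] := adj_ds w fg; have := ds_tri G c g w; clear -v1 v2 fw gc fc bw; lia.
  have Nfws : geo_step f w s by apply/geo_stepP; rewrite adj_sym; split=> //; clear -sw fw; lia.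
  have gs : g != s by apply/eqP => e; have := far s as_; rewrite -e; clear -gc fc; lia.
  have [s' h' _] := square Nfwg Nfws gs ltac:(clear -fw bw fc fc0 bwV cw0; lia).
  have [[e1 _ e3]|[e1 _ e3]] := C4_uniq (C4_rot (C4_rot (C4_rot h))) h'.
    have [] : ds g w = ds b w by rewrite e1.
    by have [v1 v2] := adj_ds w fg; have := ds_tri G c g w; clear -gc fc bw bc0 fw; lia.
  by rewrite e1 eqxx in gs.
rewrite fc1 in h fc sf bf.
have Nacb : geo_step a c b by apply/geo_stepP; rewrite (ds1 bf) ac (ds1 bf).
have Nacs : geo_step a c s by apply/geo_stepP; rewrite as_ (ds1 sf) ac (ds1 bf).
have sb : s != b by apply/eqP => e; case/and5P: h; rewrite e /= !inE eqxx !orbT.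
have mba : matched b a by rewrite -(matchedC h); apply: (other s).
have mbc : ~~ matched b c by rewrite (matched_opp h) mba.
split.
  by rewrite /unmatched mbc andbT; apply/existsP; exists s; apply/existsP; exists a; apply: C4_rev.
suff <- : a = cstep b w by rewrite /unmatched mba andbF.
apply/eqP/negPn/negP => ne; have [s' [h' _ m _]] := cstep_other bw1 Nbwa ne.
by have := matched_opp h'; rewrite m mba.
Qed.

Theorem short_cycles_diagonal : diagonal_graph G.
Proof.
apply: (@certificate_diagonal _ _ cstep unmatched).
- by move=> x z xz; have /geo_stepP : geo_step x z (cstep x z) by apply: cstepP; lia.
- exact: cstep_step.
- exact: cstep_cut.
- exact: cstep_cross.
Qed.

End ShortCycles.

(** * Non-diagonality from an edge of large finite local girth *)

Section SliceArith.
Set Implicit Arguments.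
Unset Strict Implicit.
Local Open Scope nat_scope.

(** Lower-case names are distances in the graph, capitals those in the graph without the edge ab,
    and [m] is the latter distance from a to b, one less than the length of a shortest cycle through
    ab. The last five premises list how a geodesic may cross the edge: not at all, from a to b, or
    from b to a. *)
Lemma slice_arith (ap pq qw aq pw Ap Pq Qw Aq Pw Pb Qb Wb Aw m : nat) :
  0 < ap -> 0 < pq -> 0 < qw -> ap + pq + qw = Aw -> 3 < m ->
  m.+1 <= 2 * Aw <= m.+2 -> Aw + Wb = m ->
  ap <= Ap -> pq <= Pq -> qw <= Qw -> aq <= Aq -> pw <= Pw ->
  aq <= ap + pq -> pw <= pq + qw ->
  m <= Aq + Qb -> m <= Ap + Pb -> Qb <= Pq + Pb -> Pb <= Pq + Qb ->
  Aw <= Aq + Qw -> Aw <= Ap + Pw -> Pw <= Pq + Qw -> Aq <= Ap + Pq -> Wb <= Qw + Qb ->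
  [\/ Ap <= ap, Pb.+1 <= ap | m + Ap.+1 <= ap] ->
  [\/ Pq <= pq, Ap + Qb.+1 <= pq | Pb + Aq.+1 <= pq] ->
  [\/ Qw <= qw, Aq + Wb.+1 <= qw | Qb + Aw.+1 <= qw] ->
  [\/ Aq <= aq, Qb.+1 <= aq | m + Aq.+1 <= aq] ->
  [\/ Pw <= pw, Ap + Wb.+1 <= pw | Pb + Aw.+1 <= pw] ->
  (aq == ap + pq) && (Aq + Qw == Aw) = (pw == pq + qw) && (Ap + Pw == Aw).
Proof.
move=> h1 h2 h3 h4 h5 h6 h7 h8 h9 h10 h11 h12 h13 h14 h15 h16 h17 h18 h19 h20 h21 h22 h23.
move=> [e1|e1|e1]; [| |lia].
all: move=> [e2|e2|e2].
all: move=> [e3|e3|e3].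
all: try lia.
all: move=> [e4|e4|e4]; [| |lia].
all: move=> [e5|e5|e5].
all: lia.
Qed.

End SliceArith.

(** * Distances without an edge, and a functional vanishing on boundaries *)

Section EdgeDeletion.
Set Implicit Arguments.
Unset Strict Implicit.
Unset Printing Implicit Defensive.
Local Open Scope nat_scope.
Variables (V : finType) (G : sgraph V).

Fact rem_edges_proof (F : {set {set V}}) : [forall e in edges G :\: F, #|e| == 2].
Proof.
apply/forall_inP => e; rewrite finset.in_setD => /andP[_].
by move: e; apply/forall_inP/edges_card.
Qed.

Definition rem_edges F := SGraph (rem_edges_proof F).

Variables (a b : V).
Definition del_edge := rem_edges [set [set a; b]].
Local Notation d := (ds G).
Local Notation D := (ds del_edge).

Lemma del_edge_adj x y : adj del_edge x y = adj G x y && ([set x; y] != [set a; b]).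
Proof. by rewrite /adj in_setD1 andbC. Qed.

Lemma ds_del_edge x y : d x y <= D x y.
Proof.
have [/ds_path[s [ps _ ls <-]]|h] := ltnP (D x y) #|V|; last exact: leq_trans (ds_le _ _ _) h.
rewrite -ls; apply: ds_walk; apply: sub_path ps => u v.
by rewrite del_edge_adj => /andP[].
Qed.

Hypothesis ab : adj G a b.

Lemma ds_through_edge x y : d x y < #|V| ->
  [\/ D x y <= d x y, D x a + (D b y).+1 <= d x y | D x b + (D a y).+1 <= d x y].
Proof.
move nE : (d x y) => n; elim: n x nE => [|n IH] x xy nV.
  move/eqP: xy; rewrite ds_eq0 => /eqP ->.
  by constructor 1; rewrite dsxx.
have [u xu uy] := ds_first xy nV.
have {IH} := IH u uy (ltnW nV).
have [/set2_inj[[-> ->]|[-> ->]]|ne] := eqVneq [set x; u] [set a; b].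
- rewrite !dsxx => -[h|h|h]; [constructor 2|constructor 2|constructor 1]; lia.
- rewrite !dsxx => -[h|h|h]; [constructor 3|constructor 1|constructor 3]; lia.
have xu1 : D x u = 1 by apply: ds1; rewrite del_edge_adj xu.
have t1 := ds_tri del_edge u x y; have t2 := ds_tri del_edge u x a.
have t3 := ds_tri del_edge u x b.
case=> h; [constructor 1|constructor 2|constructor 3]; lia.
Qed.

Hypothesis no_triangle : forall x, adj G a x -> adj G x b -> False.
Hypothesis no_square : forall x y, adj G a x -> adj G x y -> adj G y b -> x = b \/ y = a.
Hypothesis conn : D a b < #|V|.

Lemma del_edge_far : 4 <= D a b.
Proof.
rewrite leqNgt; apply/negP => h; have [s [ps us ls sz]] := ds_path conn.
have nab : adj del_edge a b = false by rewrite del_edge_adj eqxx andbF.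
case: s ps us ls sz => [|x [|y [|z [|t s]]]] /=.
- by move=> _ _ e; have := adj_neq ab; rewrite e eqxx.
- by move=> + _ e _; rewrite e nab.
- rewrite !del_edge_adj => /and3P[/andP[ax _] /andP[xy _] _] _ e _.
  by apply: (no_triangle ax); rewrite -e.
- rewrite !del_edge_adj => /and4P[/andP[ax n1] /andP[xy _] /andP[yz n2] _] _ e _.
  rewrite e in yz n2; have [e2|e2] := no_square ax xy yz.
    by rewrite e2 eqxx in n1.
  by rewrite e2 eqxx in n2.
- by move=> _ _ _ sz; rewrite -sz in h.
Qed.

Lemma geodesic_point (H : sgraph V) x y i : ds H x y < #|V| -> i <= ds H x y ->
  exists w, ds H x w = i /\ i + ds H w y = ds H x y.
Proof.
elim: i x => [|i IH] x xyV ixy; first by exists x; rewrite dsxx.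
case xyE : (ds H x y) => [|n]; first by rewrite xyE in ixy.
have [u xu un] := ds_first xyE ltac:(lia).
have [w [uw wy]] := IH u ltac:(lia) ltac:(lia).
exists w; split; last by lia.
have := ds_tri H u x w; rewrite (ds1 xu) uw => h1.
by have := ds_tri H w x y; lia.
Qed.

(** A shortest cycle through the edge has length [D a b] plus 1; rounding its half up accounts for
    the shift by 2. *)
Let l := (D a b).+2./2.

Lemma halfE : 2 * l = (D a b).+1 \/ 2 * l = (D a b).+2.
Proof. by rewrite /l; have := odd_double_half (D a b).+2; case: odd; lia. Qed.

Section Slice.
Variable w : V.
Hypothesis aw : D a w = l.
Hypothesis wb : l + D w b = D a b.

(** The two sides are the contributions to the functional of the faces (a, q, w) and (a, p, w) of
    the tuple (a, p, q, w). These faces carry opposite signs, so equality makes the functional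
    vanish on boundaries. *)
Lemma slice_symm p q : 0 < d a p -> 0 < d p q -> 0 < d q w ->
  d a p < #|V| -> d p q < #|V| -> d q w < #|V| -> d a p + d p q + d q w = l ->
  (d a q == d a p + d p q) && (D a q + D q w == l) =
  (d p w == d p q + d q w) && (D a p + D p w == l).
Proof.
move=> ap0 pq0 qw0 apV pqV qwV lE.
have Aap := ds_through_edge apV; have Apq := ds_through_edge pqV; have Aqw := ds_through_edge qwV.
have Aaq := ds_through_edge (conn_trans apV pqV).
have Apw := ds_through_edge (conn_trans pqV qwV).
have Lap := ds_del_edge a p; have Lpq := ds_del_edge p q; have Lqw := ds_del_edge q w.
have Laq := ds_del_edge a q; have Lpw := ds_del_edge p w.
have far := del_edge_far; have hl := halfE.
have sym x y : D x y = D y x by apply: ds_sym.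
have T1 := ds_tri G p a q; have T2 := ds_tri G q p w.
have T3 := ds_tri del_edge q a b; have T4 := ds_tri del_edge p a b.
have T5 := ds_tri del_edge p q b; have T6 := ds_tri del_edge q p b.
have T7 := ds_tri del_edge q a w; have T8 := ds_tri del_edge p a w.
have T9 := ds_tri del_edge q p w; have T10 := ds_tri del_edge p a q.
have T11 := ds_tri del_edge q w b.
rewrite !dsxx !add0n (sym b p) (sym p a) (sym b q) (sym q a) (sym b w) in Aap Apq Aqw Aaq Apw.
rewrite (sym q p) in T5; rewrite (sym w q) in T11.
rewrite -aw in lE hl *; have wb' := wb; rewrite -[X in (X + _)%N]aw in wb'.
have hl' : (D a b).+1 <= 2 * D a w <= (D a b).+2 by case: hl => ->; rewrite leqnn leqnSn.
exact: (slice_arith ap0 pq0 qw0 lE far hl' wb' Lap Lpq Lqw Laq Lpw T1 T2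
  T3 T4 T5 T6 T7 T8 T9 T10 T11 Aap Apq Aqw Aaq Apw).
Qed.

(** On a shortest cycle through the edge, the only rival of an arc avoiding ab is the complementary
    arc. It is never shorter for the pairs (a, v), (v, w) and (b, w), but it may be for (a, w). *)
Lemma slice_dist v : D a v = 1 -> 1 + D v w = l ->
  [/\ d a v = 1, d v w = D v w, d b w = D b w & d a w = minn l (D b w).+1].
Proof.
move=> av vw.
have far := del_edge_far; have hl := halfE.
have sym x y : D x y = D y x by apply: ds_sym.
have dv : d a v = 1 by have := ds_del_edge a v; rewrite av; case E : (d a v) => [|[|]] // _;
  move/eqP: E; rewrite ds_eq0 => /eqP e; move: av; rewrite -e dsxx.
have vwV : d v w < #|V| by apply: leq_ltn_trans (ds_del_edge v w) _; lia.
have bwV : d b w < #|V| by apply: leq_ltn_trans (ds_del_edge b w) _; rewrite sym; lia.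
have awV : d a w < #|V| by apply: leq_ltn_trans (ds_del_edge a w) _; lia.
have Avw := ds_through_edge vwV; have Abw := ds_through_edge bwV.
have Aaw := ds_through_edge awV.
have L1 := ds_del_edge v w; have L2 := ds_del_edge b w; have L3 := ds_del_edge a w.
have T0 : d a w <= (D b w).+1 by have := ds_tri G b a w; rewrite (ds1 ab); lia.
rewrite !dsxx (sym v a) (sym b a) in Avw Abw Aaw.
have wb' := wb; rewrite sym in wb'.
split=> //.
- by clear -Avw L1 vw av wb' hl far aw; case: Avw => h; lia.
- by clear -Abw L2 vw av wb' hl far aw; case: Abw => h; lia.
- by clear -Aaw L3 vw av wb' hl far aw T0; case: Aaw => h; lia.
Qed.
End Slice.

Local Open Scope ring_scope.

Let slice w (t : 3.-tuple V) : int :=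
  ([&& vtx t 0 == a, vtx t 2 == w & (D a (vtx t 1) + D (vtx t 1) w == l)%N] : nat)%:Z.

Lemma slice_bdry w (y : MC_gen G 3 l) : D a w = l -> (l + D w b)%N = D a b ->
  \sum_(x : MC_gen G 2 l) bdry_coef y x * slice w (val x) = 0.
Proof.
move=> aw wb.
have gy : vgen G l (vtx (val y)) 3 by apply/is_genP; apply: valP.
pose S i : int := if vsmooth G (vtx (val y)) i then slice w (tup 2 (vtx (val y) \o bump i)) else 0.
have E i : (0 < i < 3)%N -> \sum_(x : MC_gen G 2 l)
    (if tval (val x) == delete i (val y) then (-1) ^+ i else 0) * slice w (val x) = (-1) ^+ i * S i.
  move=> i3; rewrite /S; case: ifP => sm; last first.
    rewrite mulr0 big1 // => x _; case: eq_deleteP => [|e|_]; [lia| |by rewrite mul0r].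
    have [_ _ xl] : vgen G l (vtx (val x)) 2 by apply/is_genP; apply: valP.
    move: sm; rewrite (@vgen_delete_smooth _ G l _ 2) // -[RHS]xl.
    by apply: eq_vlen => j jk; rewrite /= e.
  have gt : is_gen G l (tup 2 (vtx (val y) \o bump i)).
    apply/is_genP; apply: (@eq_vgen _ _ _ (vtx (val y) \o bump i)); last exact: vgen_delete.
    by move=> j jk; rewrite vtx_tup.
  rewrite (bigD1 (exist (fun w => is_gen G l w) _ gt : MC_gen G 2 l)) //=.
  rewrite [X in _ + X]big1 ?addr0 => [|x xN].
    rewrite ifT //; apply: (introT (@eq_deleteP _ _ (val y) (tup 2 (vtx (val y) \o bump i)) i _)); first lia.
    by move=> j jk; rewrite vtx_tup.
  case: eqP => [e|_]; last by rewrite mul0r.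
  by case/eqP: xN; apply: val_inj => /=; apply: val_inj; rewrite /= e delete_tup //; lia.
rewrite /bdry_coef; under eq_bigr do rewrite mulr_suml.
rewrite exchange_big; transitivity (\sum_(1 <= i < 3) (-1) ^+ i * S i).
  by apply: eq_big_nat => i i3; apply: E.
rewrite big_ltn // big_nat1 expr1 sqrrN expr1n mulN1r mul1r.
apply/eqP; rewrite addrC subr_eq0; apply/eqP.
rewrite /S /slice /vsmooth !vtx_tup // /bump.
clear E S; move: gy; move: (vtx (val y)) => v gy /=; rewrite !addn0 !add0n.
have [ne cn vl] := gy.
have [v0|v0] := eqVneq (v 0%N) a; last by rewrite !if_same.
have [v3|v3] := eqVneq (v 3%N) w; last by rewrite !if_same.
have c i : (0 < i <= 3)%N -> (0 < d (v i.-1) (v i) < #|V|)%N.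
  by move=> i3; rewrite cn // lt0n ds_eq0 ne.
have /andP[c1 c1'] := c 1%N isT; have /andP[c2 c2'] := c 2%N isT; have /andP[c3 c3'] := c 3%N isT.
have := @slice_symm w aw wb (v 1%N) (v 2%N); rewrite -v0 -v3.
move=> /(_ c1 c2 c3 c1' c2' c3') ss; have := ss.
have -> : (d (v 0) (v 1) + d (v 1) (v 2) + d (v 2) (v 3))%N = l.
  by rewrite -vl /vlen 3?big_ltn // big_geq // addn0 addnA.
move=> /(_ erefl); clear ss.
by do 2!case: (d _ _ == _) => /=; [move=> <-|move=> ->|move=> <-|].
Qed.

(* With m the length of a shortest cycle through the edge, l is m/2 rounded up and w
   sits at distance l from a along that cycle, away from b; the chain is the
   tuple (a, v, w) around the cycle, corrected by (a, b, w) when m is even. *)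
Theorem long_cycle_nondiagonal : ~ diagonal_graph G.
Proof.
move=> diag.
have far := del_edge_far; have hl := halfE.
have [w [aw wb]] := @geodesic_point del_edge a b l conn ltac:(clear -hl far; lia).
have [v [av vw]] := @geodesic_point del_edge a w 1 ltac:(rewrite aw; clear -conn hl far; lia) ltac:(clear -aw hl far; lia).
rewrite aw in vw.
have [dav dvw dbw daw] := slice_dist aw wb av vw.
have wbs : D b w = D w b by apply: ds_sym.
pose t1 : nat -> V := fun i => nth a [:: a; v; w] i.
pose t2 : nat -> V := fun i => nth a [:: a; b; w] i.
have g1 : vgen G l t1 2.
  have dvw1 : (0 < d v w)%N by rewrite dvw; clear -vw hl far; lia.
  have dvw2 : (d v w < #|V|)%N by rewrite dvw; clear -vw hl far conn; lia.
  have dav1 : (0 < d a v < #|V|)%N by rewrite dav; clear -conn far; lia.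
  have step i : (0 < i <= 2)%N -> (0 < d (t1 i.-1) (t1 i) < #|V|)%N.
    by case: i => [|[|[|i]]] //= _; rewrite dvw1.
  split=> [i i2|i i2|].
  - by rewrite -(ds_eq0 G) -lt0n; have /andP[] := step i i2.
  - by have /andP[] := step i i2.
  - by rewrite /vlen 2?big_ltn // big_geq // addn0 /= dav dvw.
have [x1 x1E] : {x : MC_gen G 2 l | forall j, (j <= 2)%N -> vtx (val x) j = t1 j}.
  have gt : is_gen G l (tup 2 t1).
    by apply/is_genP; apply: eq_vgen g1 => j jk; rewrite vtx_tup.
  by exists (exist (fun w => is_gen G l w) _ gt) => j jk; rewrite /= vtx_tup.
have [f2 [f2P f2s]] : exists f2 : MC G 2 l, (\sum_(x : MC_gen G 2 l) f2 x * slice w (val x) = 0) /\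
    (forall y : MC_gen G 1 l, \sum_x f2 x * bdry_coef x y = bdry_coef x1 y).
  (* If [d a w] is not [l], deleting the middle vertex shortens the tuple, so (a, v, w) is already a
     cycle and the correction is 0. *)
  have [aw'|aw'] := eqVneq (d a w) l; last first.
    exists 0; split=> [|y]; first by rewrite big1 // => x _; rewrite ffunE mul0r.
    rewrite big1 => [|x _]; last by rewrite ffunE mul0r.
    rewrite /bdry_coef big_nat1; case: eq_deleteP => // e; case/eqP: aw'.
    have [_ _ <-] : vgen G l (vtx (val y)) 1 by apply/is_genP; apply: valP.
    by rewrite /vlen big_nat1 !e // !x1E.
  have bwl : ((d b w).+1 = l)%N by clear -wb wbs dbw daw aw' hl far; lia.
  have g2 : vgen G l t2 2.
    have dab := ds1 ab.
    have dab1 : (0 < d a b < #|V|)%N by rewrite dab; clear -conn far; lia.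
    have dbw1 : (0 < d b w)%N by clear -bwl hl far; lia.
    have dbw2 : (d b w < #|V|)%N by clear -bwl conn hl far; lia.
    have step i : (0 < i <= 2)%N -> (0 < d (t2 i.-1) (t2 i) < #|V|)%N.
      by case: i => [|[|[|i]]] //= _; rewrite dbw1.
    split=> [i i2|i i2|].
    - by rewrite -(ds_eq0 G) -lt0n; have /andP[] := step i i2.
    - by have /andP[] := step i i2.
    - by rewrite /vlen 2?big_ltn // big_geq // addn0 /= dab add1n.
  have gt : is_gen G l (tup 2 t2).
    by apply/is_genP; apply: eq_vgen g2 => j jk; rewrite vtx_tup.
  pose x2 : MC_gen G 2 l := exist (fun w => is_gen G l w) _ gt.
  have x2E j : (j <= 2)%N -> vtx (val x2) j = t2 j by move=> j2; rewrite /= vtx_tup.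
  exists [ffun x => (x == x2)%:Z]; split=> [|y].
    rewrite (bigD1 x2) //= ffunE eqxx mul1r big1 ?addr0 => [|x /negbTE xN]; last by rewrite ffunE xN mul0r.
    rewrite /slice !x2E //=.
    (* Without the edge, passing through b is longer than [l]: the correction is invisible to the
       functional. *)
    have -> : (D a b + D b w == l)%N = false by apply/eqP; clear -hl far; lia.
    by rewrite !andbF.
  rewrite (bigD1 x2) //= ffunE eqxx mul1r big1 ?addr0 => [|x /negbTE xN]; last by rewrite ffunE xN mul0r.
  rewrite /bdry_coef !big_nat1.
  have -> : delete 1 (val x2) = delete 1 (val x1); last by [].
  by rewrite !delete_tup //; congr tval; apply: vtx_inj => -[|[|j]] // _; rewrite !vtx_tup //= ?x1E ?x2E.
pose z : MC G 2 l := [ffun x => (x == x1)%:Z - f2 x].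
have zc : bdry z = 0.
  apply/ffunP => y; rewrite bdryE [RHS]ffunE.
  under eq_bigr do rewrite ffunE mulrBl.
  rewrite sumrB f2s (bigD1 x1) //= eqxx mul1r big1 ?addr0 ?subrr // => x /negbTE ->.
  by rewrite mul0r.
have [g gz] : exists g : MC G 3 l, bdry g = z.
  by apply: (MH_eq0P G 2 l).1 zc; apply: diag; clear -hl far; lia.
have : \sum_(x : MC_gen G 2 l) z x * slice w (val x) = 1.
  under eq_bigr do rewrite ffunE mulrBl.
  rewrite sumrB f2P subr0 (bigD1 x1) //= eqxx mul1r big1 ?addr0 => [|x /negbTE ->]; last by rewrite mul0r.
  by rewrite /slice !x1E //= !eqxx av vw eqxx.
rewrite -gz; under eq_bigr do rewrite bdryE mulr_suml.
rewrite exchange_big big1 //= => y _.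
under eq_bigr do rewrite -mulrA.
by rewrite -mulr_sumr slice_bdry // mulr0.
Qed.

End EdgeDeletion.

(** * Edge sets of cycles *)

Section CycleCombinatorics.
Set Implicit Arguments.
Unset Strict Implicit.
Unset Printing Implicit Defensive.
Local Open Scope nat_scope.
Variable V : finType.
Implicit Types (x y z a b : V) (c : seq V).

Lemma next_next c x : uniq c -> 2 < size c -> x \in c -> next c (next c x) != x.
Proof.
move=> uc sc xc; have [i p e] := rot_to xc.
have ur : uniq (x :: p) by rewrite -e rot_uniq.
have sr : 2 < size (x :: p) by rewrite -e size_rot.
rewrite -!(next_rot i uc) e; case: p ur sr {e} => [|y [|z p]] //= ur _.
move: ur; rewrite !inE !negb_or eqxx => /andP[/and3P[xy xz _] _].
have yx : (y == x) = false by rewrite eq_sym (negbTE xy).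
by rewrite yx eqxx eq_sym.
Qed.

Lemma next_neq_prev c x : uniq c -> 2 < size c -> x \in c -> next c x != prev c x.
Proof.
move=> uc sc xc; apply: contraNneq (next_next uc sc xc) => ->.
by rewrite next_prev.
Qed.

Lemma next_edge_inj c : uniq c -> 2 < size c ->
  {in c &, injective (fun x => [set x; next c x])}.
Proof.
move=> uc sc x y xc yc /set2_inj[[]//|[xy yx]].
by have := next_next uc sc xc; rewrite yx -xy eqxx.
Qed.

Lemma card_cyc_edges c : uniq c -> 2 < size c -> #|cyc_edges c| = size c.
Proof.
by move=> uc sc; rewrite card_in_imset ?(card_uniqP uc) //; apply: next_edge_inj.
Qed.

Lemma cyc_edges_mem c x y : [set x; y] \in cyc_edges c -> x \in c.
Proof.
by case/imsetP=> z zc /set2_inj[[-> _]|[-> _]]; rewrite ?mem_next.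
Qed.

Lemma cyc_edges_rot c i : uniq c -> cyc_edges (rot i c) = cyc_edges c.
Proof.
move=> uc; apply/setP => e; apply/imsetP/imsetP => -[x xc ->]; exists x.
- by rewrite mem_rot in xc.
- by rewrite next_rot.
- by rewrite mem_rot.
- by rewrite next_rot.
Qed.

Lemma cyc_edges_rev c : uniq c -> cyc_edges (rev c) = cyc_edges c.
Proof.
move=> uc; apply/setP => e; apply/imsetP/imsetP => -[x xc ->].
  exists (prev c x); first by rewrite mem_prev -mem_rev.
  by rewrite next_rev // next_prev // finset.setUC.
exists (next c x); first by rewrite mem_rev mem_next.
by rewrite next_rev // prev_next // finset.setUC.
Qed.

Lemma cyc_edges_card2 c e : uniq c -> 2 < size c -> e \in cyc_edges c -> #|e| = 2.
Proof.
move=> uc sc /imsetP[x xc ->]; rewrite cards2.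
suff -> : x != next c x by [].
by apply: contraNneq (next_next uc sc xc) => e1; rewrite -e1 -e1.
Qed.

Lemma is_cycleE (G : sgraph V) c :
  is_cycle G c = [&& 2 < size c, uniq c & cyc_edges c \subset edges G].
Proof.
rewrite /is_cycle; case: (2 < size c) => //=; rewrite andbC.
case uc: (uniq c) => //=; apply/idP/fintype.subsetP => [cc e /imsetP[x xc ->]|sub].
  exact: next_cycle cc xc.
by apply: cycle_from_next => // x xc; apply: sub; apply: imset_f.
Qed.

Lemma next_closed c z (P : pred V) : uniq c -> z \in c -> P z ->
  (forall x, x \in c -> P x -> P (next c x)) -> forall x, x \in c -> P x.
Proof.
move=> uc zc Pz Pn x; have cc := cycle_next uc.
rewrite -(fconnect_cycle cc zc) => zx; rewrite -(iter_findex zx).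
suff : forall n, (iter n (next c) z \in c) && P (iter n (next c) z) by move=> /(_ (findex (next c) z x))/andP[].
elim=> [|n /andP[IH1 IH2]] /=; first by rewrite zc.
by rewrite mem_next IH1 Pn.
Qed.

Lemma cycle_traject a c : uniq (a :: c) -> a :: c = traject (next (a :: c)) a (size (a :: c)).
Proof.
move=> uc; have := cycle_next uc; rewrite /= rcons_path => /andP[/fpathE p _].
by rewrite {1}p.
Qed.

(** Edge set, starting vertex and direction determine the list: at each vertex the next edge is the
    one of the two that was not just used. *)
Lemma cyc_edges_head_inj a c c' : uniq (a :: c) -> uniq (a :: c') -> 2 < size (a :: c) ->
  size c = size c' -> cyc_edges (a :: c) = cyc_edges (a :: c') ->
  next (a :: c) a = next (a :: c') a -> c = c'.
Proof.
move=> uc uc' sc sz e n1; suff : a :: c = a :: c' by case.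
rewrite (cycle_traject uc) [RHS](cycle_traject uc') -![size (a :: _)]/(size _).+1 sz !trajectS; congr cons.
rewrite n1; set b := next _ a.
have sc' : 2 < size (a :: c') by rewrite /= -sz.
set f := next _ in n1 *; set f' := next _ in n1 b *.
have H x : x \in a :: c' -> f x = f' x -> f (f' x) = f' (f' x).
  move=> xc fx; have fc : f' x \in a :: c' by rewrite mem_next.
  have : [set f' x; f' (f' x)] \in cyc_edges (a :: c).
    by rewrite e mem_cyc_edges // eqxx.
  have fc1 : f' x \in a :: c.
    have : [set f' x; f' (f' x)] \in cyc_edges (a :: c) by rewrite e mem_cyc_edges // eqxx.
    exact: cyc_edges_mem.
  rewrite mem_cyc_edges // => /orP[/eqP ->//|/eqP h].
  have := next_next uc' sc' xc; rewrite -/f' h -fx prev_next // eqxx //.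
suff T n x : x \in a :: c' -> f x = f' x -> traject f (f' x) n = traject f' (f' x) n.
  by apply: T; rewrite ?mem_head.
elim: n x => [|n IH] x xc fx //=; congr cons.
by rewrite H // IH ?mem_next //; apply: H.
Qed.

Definition cycle_sets k : {set {set {set V}}} :=
  [set cyc_edges t | t : k.-tuple V & uniq t].

(** A list with the given edge set is determined by its first two vertices, which can be any of the
    k vertices followed by either of its two neighbours. *)
Lemma card_cycle_fibre k (c : k.-tuple V) : 2 < k -> uniq c ->
  #|[set t : k.-tuple V | uniq t & cyc_edges t == cyc_edges c]| = 2 * k.
Proof.
move=> k2 uc; have sc : 2 < size c by rewrite size_tuple.
pose B1 := [set (x, next c x) | x in c]; pose B2 := [set (x, prev c x) | x in c].
have -> : 2 * k = #|B1 :|: B2|.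
  rewrite cardsU.
  have -> : B1 :&: B2 = finset.set0.
    apply/setP => -[x y]; rewrite !inE; apply/negP => /andP[/imsetP[z zc [-> ->]] /imsetP[z' zc' [<- e]]].
    by have := next_neq_prev uc sc zc; rewrite e eqxx.
  rewrite cards0 subn0 !card_imset; try by move=> x y [].
  by rewrite (card_uniqP uc) size_tuple; lia.
have [m km] : exists m, k = m.+1 by case: (k) k2 => // m _; exists m.
subst k.
pose phi (t : m.+1.-tuple V) := (thead t, next t (thead t)).
have headE (t : m.+1.-tuple V) : tval t = thead t :: behead t by case/tupleP: t => x t; rewrite theadE.
rewrite -(@card_in_imset _ _ phi); last first.
  move=> t t'; rewrite !inE => /andP[ut /eqP te] /andP[ut' /eqP te'] [h1 h2].
  apply: val_inj; rewrite /= headE (headE t') -h1; congr cons.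
  apply: (@cyc_edges_head_inj (thead t)).
  - by rewrite -headE.
  - by rewrite h1 -headE.
  - by rewrite -headE size_tuple.
  - by rewrite !size_behead !size_tuple.
  - by rewrite -headE h1 -headE te te'.
  - by rewrite -headE h2 h1 -headE.
congr #|pred_of_set _|; apply/setP => -[a b]; apply/imsetP/setUP.
  case=> t; rewrite inE => /andP[ut /eqP te] [-> ->]; set x := thead t.
  have xt : x \in tval t by rewrite headE mem_head.
  have : [set x; next t x] \in cyc_edges c by rewrite -te mem_cyc_edges // eqxx.
  have xc : x \in tval c.
    apply: (@cyc_edges_mem _ _ (next t x)); by rewrite -te mem_cyc_edges // eqxx.
  rewrite mem_cyc_edges // => /orP[]/eqP ->; [left|right]; exact: imset_f.
have mk (s : seq V) x : uniq s -> size s = m.+1 -> cyc_edges s = cyc_edges c -> x \in s ->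
    exists2 t : m.+1.-tuple V, t \in [set t : m.+1.-tuple V | uniq t & cyc_edges t == cyc_edges c] &
      (x, next s x) = phi t.
  move=> us ss es xs; have [i p e] := rot_to xs.
  have sz : size (rot i s) == m.+1 by rewrite size_rot ss.
  exists (Tuple sz); first by rewrite inE /= rot_uniq us cyc_edges_rot // es eqxx.
  rewrite /phi /=; have -> : thead (Tuple sz) = x by rewrite /thead (tnth_nth x) /= e.
  by rewrite next_rot.
case=> /imsetP[x xc [-> ->]].
  by apply: (mk c) => //; rewrite size_tuple.
have [|||| t th e] := mk (rev c) x; rewrite ?rev_uniq ?size_rev ?size_tuple ?cyc_edges_rev ?mem_rev //.
by exists t => //; rewrite -e next_rev.
Qed.

Lemma card_cycle_sets k : 2 < k -> #|cycle_sets k| * (2 * k) = #|V| ^_ k.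
Proof.
move=> k2; pose A := [set t : k.-tuple V | uniq t].
have -> : #|V| ^_ k = #|A|.
  by rewrite -card_uniq_tuples; apply: eq_card => t; rewrite !inE all_predT.
have E : cycle_sets k = [set cyc_edges (val t) | t in A].
  by apply/setP => S; apply/imsetP/imsetP => -[t ut ->]; exists t => //; rewrite inE in ut *.
rewrite -[RHS]sum1_card [RHS](partition_big_imset (fun t : k.-tuple V => cyc_edges (val t))) /= -E.
rewrite -sum_nat_const; apply: eq_bigr => S; rewrite E => /imsetP[c]; rewrite inE => uc ->.
rewrite -(card_cycle_fibre k2 uc) -sum1_card; apply: eq_bigl => t.
by rewrite !inE.
Qed.

Lemma cycle_setsP k (S : {set {set V}}) : reflect (exists c, [/\ size c = k, uniq c & cyc_edges c = S])
  (S \in cycle_sets k).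
Proof.
apply: (iffP imsetP) => [[t]|[c [sc uc <-]]].
  by rewrite inE => ut ->; exists t; rewrite size_tuple.
have sc' : size c == k by rewrite sc.
by exists (Tuple sc'); rewrite ?inE.
Qed.

(** The cycle [c] has as many edges as vertices, and each vertex of [c'] outside [c] brings the new
    edge to its successor. Without a further new edge, [c'] could not leave [c] after [z], and the
    two edge sets would coincide. *)
Lemma cyc_edges_overlap c c' z : uniq c -> uniq c' -> 2 < size c -> 2 < size c' ->
  z \in c -> z \in c' -> cyc_edges c != cyc_edges c' ->
  #|[set x in c] :|: [set x in c']| < #|cyc_edges c :|: cyc_edges c'|.
Proof.
move=> uc uc' sc sc' zc zc' ne.
have cN (q : seq V) : uniq q -> #|[set x in q]| = size q.
  by move=> uq; rewrite -(card_uniqP uq); apply: eq_card => x; rewrite inE.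
have cU (T : finType) (A B : {set T}) : #|A :|: B| = #|A| + #|B :\: A|.
  by rewrite cardsU cardsD (finset.setIC B); have := subset_leq_card (finset.subsetIr A B); lia.
rewrite !cU cN // card_cyc_edges // ltn_add2l.
pose f x := [set x; next c' x].
pose W := [set x in c' | f x \notin cyc_edges c].
have -> : cyc_edges c' :\: cyc_edges c = f @: W.
  apply/setP => e; rewrite inE; apply/andP/imsetP => [[eN /imsetP[x xc xe]]|[x]].
    by exists x; rewrite // inE xc /f -xe.
  by rewrite inE => /andP[xc fx] ->; split=> //; apply: imset_f.
rewrite card_in_imset; last first.
  move=> x y; rewrite !inE => /andP[xc _] /andP[yc _]; exact: next_edge_inj.
have DW : [set x in c'] :\: [set x in c] \subset W.
  apply/fintype.subsetP => x; rewrite !inE => /andP[xN ->] /=.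
  by apply: contra xN; apply: cyc_edges_mem.
apply: proper_card; rewrite properE DW /=; apply/negP => WD.
have sub x : x \in c' -> x \in c -> f x \in cyc_edges c.
  move=> xc' xc; apply: contraTT isT => fx.
  have : x \in W by rewrite inE xc'.
  by move/(fintype.subsetP WD); rewrite !inE xc.
have c'c x : x \in c' -> x \in c.
  apply: (next_closed (z := z) (P := fun x => x \in c)) => // y yc' yc.
  have := sub y yc' yc; rewrite /f finset.setUC; exact: cyc_edges_mem.
have E'E : cyc_edges c' \subset cyc_edges c.
  by apply/fintype.subsetP => e /imsetP[x xc' ->]; apply: sub => //; apply: c'c.
have cc' x : x \in c -> x \in c'.
  apply: (next_closed (z := z) (P := fun x => x \in c')) => // y yc yc'.
  have h1 : (next c' y == next c y) || (next c' y == prev c y).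
    by rewrite -mem_cyc_edges //; apply: sub.
  have h2 : (prev c' y == next c y) || (prev c' y == prev c y).
    rewrite -mem_cyc_edges //; apply: (fintype.subsetP E'E).
    by rewrite mem_cyc_edges // eqxx orbT.
  have := next_neq_prev uc' sc' yc'.
  case/orP: h1 => /eqP h1; first by rewrite -h1 mem_next.
  case/orP: h2 => /eqP h2; first by rewrite -h2 mem_prev.
  by rewrite h1 h2 eqxx.
case/eqP: ne; apply/esym/eqP; rewrite eqEcard E'E !card_cyc_edges //.
by apply: uniq_leq_size.
Qed.

End CycleCombinatorics.

(** * Non-diagonality from an edge of a cycle that lies on no short cycle *)

Section LongCycle.
Set Implicit Arguments.
Unset Strict Implicit.
Unset Printing Implicit Defensive.
Local Open Scope nat_scope.
Variables (V : finType) (G : sgraph V).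

Lemma cycle_edge_connected (c : seq V) a : is_cycle G c -> a \in c ->
  ds (del_edge G a (next c a)) a (next c a) < #|V|.
Proof.
move=> /and3P[sc cc uc] ac; have [i p e] := rot_to ac.
have ur : uniq (a :: p) by rewrite -e rot_uniq.
have sr : 2 < size (a :: p) by rewrite -e size_rot.
have cr : cycle (adj G) (a :: p) by rewrite -e rot_cycle.
rewrite -(next_rot i uc) e; case: p ur sr cr {e} => [|b q] //= ur sr.
rewrite eqxx rcons_path => /andP[ab /andP[bq qa]].
rewrite ds_sym -{2}(last_rcons b q a); apply: ds_connected.
move: ur; rewrite inE negb_or => /andP[/andP[nab aq] /andP[bNq uq]].
rewrite rcons_path del_edge_adj qa /=; apply/andP; split.
  apply: (sub_in_path (P := [pred x | x != a]) (e := adj G)) bq => [x y xa ya xy|].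
    rewrite del_edge_adj xy /=; apply/eqP => /set2_inj[[e _]|[_ e]].
      by rewrite inE e eqxx in xa.
    by rewrite inE e eqxx in ya.
  rewrite /= eq_sym nab /=; apply/allP => x xq; rewrite inE.
  by apply: contraNneq aq => <-.
have lq : last b q \in q by case: (q) sr => //= x s _; apply: mem_last.
apply/eqP => /set2_inj[[_ e]|[e _]]; first by rewrite e eqxx in nab.
by rewrite e (negbTE bNq) in lq.
Qed.

Theorem edge_long_cycle_nondiagonal (c : seq V) a : is_cycle G c -> a \in c ->
  (forall c', is_cycle G c' -> size c' <= 4 -> [set a; next c a] \notin cyc_edges c') ->
  ~ diagonal_graph G.
Proof.
move=> cc ac short; set b := next c a in short *.
have [sc cy uc] := and3P cc.
have ab : adj G a b by apply: next_cycle cy ac.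
have nab := adj_neq ab.
apply: (@long_cycle_nondiagonal _ G a b ab) => [x ax xb|x y ax xy yb|].
- have c3 : is_cycle G [:: a; x; b].
    by rewrite /is_cycle /= ax xb adj_sym ab /= !inE !negb_or nab (adj_neq ax) (adj_neq xb).
  have [_ _ u3] := and3P c3.
  case/negP: (short _ c3 isT); rewrite finset.setUC mem_cyc_edges //; last by rewrite !inE eqxx !orbT.
  by rewrite -(next_rot 2 u3) /= !eqxx.
- have [->|xb] := eqVneq x b; first by left.
  have [->|ya] := eqVneq y a; first by right.
  have c4 : is_cycle G [:: a; x; y; b].
    rewrite /is_cycle /= ax xy yb adj_sym ab /= !inE !negb_or nab (adj_neq ax) (adj_neq xy) (adj_neq yb) xb.
    by rewrite eq_sym ya.
  have [_ _ u4] := and3P c4.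
  case/negP: (short _ c4 isT); rewrite finset.setUC mem_cyc_edges //; last by rewrite !inE eqxx !orbT.
  by rewrite -(next_rot 3 u4) /= !eqxx.
- exact: cycle_edge_connected cc ac.
Qed.

End LongCycle.

(** * The random graph *)

Section EdgeAddition.
Set Implicit Arguments.
Unset Strict Implicit.
Unset Printing Implicit Defensive.
Variables (V : finType) (G : sgraph V).

Fact add_edges_proof (S : {set {set V}}) :
  [forall e in edges G :|: [set f in S | #|f| == 2], #|e| == 2].
Proof.
apply/forall_inP => e; rewrite !inE => /orP[|/andP[]//].
by move: e; apply/forall_inP/edges_card.
Qed.

Definition add_edges S := SGraph (add_edges_proof S).
End EdgeAddition.

(** * Adding edges under the product measure; the Harris and Janson bounds *)

Section RandomGraph.
Set Implicit Arguments.
Unset Strict Implicit.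
Unset Printing Implicit Defensive.
Local Open Scope ring_scope.
Variables (R : realType) (n : nat) (p : R).
Hypothesis p01 : 0 <= p <= 1.
Local Notation graph := (sgraph 'I_n).
Local Notation edge := {set 'I_n}.
Local Notation Pr := (@Gnp_prob R n p).
Local Notation w := (@Gnp_weight R n p).
Implicit Types (A B D : graph -> Prop) (S T : {set edge}) (e : edge).

Lemma p_ge0 : 0 <= p. Proof. by case/andP: p01. Qed.
Lemma p_le1 : p <= 1. Proof. by case/andP: p01. Qed.

Lemma weight_ge0 G : 0 <= w G.
Proof.
apply: prodr_ge0 => e _; case: ifP => _; first exact: p_ge0.
by rewrite subr_ge0 p_le1.
Qed.

Lemma probE A : Pr A = \sum_G w G * (`[< A G >])%:R.
Proof.
rewrite /Gnp_prob big_mkcond; apply: eq_bigr => G _.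
by case: asboolP; rewrite ?mulr1 ?mulr0.
Qed.

Lemma prob_ge0 A : 0 <= Pr A.
Proof. by apply: sumr_ge0 => G _; apply: weight_ge0. Qed.

Lemma eq_prob A B : (forall G, A G <-> B G) -> Pr A = Pr B.
Proof.
by move=> AB; rewrite !probE; apply: eq_bigr => G _; rewrite (asbool_equiv_eq (AB G)).
Qed.

Lemma le_prob A B : (forall G, A G -> B G) -> Pr A <= Pr B.
Proof.
move=> AB; rewrite !probE; apply: ler_sum => G _; apply: ler_wpM2l; first exact: weight_ge0.
by case: asboolP => // /AB h; rewrite asboolT.
Qed.

Lemma prob_sum (I : finType) (Q : pred I) (f : I -> graph -> Prop) A :
  (forall G, A G -> exists2 i, Q i & f i G) -> Pr A <= \sum_(i | Q i) Pr (f i).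
Proof.
move=> Af; rewrite probE; under [X in _ <= X]eq_bigr do rewrite probE.
rewrite exchange_big; apply: ler_sum => G _; rewrite -mulr_sumr.
apply: ler_wpM2l; first exact: weight_ge0.
case: asboolP => [/Af[i Qi fi]|_]; last by apply: sumr_ge0 => i _; apply: ler0n.
by rewrite (bigD1 i) //= asboolT //= lerDl; apply: sumr_ge0 => j _; apply: ler0n.
Qed.

Lemma prob_sum_seq (I : eqType) (r : seq I) (f : I -> graph -> Prop) A :
  (forall G, A G -> exists2 i, i \in r & f i G) -> Pr A <= \sum_(i <- r) Pr (f i).
Proof.
move=> Af; rewrite probE; under [X in _ <= X]eq_bigr do rewrite probE.
rewrite exchange_big; apply: ler_sum => G _; rewrite -mulr_sumr.
apply: ler_wpM2l; first exact: weight_ge0.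
case: asboolP => [/Af[i ri fi]|_]; last by apply: sumr_ge0 => i _; apply: ler0n.
by rewrite (big_rem i) //= asboolT //= lerDl; apply: sumr_ge0 => j _; apply: ler0n.
Qed.

Lemma probD A B : Pr A = Pr (fun G => A G /\ B G) + Pr (fun G => A G /\ ~ B G).
Proof.
rewrite !probE -big_split; apply: eq_bigr => G _ /=; rewrite -mulrDr; congr (_ * _).
rewrite !asbool_and asbool_neg.
by case: asboolP => _; case: asboolP => _; rewrite /= ?addr0 ?add0r.
Qed.

(** The sum of the two values is left free: 1 gives the total mass, and another value gives the
    generating function of the number of edges in [prob_few_edges]. *)
Lemma sum_weight (a b : R) :
  \sum_(G : graph) \prod_(e : edge | #|e| == 2%N) (if e \in edges G then a else b) =
  (a + b) ^+ 'C(n, 2).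
Proof.
rewrite -[in RHS](card_ord n) -card_draws -prodr_const.
rewrite [RHS]big_mkcond /=.
(* On sets that are not pairs the factors are 0 and 1, so the expanded product over all sets keeps
   only the families of pairs, that is, the graphs. *)
pose F (e : edge) : R := if #|e| == 2%N then a else 0.
pose H (e : edge) : R := if #|e| == 2%N then b else 1.
transitivity (\prod_(e : edge) (F e + H e)); last first.
  by apply: eq_bigr => e _; rewrite inE /F /H; case: ifP => // _; rewrite add0r.
rewrite bigA_distr (bigID (fun J : {set edge} => [forall e in J, #|e| == 2%N])) /=.
rewrite [X in _ = _ + X]big1 ?addr0 => [|J]; last first.
  case/forall_inPn => e eJ ne; rewrite (bigD1 e) //= eJ /F (negbTE ne) mul0r //.
rewrite (reindex_omap (val : graph -> {set edge}) insub) /=; last first.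
  by move=> J JP; rewrite insubT.
apply: eq_big => [G|G _].
  by rewrite valK eqxx andbT edges_card.
rewrite big_mkcond; apply: eq_bigr => e _; rewrite /F /H.
case: ifP => c; first by [].
by case: ifP => // /(forall_inP (edges_card G)); rewrite c.
Qed.

Lemma prob_total : Pr (fun _ => True) = 1.
Proof.
rewrite probE -[RHS](expr1n R 'C(n, 2)) -{2}(subrKC p 1) -sum_weight.
by apply: eq_bigr => G _; rewrite asboolT // mulr1.
Qed.

Lemma prob_compl A : Pr (fun G => ~ A G) = 1 - Pr A.
Proof.
rewrite -prob_total (probD (fun=> True) A).
rewrite (@eq_prob (fun G => True /\ A G) A); last by move=> G; tauto.
rewrite (@eq_prob (fun G => True /\ ~ A G) (fun G => ~ A G)); last by move=> G; tauto.
by rewrite [RHS]addrC addKr.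
Qed.

Lemma prob_le1 A : Pr A <= 1.
Proof. by rewrite -prob_total; apply: le_prob. Qed.

Definition weight_except e G := \prod_(f : edge | (#|f| == 2%N) && (f != e)) (if f \in edges G then p else 1 - p).

Lemma weightE e G : #|e| = 2%N -> w G = (if e \in edges G then p else 1 - p) * weight_except e G.
Proof. by move=> e2; rewrite /Gnp_weight (bigD1 e) ?e2. Qed.

Lemma sgraph_inj (G H : graph) : edges G = edges H -> G = H.
Proof. exact: val_inj. Qed.

(** [G] with and without [e] become the same graph after adding [e], and their weights are in the
    ratio p to 1 - p; summing over such a pair leaves the factor p. *)
Lemma prob_edge e D : #|e| = 2%N ->
  Pr (fun G => e \in edges G /\ D G) = p * Pr (fun G => D (add_edges G [set e])).
Proof.
move=> e2; rewrite !probE [X in p * X](bigID (fun G => e \in edges G)) /=.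
rewrite (bigID (fun G => e \in edges G)) /= [X in _ + X = _]big1 ?addr0 => [|G /negbTE eG]; last first.
  by rewrite eG asboolF ?mulr0 // => -[].
have addE G : edges (add_edges G [set e]) = edges G :|: [set e].
  by apply/setP => f; rewrite !inE; case: eqVneq => [->|_]; rewrite ?e2 ?andbF ?orbT.
have -> : \sum_(G : graph | e \notin edges G) w G * `[< D (add_edges G [set e]) >]%:R =
          \sum_(G : graph | e \in edges G) (1 - p) * (weight_except e G * `[< D G >]%:R).
  rewrite [RHS](reindex_onto (fun G => add_edges G [set e]) (fun G => rem_edges G [set e])) /=; last first.
    move=> G eG; apply: sgraph_inj; rewrite addE /= finset.setUC finset.setD1K //.
  apply: eq_big => [G|G eG].
    rewrite !inE eqxx e2 /= orbT /=; apply/idP/eqP => [eG|<-].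
      apply: sgraph_inj; rewrite -[edges (rem_edges _ _)]/(edges (add_edges G [set e]) :\ e).
      by rewrite addE finset.setUC; apply: setU1K.
    by rewrite /= !inE eqxx.
  rewrite (weightE _ e2) (negbTE eG) -mulrA; congr (_ * (_ * _)).
  apply: eq_bigr => f /andP[_ fe]; by rewrite addE !inE (negbTE fe) orbF.
rewrite mulrDr !mulr_sumr -big_split /=; apply: eq_bigr => G eG.
rewrite (weightE _ e2) eG; have -> : add_edges G [set e] = G.
  by apply: sgraph_inj; rewrite addE; apply/setP => f; rewrite !inE; case: eqVneq => [->|]; rewrite ?eG ?orbF.
have -> : `[< true /\ D G >] = `[< D G >] by apply: asbool_equiv_eq; split=> [[]|].
by ring.
Qed.

Lemma prob_edges S D : (forall e, e \in S -> #|e| = 2%N) ->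
  Pr (fun G => S \subset edges G /\ D G) = p ^+ #|S| * Pr (fun G => D (add_edges G S)).
Proof.
move: D; move cS : #|S| => k; elim: k S cS => [|k IH] S cS D S2.
  rewrite expr0 mul1r; apply: eq_prob => G; move/eqP: cS; rewrite cards_eq0 => /eqP ->.
  rewrite finset.sub0set; have -> : add_edges G finset.set0 = G.
    by apply: sgraph_inj; apply/setP => f; rewrite !inE orbF.
  by split=> [[]|].
have [e eS] : exists e, e \in S by apply/set0Pn; rewrite -card_gt0 cS.
have SE : S = e |: S :\ e by rewrite finset.setD1K.
have cS' : #|S :\ e| = k by move: cS; rewrite (cardsD1 e) eS => -[].
transitivity (Pr (fun G => e \in edges G /\ (S :\ e \subset edges G /\ D G))).
  apply: eq_prob => G; rewrite {1}SE finset.subUset finset.sub1set.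
  by split=> [[/andP[]]|[-> []]] //.
rewrite prob_edge; last exact: S2.
rewrite exprS -mulrA; congr (_ * _).
transitivity (Pr (fun G => S :\ e \subset edges G /\ D (add_edges G [set e]))).
  apply: eq_prob => G; suff -> : (S :\ e \subset edges (add_edges G [set e])) = (S :\ e \subset edges G) by [].
  apply/fintype.subsetP/fintype.subsetP => h f fS; have := h f fS; rewrite !inE.
    by move: fS; rewrite !inE => /andP[/negbTE -> _]; rewrite orbF.
  by move=> ->.
rewrite (IH _ cS' (fun G => D (add_edges G [set e]))); last first.
  by move=> f; rewrite !inE => /andP[_ /S2].
congr (_ * _); apply: eq_prob => G.
suff -> : add_edges (add_edges G (S :\ e)) [set e] = add_edges G S by [].
apply: sgraph_inj; apply/setP => f; rewrite !inE.
by case: eqVneq => [->|_]; rewrite ?eS ?andbF ?orbF // S2 ?eqxx ?orbT // eS.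
Qed.

Lemma prob_subset S : (forall e, e \in S -> #|e| = 2%N) ->
  Pr (fun G => S \subset edges G) = p ^+ #|S|.
Proof.
move=> S2; rewrite (@eq_prob _ (fun G => S \subset edges G /\ True)); last by move=> G; tauto.
by rewrite (prob_edges (fun=> True) S2) prob_total mulr1.
Qed.

Section Avoidance.
Variables (I : eqType) (S : I -> {set edge}) .
Hypothesis S2 : forall i e, e \in S i -> #|e| = 2%N.

Definition avoids (s : seq I) G := forall i, i \in s -> ~ (S i \subset edges G).

Lemma avoids_add s (T : {set edge}) G : avoids s (add_edges G T) -> avoids s G.
Proof.
move=> h i i_s si; apply: (h i i_s); apply: fintype.subset_trans si _.
by apply/fintype.subsetP => e; rewrite !inE => ->.
Qed.

(** By [prob_edges], forcing [S i] costs the factor [p ^+ #|S i|] and replaces [G] by a larger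
    graph, which is less likely to avoid the other sets. *)
Lemma harris_avoids s : \prod_(i <- s) (1 - p ^+ #|S i|) <= Pr (avoids s).
Proof.
elim: s => [|i s IH].
  by rewrite big_nil (@eq_prob _ (fun=> True)) ?prob_total // => G; split=> // _ i.
rewrite big_cons.
have E : Pr (avoids (i :: s)) = Pr (avoids s) - Pr (fun G => S i \subset edges G /\ avoids s G).
  rewrite (probD (avoids s) (fun G => S i \subset edges G)).
  rewrite (@eq_prob (fun G => avoids s G /\ S i \subset edges G) (fun G => S i \subset edges G /\ avoids s G)); last by move=> G; tauto.
  rewrite addrAC subrr add0r; apply: eq_prob => G; split=> [h|[h hi] j].
    by split=> [j js|]; apply: h; rewrite inE ?js ?orbT ?eqxx.
  by rewrite inE => /orP[/eqP ->|/h].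
rewrite E prob_edges; last exact: S2.
have le : Pr (fun G => avoids s (add_edges G (S i))) <= Pr (avoids s).
  by apply: le_prob => G; apply: avoids_add.
have p0 := p_ge0; have p1 : 0 <= 1 - p ^+ #|S i| by rewrite subr_ge0 exprn_ile1 ?p_le1.
apply: le_trans (ler_wpM2l p1 IH) _; rewrite mulrBl mul1r lerB //.
by apply: ler_wpM2l => //; apply: exprn_ge0.
Qed.

Let delta i s := \sum_(j <- s | (j != i) && (S i :&: S j != finset.set0)) p ^+ #|S i :|: S j|.

(** Only the sets disjoint from [S i] are kept at first: adding [S i] does not change whether [G]
    avoids them, so the factor [p ^+ #|S i|] comes out exactly. The sets meeting [S i] are restored
    by a union bound, whose terms carry the probability of avoiding the same disjoint sets. *)
Lemma avoids_step i s : i \notin s ->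
  (p ^+ #|S i| - delta i s) * Pr (avoids s) <= Pr (fun G => S i \subset edges G /\ avoids s G).
Proof.
move=> iNs.
have [neg|pos] := lerP (p ^+ #|S i| - delta i s) 0.
  by apply: le_trans (prob_ge0 _); apply: mulr_le0_ge0 => //; apply: prob_ge0.
pose sd := [seq j <- s | S i :&: S j == finset.set0].
pose sn := [seq j <- s | S i :&: S j != finset.set0].
have sub G : avoids s G -> avoids sd G.
  by move=> h j; rewrite mem_filter => /andP[_]; apply: h.
apply: (@le_trans _ _ ((p ^+ #|S i| - delta i s) * Pr (avoids sd))).
  by apply: ler_wpM2l; [apply: ltW|apply: le_prob].
rewrite mulrBl lerBlDr.
have -> : p ^+ #|S i| * Pr (avoids sd) = Pr (fun G => S i \subset edges G /\ avoids sd G).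
  rewrite prob_edges; last exact: S2.
  congr (_ * _); apply: eq_prob => G; split=> [h j js|]; last exact: avoids_add.
  move=> sub'; apply: (h j js); apply/fintype.subsetP => e ej.
  have := fintype.subsetP sub' e ej; rewrite !inE => /orP[//|/andP[ei _]].
  by move: js; rewrite mem_filter => /andP[/eqP/setP/(_ e)]; rewrite !inE ei ej.
rewrite (probD _ (avoids s)); apply: lerD.
  by apply: le_prob => G [[]].
apply: (@le_trans _ _ (\sum_(j <- sn) Pr (fun G => S i :|: S j \subset edges G /\ avoids sd G))).
  apply: prob_sum_seq => G [[si sdG] ns].
  apply: contrapT => nex; apply: ns => j js sj.
  have [d|d] := eqVneq (S i :&: S j) finset.set0.
    by apply: (sdG j) => //; rewrite mem_filter d eqxx.
  by apply: nex; exists j; rewrite ?mem_filter ?d // finset.subUset si sj.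
rewrite big_filter /delta mulr_suml big_seq_cond [X in _ <= X]big_seq_cond.
rewrite (eq_bigl (fun j => (j \in s) && ((j != i) && (S i :&: S j != finset.set0)))); last first.
  by move=> j; case js: (j \in s) => //=; rewrite (_ : j != i) //; apply: contraNneq iNs => <-.
apply: ler_sum => j _; rewrite prob_edges; last by move=> e; rewrite inE => /orP[]; apply: S2.
apply: ler_wpM2l; first by apply/exprn_ge0/p_ge0.
by apply: le_prob => G; apply: avoids_add.
Qed.

(* Janson's inequality; as the product measure satisfies
   P (S <= G /\ A) = p^|S| P (G + S in A), no correlation inequality is needed. *)
Lemma janson_avoids s : uniq s -> Pr (avoids s) <=
  expR (- (\sum_(i <- s) p ^+ #|S i|) +
    \sum_(i <- s) \sum_(j <- s | (j != i) && (S i :&: S j != finset.set0)) p ^+ #|S i :|: S j|).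
Proof.
elim: s => [_|i s IH /= /andP[iNs us]].
  by rewrite !big_nil oppr0 addr0 expR0 prob_le1.
have E : Pr (avoids (i :: s)) = Pr (avoids s) - Pr (fun G => S i \subset edges G /\ avoids s G).
  rewrite (probD (avoids s) (fun G => S i \subset edges G)).
  rewrite (@eq_prob (fun G => avoids s G /\ S i \subset edges G) (fun G => S i \subset edges G /\ avoids s G)); last by move=> G; tauto.
  rewrite addrAC subrr add0r; apply: eq_prob => G; split=> [h|[h hi] j].
    by split=> [j js|]; apply: h; rewrite inE ?js ?orbT ?eqxx.
  by rewrite inE => /orP[/eqP ->|/h].
have step := avoids_step iNs.
apply: (@le_trans _ _ ((1 + (delta i s - p ^+ #|S i|)) * Pr (avoids s))).
  by rewrite E mulrDl mul1r lerD2l -lerN2 opprK -mulNr opprB.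
apply: (@le_trans _ _ (expR (delta i s - p ^+ #|S i|) * Pr (avoids s))).
  by apply: ler_wpM2r; [apply: prob_ge0|apply: expR_ge1Dx].
apply: le_trans (ler_wpM2l (expR_ge0 _) (IH us)) _.
rewrite -expRD ler_expR !big_cons eqxx /=.
have : \sum_(i0 <- s) \sum_(j <- s | (j != i0) && (S i0 :&: S j != finset.set0)) p ^+ #|S i0 :|: S j| <=
  \sum_(j <- s) (\sum_(j0 <- (i :: s) | (j0 != j) && (S j :&: S j0 != finset.set0)) p ^+ #|S j :|: S j0|).
  apply: ler_sum => j _; rewrite big_cons; case: ifP => // _.
  by rewrite lerDr exprn_ge0 // p_ge0.
set Y := \sum_(i0 <- s) \sum_(j <- s | _) _; set X := \sum_(j <- s) \sum_(j0 <- i :: s | _) _ => YX.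
set q := p ^+ _; set Z := \sum_(i0 <- s) _.
have -> : delta i s - q + (- Z + Y) = - (q + Z) + (delta i s + Y) by ring.
by rewrite !lerD2l.
Qed.
End Avoidance.

End RandomGraph.

(** * First moments of cycles and of overlapping pairs of cycles *)

Section CycleSums.
Set Implicit Arguments.
Unset Strict Implicit.
Unset Printing Implicit Defensive.
Local Open Scope ring_scope.
Variables (R : realType) (n : nat) (p : R).
Hypothesis p01 : 0 <= p <= 1.
Local Notation edge := {set 'I_n}.

Lemma ler_sum_cover (X Y : finType) (A : pred X) (B : pred Y) (h : Y -> X) (F : X -> R) (F' : Y -> R) :
  (forall y, B y -> 0 <= F' y) ->
  (forall x, A x -> exists y, [/\ B y, h y = x & F x <= F' y]) ->
  \sum_(x | A x) F x <= \sum_(y | B y) F' y.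
Proof.
move=> F0 AB; rewrite (partition_big h xpredT) //= [X in _ <= X](bigID A) /=.
rewrite ler_wpDr ?sumr_ge0 // => [x _|]; first by apply: sumr_ge0 => y /andP[]; auto.
apply: ler_sum => x /AB[y [By hy le]]; rewrite (bigD1 y) ?By ?hy ?eqxx //=.
by apply: le_trans le _; rewrite lerDl; apply: sumr_ge0 => z /andP[/andP[]]; auto.
Qed.

(** A new entry repeats one of at most [m] earlier ones at no cost, or is one of at most [n] new
    vertices at cost [p]. *)
Lemma sum_tuple_support m :
  \sum_(z : m.-tuple 'I_n) p ^+ #|[set i in z]| <= (m%:R + n%:R * p) ^+ m.
Proof.
have [p0 p1] := andP p01.
elim: m => [|m IH].
  rewrite expr0 (eq_bigr (fun=> 1)) => [|z _].
    by rewrite sumr_const card_tuple expn0.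
  by rewrite tuple0 (_ : [set i in [tuple]] = finset.set0) ?cards0 //; apply/setP => i; rewrite !inE.
apply: (@le_trans _ _ (\sum_(z : m.-tuple 'I_n) p ^+ #|[set i in z]| * (m%:R + n%:R * p))).
  rewrite (reindex (fun az : 'I_n * m.-tuple 'I_n => cons_tuple az.1 az.2)) /=; last first.
    exists (fun z : m.+1.-tuple 'I_n => (thead z, behead_tuple z)).
      by move=> [a z] _; congr pair; apply: val_inj.
    by move=> z _; rewrite [RHS]tuple_eta; apply: val_inj.
  rewrite -(pair_bigA _ (fun (a : 'I_n) (z : m.-tuple 'I_n) => p ^+ #|[set i in a :: z]|)) /=.
  rewrite exchange_big /=; apply: ler_sum => z _.
  have E a : [set i in a :: z] = a |: [set i in z] by apply/setP => i; rewrite !inE.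
  under eq_bigr do rewrite E cardsU1 exprD.
  rewrite -mulr_suml mulrC; apply: ler_wpM2l; first exact: exprn_ge0.
  rewrite (bigID (fun a => a \in [set i in z])) /=; apply: lerD.
    rewrite (eq_bigr (fun=> 1)) => [|a ->]; last by rewrite expr0.
    rewrite sumr_const ler_nat; apply: leq_trans (_ : #|[set i in z]| <= m)%N.
      by apply: subset_leq_card; apply/fintype.subsetP => a.
    by rewrite cardsE -[X in (_ <= X)%N](size_tuple z) card_size.
  rewrite (eq_bigr (fun=> p)) => [|a /negbTE ->]; last by rewrite expr1.
  rewrite sumr_const -[X in X <= _]mulr_natl; apply: ler_wpM2r => //.
  by rewrite ler_nat -[X in (_ <= X)%N]card_ord max_card.
rewrite -mulr_suml exprSr; apply: ler_pM => //.
- by apply: sumr_ge0 => z _; apply: exprn_ge0.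
- by rewrite addr_ge0 ?mulr_ge0.
- apply: le_trans IH _; apply: lerXn2r; rewrite ?nnegrE ?addr_ge0 ?mulr_ge0 //.
  by rewrite lerD2r ler_nat.
- by rewrite lerD2r ler_nat.
Qed.

Definition cycles_between a K : {set {set edge}} :=
  \bigcup_(k < K.+1 | (a <= k)%N) cycle_sets 'I_n k.

Lemma cycles_betweenP a K (S : {set edge}) :
  reflect (exists c, [/\ (a <= size c <= K)%N, uniq c & cyc_edges c = S]) (S \in cycles_between a K).
Proof.
apply: (iffP bigcupP) => [[k ak /cycle_setsP[c [sc uc e]]]|[c [/andP[ac cK] uc e]]].
  by exists c; rewrite sc ak -ltnS ltn_ord.
by exists (Ordinal (cK : (size c < K.+1)%N)) => //; apply/cycle_setsP; exists c.
Qed.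

Lemma sum_cycles_between a K : (2 < a)%N ->
  \sum_(S in cycles_between a K) p ^+ #|S| =
  \sum_(a <= k < K.+1) #|cycle_sets 'I_n k|%:R * p ^+ k.
Proof.
move=> a2.
have SK S : S \in cycles_between a K -> (a <= #|S| <= K)%N.
  move=> /cycles_betweenP[c [/andP[ac cK] uc <-]].
  by rewrite card_cyc_edges ?ac ?cK //; apply: leq_trans a2 ac.
rewrite (partition_big (fun S : {set edge} => (inord #|S| : 'I_K.+1)) (fun k : 'I_K.+1 => (a <= k)%N)) /=; last first.
  by move=> S /SK/andP[aS SK']; rewrite inordK.
rewrite big_geq_mkord; apply: eq_bigr => k ak.
rewrite -sum1_card natr_sum mulr_suml; apply: eq_big => [S|S]; last first.
  move=> /andP[/SK/andP[_ SK'] /eqP <-]; rewrite mul1r inordK //.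
apply/andP/cycle_setsP => [[/[dup] /SK/andP[_ SK'] /cycles_betweenP[c [acK uc e]] /eqP <-]|[c [sc uc e]]].
  exists c; split=> //; rewrite inordK // -e card_cyc_edges //.
  by case/andP: acK => ac _; apply: leq_trans a2 ac.
split; first by apply/cycles_betweenP; exists c; rewrite sc ak -ltnS ltn_ord.
rewrite -e card_cyc_edges ?sc //; last by apply: leq_trans a2 ak.
by apply/eqP/val_inj; rewrite /= inordK.
Qed.

Lemma card_cycle_setsR k : (2 < k)%N ->
  #|cycle_sets 'I_n k|%:R = (n ^_ k)%:R / (2 * k)%:R :> R.
Proof.
move=> k2; have := card_cycle_sets 'I_n k2; rewrite card_ord => <-.
by rewrite natrM mulfK // pnatr_eq0; lia.
Qed.

(* Two distinct cycles with a common vertex have more edges than vertices in total,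
   so that they are rarer than a single cycle by a factor of order p. *)
Definition overlapping K : {set {set edge} * {set edge}} :=
  [set P | [&& P.1 \in cycles_between 3 K, P.2 \in cycles_between 3 K, P.1 != P.2 &
     finset.cover P.1 :&: finset.cover P.2 != finset.set0]].

Lemma cover_cyc_edges (c : seq 'I_n) x : x \in finset.cover (cyc_edges c) -> x \in c.
Proof.
move=> /bigcupP[e /imsetP[y yc ->]]; rewrite !inE => /orP[/eqP ->//|/eqP ->].
by rewrite mem_next.
Qed.

(** For fixed lengths, a pair is encoded by the concatenation of two vertex lists, of length at most
    2K. By [cyc_edges_overlap], its weight is at most [p] times [p] to the number of distinct
    vertices, so [sum_tuple_support] applies. The square counts the pairs of lengths. *)
Lemma sum_overlapping K : \sum_(P in overlapping K) p ^+ #|P.1 :|: P.2| <=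
  (K.+1 ^ 2)%:R * (p * ((2 * K).+1%:R + n%:R * p) ^+ (2 * K)).
Proof.
have [p0 p1] := andP p01.
pose from (kl : 'I_K.+1 * 'I_K.+1) (P : {set edge} * {set edge}) :=
  (P \in overlapping K) && [exists x : kl.1.-tuple 'I_n, exists y : kl.2.-tuple 'I_n,
    [&& uniq x, uniq y, cyc_edges x == P.1 & cyc_edges y == P.2]].
apply: (@le_trans _ _ (\sum_(kl : 'I_K.+1 * 'I_K.+1) \sum_(P | from kl P) p ^+ #|P.1 :|: P.2|)).
  rewrite (exchange_big_dep (mem (overlapping K))) /=; last by move=> kl P _ /andP[].
  apply: ler_sum => P PK.
  have := PK; rewrite inE => /and4P[/cycles_betweenP[c [/andP[_ cK] uc e]] /cycles_betweenP[c' [/andP[_ cK'] uc' e']] _ _].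
  pose kl := (Ordinal (cK : (size c < K.+1)%N), Ordinal (cK' : (size c' < K.+1)%N)).
  rewrite (bigD1 kl) /=; last first.
    rewrite /from PK; apply/existsP; exists (in_tuple c); apply/existsP; exists (in_tuple c').
    by rewrite uc uc' e e' !eqxx.
  by rewrite lerDl; apply: sumr_ge0 => kl' _; apply: exprn_ge0.
have -> : (K.+1 ^ 2)%:R = \sum_(kl : 'I_K.+1 * 'I_K.+1) (1 : R).
  by rewrite sumr_const card_prod card_ord mulnn.
rewrite mulr_suml; apply: ler_sum => -[k l] _; rewrite mul1r.
apply: (@le_trans _ _ (\sum_(z : (k + l).-tuple 'I_n) p * p ^+ #|[set i in z]|)).
  apply: (ler_sum_cover (h := fun z : (k + l).-tuple 'I_n => (cyc_edges (take k z), cyc_edges (drop k z)))).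
    by move=> z _; rewrite mulr_ge0 // exprn_ge0.
  move=> [S T] /andP[]; rewrite inE /= => /and4P[Sk Tk ST /set0Pn[z]].
  rewrite inE => /andP[zS zT] /existsP[x /existsP[y /and4P[ux uy /eqP xS /eqP yT]]].
  exists (cat_tuple x y); split=> //=.
    by rewrite take_size_cat ?drop_size_cat ?size_tuple // xS yT.
  rewrite -exprS; apply: ler_wiXn2l => //.
  have -> : [set i in x ++ y] = [set i in x] :|: [set i in y].
    by apply/setP => i; rewrite !inE mem_cat.
  have sz (q : seq 'I_n) Q : uniq q -> cyc_edges q = Q -> Q \in cycles_between 3 K -> (2 < size q)%N.
    move=> _ qQ /cycles_betweenP[c [/andP[c3 _] uc cQ]]; apply: leq_trans (c3) _.
    rewrite -(card_cyc_edges uc c3) cQ -qQ; apply: leq_trans (leq_imset_card _ _) _.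
    exact: card_size.
  rewrite -xS -yT; apply: (@cyc_edges_overlap _ _ _ z) => //.
  - exact: sz ux xS Sk.
  - exact: sz uy yT Tk.
  - by apply: cover_cyc_edges; rewrite xS.
  - by apply: cover_cyc_edges; rewrite yT.
  - by rewrite xS yT.
rewrite -mulr_sumr; apply: ler_wpM2l => //.
apply: le_trans (sum_tuple_support _) _.
have kK := ltn_ord k; have lK := ltn_ord l.
apply: (@le_trans _ _ (((2 * K).+1%:R + n%:R * p) ^+ (k + l))).
  apply: lerXn2r; rewrite ?nnegrE ?addr_ge0 ?mulr_ge0 //.
  by rewrite lerD2r ler_nat; lia.
apply: ler_weXn2l; last by lia.
apply: (@le_trans _ _ (2 * K).+1%:R); first by rewrite ler1n.
by rewrite lerDl mulr_ge0.
Qed.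

Local Notation Pr := (@Gnp_prob R n p).

Definition overlap_bound K : R := (K.+1 ^ 2)%:R * (p * ((2 * K).+1%:R + n%:R * p) ^+ (2 * K)).

Lemma cycles_between2 a K S e : (2 < a)%N -> S \in cycles_between a K -> e \in S -> #|e| = 2%N.
Proof.
move=> a2 /cycles_betweenP[c [/andP[ac _] uc <-]]; apply: cyc_edges_card2 => //.
exact: leq_trans a2 ac.
Qed.

Definition cycle_overlap K (G : sgraph 'I_n) := exists c c' z,
  [/\ is_cycle G c, is_cycle G c', (size c <= K)%N && (size c' <= K)%N,
      z \in c /\ z \in c' & cyc_edges c != cyc_edges c'].

Lemma is_cycle_between (G : sgraph 'I_n) c a K : is_cycle G c -> (a <= size c <= K)%N ->
  cyc_edges c \in cycles_between a K /\ cyc_edges c \subset edges G.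
Proof.
rewrite is_cycleE => /and3P[_ uc sub] ac; split=> //.
by apply/cycles_betweenP; exists c.
Qed.

Lemma mem_cover_cyc_edges (c : seq 'I_n) x : x \in c -> x \in finset.cover (cyc_edges c).
Proof. move=> xc; apply/bigcupP; exists [set x; next c x]; first exact: imset_f.
by rewrite !inE eqxx. Qed.

Lemma prob_overlap K : Pr (cycle_overlap K) <= overlap_bound K.
Proof.
apply: le_trans (sum_overlapping K).
apply: le_trans (prob_sum p01 (Q := mem (overlapping K)) (f := fun P G => P.1 :|: P.2 \subset edges G) _) _.
  move=> G [c [c' [z [cc cc' /andP[cK cK'] [zc zc'] ne]]]].
  have [|S1 E1] := is_cycle_between (a := 3) (K := K) cc; first by case/and3P: cc => ->.
  have [|S2 E2] := is_cycle_between (a := 3) (K := K) cc'; first by case/and3P: cc' => ->.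
  exists (cyc_edges c, cyc_edges c'); last by rewrite /= finset.subUset E1 E2.
  rewrite 2!inE /= S1 S2 ne; apply/set0Pn; exists z; rewrite inE.
  by rewrite !mem_cover_cyc_edges.
apply: ler_sum => P; rewrite 2!inE => /and4P[P1 P2 _ _].
rewrite prob_subset // => e; rewrite inE => /orP[].
  exact: (@cycles_between2 3 K).
exact: (@cycles_between2 3 K).
Qed.

Definition has_cycle a K (G : sgraph 'I_n) := exists2 c, is_cycle G c & (a <= size c <= K)%N.

(* [avoids] is stated for families indexed by a whole type, hence this truncation. *)
Let pairs (S : {set edge}) := [set e in S | #|e| == 2%N].

Let pairs2 S e : e \in pairs S -> #|e| = 2%N.
Proof. by rewrite inE => /andP[_ /eqP]. Qed.

Let pairs_id a K S : (2 < a)%N -> S \in cycles_between a K -> pairs S = S.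
Proof.
move=> a2 SK; apply/setP => e; rewrite inE; case eS: (e \in S) => //=.
by rewrite (cycles_between2 a2 SK eS).
Qed.

Lemma no_cycle_avoids a K G : (2 < a)%N ->
  ~ has_cycle a K G <-> avoids pairs (enum (cycles_between a K)) G.
Proof.
move=> a2; split=> [nc S | av [c cc sc]].
  rewrite mem_enum => SK; rewrite (pairs_id a2 SK).
  move: SK => /cycles_betweenP[c [ac uc <-]] sub; apply: nc; exists c => //.
  by rewrite is_cycleE uc sub !andbT; case/andP: ac => ac _; apply: leq_trans a2 ac.
have [S1 E1] := is_cycle_between cc sc.
by apply: (av (cyc_edges c)); rewrite ?mem_enum // (pairs_id a2 S1).
Qed.

Lemma sum_cycles_betweenE a K : (2 < a)%N ->
  \sum_(S in cycles_between a K) p ^+ #|S| =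
  \sum_(a <= k < K.+1) (n ^_ k)%:R / (2 * k)%:R * p ^+ k.
Proof.
move=> a2; rewrite sum_cycles_between //; apply: eq_big_nat => k /andP[ak _].
by rewrite card_cycle_setsR //; apply: leq_trans a2 ak.
Qed.

(** The pairs in Janson's inequality share an edge, hence a vertex, so [sum_overlapping] bounds
    their sum. *)
Lemma prob_no_cycle_le a K : (2 < a)%N -> Pr (fun G => ~ has_cycle a K G) <=
  expR (- (\sum_(a <= k < K.+1) (n ^_ k)%:R / (2 * k)%:R * p ^+ k) + overlap_bound K).
Proof.
move=> a2; rewrite (eq_prob _ (B := avoids pairs (enum (cycles_between a K)))); last first.
  by move=> G; apply: no_cycle_avoids.
apply: le_trans (janson_avoids p01 pairs2 (enum_uniq _)) _.
rewrite ler_expR -sum_cycles_betweenE //; apply: lerD.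
  rewrite big_enum /= (eq_bigr (fun S : {set edge} => p ^+ #|S|)) // => S SK.
  by rewrite (pairs_id a2 SK).
apply: le_trans (sum_overlapping K); rewrite big_enum /=.
under eq_bigr do rewrite -big_filter big_filter_cond big_enum_cond /=.
rewrite pair_big_dep /= big_mkcond [X in _ <= X]big_mkcond; apply: ler_sum => -[S T] _ /=.
case: ifP => [/and4P[SK TK /andP[ne ov] _]|_]; last by case: ifP => _ //; apply/exprn_ge0; case/andP: p01.
have mono Q : Q \in cycles_between a K -> Q \in cycles_between 3 K.
  by move=> /cycles_betweenP[c [/andP[ac cK] uc e]]; apply/cycles_betweenP; exists c; rewrite cK (leq_trans a2 ac).
rewrite (pairs_id a2 SK) (pairs_id a2 TK) in ov *.
rewrite ifT // inE /= !mono // eq_sym ne /=.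
have /set0Pn[e] := ov; rewrite inE => /andP[eS eT].
have : e != finset.set0 by rewrite -card_gt0 (cycles_between2 a2 SK eS).
case/set0Pn=> x xe; apply/set0Pn; exists x; rewrite inE.
by apply/andP; split; apply/bigcupP; exists e.
Qed.

Lemma prob_no_cycle_ge a K : (2 < a)%N -> p < 1 ->
  expR (- ((\sum_(a <= k < K.+1) (n ^_ k)%:R / (2 * k)%:R * p ^+ k) / (1 - p))) <=
  Pr (fun G => ~ has_cycle a K G).
Proof.
move=> a2 p1'; rewrite (eq_prob _ (B := avoids pairs (enum (cycles_between a K)))); last first.
  by move=> G; apply: no_cycle_avoids.
apply: le_trans (harris_avoids p01 pairs2 _).
rewrite big_enum /= -sum_cycles_betweenE // mulr_suml -sumrN expR_sum.
have [p0 p1] := andP p01.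
apply: ler_prod => S SK; rewrite expR_ge0 (pairs_id a2 SK) /=.
have [c [/andP[ac _] uc cS]] := cycles_betweenP _ _ _ SK.
have xp : p ^+ #|S| <= p.
  rewrite -[X in _ <= X]expr1 ler_wiXn2l // -cS card_cyc_edges //; last by apply: leq_trans a2 ac.
  by apply: leq_trans ac; apply: ltn_trans a2.
have x0 : 0 <= p ^+ #|S| by apply: exprn_ge0.
move: (p ^+ #|S|) xp x0 => x xp x0.
have x1 : 0 < 1 - x by lra.
(* For 0 <= x <= p < 1, the inverse of 1 - x is 1 + x / (1 - x), hence at most 1 + x / (1 - p) and
   at most the exponential of x / (1 - p). *)
rewrite expRN -[X in _ <= X]invrK lef_pV2 ?posrE ?expR_gt0 ?invr_gt0 //.
apply: le_trans (_ : 1 + x / (1 - p) <= _); last exact: expR_ge1Dx.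
have -> : (1 - x)^-1 = 1 + x / (1 - x) by field; rewrite gt_eqF.
rewrite lerD2l ler_wpM2l // lef_pV2 ?posrE //; lra.
Qed.

End CycleSums.

(** * Probability bounds for diagonality *)

Section DiagonalityBounds.
Set Implicit Arguments.
Unset Strict Implicit.
Unset Printing Implicit Defensive.
Local Open Scope ring_scope.
Variables (R : realType) (n : nat).
Local Notation graph := (sgraph 'I_n).

Lemma is_cycle_size (G : graph) c : is_cycle G c -> (2 < size c <= n)%N.
Proof.
case/and3P=> -> _ uc /=; rewrite -(card_uniqP uc) -[X in (_ <= X)%N]card_ord.
exact: max_card.
Qed.

Lemma no_cycle_diagonal (G : graph) : ~ has_cycle 3 n G -> diagonal_graph G.
Proof.
move=> nc; have no c : ~ is_cycle G c.
  by move=> cc; apply: nc; exists c => //; apply: is_cycle_size cc.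
by apply: short_cycles_diagonal => [c /no|c c' x /no].
Qed.

Lemma few_cycles_diagonal (G : graph) :
  ~ has_cycle 5 n G -> ~ cycle_overlap 4 G -> diagonal_graph G.
Proof.
move=> nc no; have short c : is_cycle G c -> (size c <= 4)%N.
  move=> cc; rewrite leqNgt; apply/negP => c4; apply: nc; exists c => //.
  by rewrite c4; have /andP[] := is_cycle_size cc.
apply: short_cycles_diagonal => // c c' x cc cc' xc xc'.
apply/eqP/negPn/negP => ne; apply: no; exists c, c', x; split=> //.
by rewrite !short.
Qed.

(** A cycle of length at most 4 through the first edge would share its first vertex with the long
    cycle while having fewer edges, which is an overlap. *)
Lemma long_cycle_no_overlap (G : graph) K :
  has_cycle 5 K G -> ~ cycle_overlap K G -> ~ diagonal_graph G.
Proof.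
move=> [c cc /andP[c5 cK]] no.
case: c cc c5 cK => [|a c] // cc c5 cK.
apply: (edge_long_cycle_nondiagonal cc (mem_head _ _)) => c' cc' c4.
apply/negP => /cyc_edges_mem ac'.
have [_ _ uc] := and3P cc; have [s3 _ uc'] := and3P cc'.
have ne : cyc_edges (a :: c) != cyc_edges c'.
  apply/eqP => /(congr1 (fun A : {set {set 'I_n}} => #|A|)).
  rewrite !card_cyc_edges //; last by apply: ltn_trans c5.
  by move=> e; move: c5; rewrite e ltnNge c4.
apply: no; exists (a :: c), c', a; split=> //; last by split; rewrite ?mem_head.
rewrite cK; apply: leq_trans c4 _; exact: leq_trans (ltnW c5) cK.
Qed.

Variable p : R.
Hypothesis p01 : 0 <= p <= 1.
Local Notation Pr := (@Gnp_prob R n p).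

Lemma prob_union (A B C : graph -> Prop) : (forall G, A G -> B G \/ C G) -> Pr A <= Pr B + Pr C.
Proof.
move=> ABC.
apply: le_trans (prob_sum p01 (Q := xpredT) (f := fun b : bool => if b then B else C) _) _.
  by move=> G /ABC[]; [exists true|exists false].
by rewrite big_bool.
Qed.

Lemma prob_diagonal_ge : Pr (fun G => ~ has_cycle 5 n G) - overlap_bound n p 4 <= Pr (@diagonal_graph 'I_n).
Proof.
rewrite lerBlDr; apply: le_trans (_ : _ <= Pr (@diagonal_graph 'I_n) + Pr (cycle_overlap 4)) _.
  apply: prob_union => G nc; have [|no] := pselect (cycle_overlap 4 G); first by right.
  by left; apply: few_cycles_diagonal.
by rewrite lerD2l prob_overlap.
Qed.

Lemma prob_diagonal_le K : Pr (@diagonal_graph 'I_n) <=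
  Pr (fun G => ~ has_cycle 5 K G) + overlap_bound n p K.
Proof.
apply: le_trans (_ : _ <= Pr (fun G => ~ has_cycle 5 K G) + Pr (cycle_overlap K)) _.
  apply: prob_union => G dg; have [|no] := pselect (cycle_overlap K G); first by right.
  by left=> hc; apply: (long_cycle_no_overlap hc no).
by rewrite lerD2l prob_overlap.
Qed.

Lemma prob_has_cycle a K : (2 < a)%N -> Pr (has_cycle a K) <=
  \sum_(a <= k < K.+1) (n ^_ k)%:R / (2 * k)%:R * p ^+ k.
Proof.
move=> a2; rewrite -sum_cycles_betweenE //.
apply: le_trans (prob_sum p01 (Q := mem (cycles_between n a K)) (f := fun (S : {set {set 'I_n}}) (G : graph) => S \subset edges G) _) _.
  move=> G [c cc sc]; have [S1 E1] := is_cycle_between cc sc.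
  by exists (cyc_edges c).
by apply: ler_sum => S SK; rewrite prob_subset // => e; apply: cycles_between2 SK.
Qed.

Lemma prob_forest_diagonal :
  1 - \sum_(3 <= k < n.+1) (n ^_ k)%:R / (2 * k)%:R * p ^+ k <= Pr (@diagonal_graph 'I_n).
Proof.
apply: le_trans (_ : 1 - Pr (has_cycle 3 n) <= _); first by rewrite lerD2l lerN2 prob_has_cycle.
by rewrite -prob_compl; apply: le_prob => // G; apply: no_cycle_diagonal.
Qed.

End DiagonalityBounds.

(** * More edges than vertices force a cycle *)

Section ManyEdges.
Set Implicit Arguments.
Unset Strict Implicit.
Unset Printing Implicit Defensive.
Local Open Scope nat_scope.
Variables (V : finType) (G : sgraph V).

Definition inner_edges (W : {set V}) := [set e in edges G | e \subset W].

Lemma adj_edge e v : e \in edges G -> v \in e -> exists2 a, e = [set v; a] & adj G v a.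
Proof.
move=> eG; have /cards2P[x [y [xy e_xy]]] : #|e| == 2 by move: e eG; apply/forall_inP/edges_card.
move=> ve; have [a ea] : exists a, e = [set v; a].
  move: ve; rewrite e_xy !inE => /orP[]/eqP->; first by exists y.
  by exists x; rewrite finset.setUC.
by exists a => //; rewrite /adj -ea.
Qed.

(** A path inside [W] is extended at its head to a neighbour other than the second vertex; either
    this closes a cycle or the path gets longer, which cannot go on beyond [#|V|]. *)
Lemma min_degree2_cycle (W : {set V}) : W != finset.set0 ->
  (forall v, v \in W -> exists a b, [/\ a != b, a \in W, b \in W, adj G v a & adj G v b]) ->
  exists c, is_cycle G c.
Proof.
move=> /set0Pn[v0 v0W] deg; apply: contrapT => nc.
have ext m : exists x s, [/\ path (adj G) x s, uniq (x :: s), all (mem W) (x :: s) & size s = m].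
  elim: m => [|m [x [s [ps us Ws sz]]]]; first by exists v0, [::]; rewrite /= v0W.
  have xW : x \in W by case/andP: Ws.
  have [a [b [ab aW bW xa xb]]] := deg x xW.
  have [y [yW xy yh]] : exists y, [/\ y \in W, adj G x y & y != head x s].
    by have [e|ne] := eqVneq a (head x s); [exists b; rewrite eq_sym -e|exists a].
  have [ys|yNs] := boolP (y \in s).
    case: nc; move: ps us {Ws sz} yh; case/splitPr: ys => s1 s2 ps us yh.
    exists (x :: rcons s1 y); apply/and3P; split.
    - by rewrite /= size_rcons; case: (s1) yh => [|z t] //=; rewrite eqxx.
    - rewrite /= rcons_path last_rcons adj_sym xy andbT.
      by move: ps; rewrite -cat_rcons cat_path => /andP[].
    - by move: us; rewrite -cat_rcons -cat_cons cat_uniq => /andP[].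
  exists y, (x :: s); split=> //=; rewrite ?ps ?sz //.
  - by rewrite adj_sym xy.
  - by rewrite inE negb_or yNs eq_sym (adj_neq xy).
  - by rewrite yW; exact: Ws.
have [x [s [_ us _ sz]]] := ext #|V|.
have := card_uniqP us; rewrite /= sz => e.
by have := max_card (mem (x :: s)); rewrite e ltnn.
Qed.

Lemma many_edges_cycle : #|V| < #|edges G| -> exists c, is_cycle G c.
Proof.
move=> h; pose P (W : {set V}) := #|W| < #|inner_edges W|.
have PT : P [set: V].
  rewrite /P cardsT; apply: leq_trans h _; apply: subset_leq_card.
  by apply/fintype.subsetP => e eG; rewrite inE eG finset.subsetT.
have [W PW minW] := @arg_minnP _ [set: V] P (fun W => #|W|) PT.
apply: (@min_degree2_cycle W).
  apply: contraTneq PW => ->; rewrite /P cards0 -leqNgt leqn0 cards_eq0.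
  apply/eqP/setP => e; rewrite !inE finset.subset0; apply/negP => /andP[eG /eqP e0].
  by have := forall_inP (edges_card G) e eG; rewrite e0 cards0.
move=> v vW.
(* [W] is minimal among the sets that span more edges than they have vertices; without [v] the
   excess is gone, so [v] carries at least two of the edges. *)
have small : #|inner_edges (W :\ v)| <= #|W|.-1.
  have cW : #|W :\ v| = #|W|.-1 by rewrite (cardsD1 v W) vW.
  rewrite -cW leqNgt; apply/negP => /minW; rewrite cW.
  by have : 0 < #|W| by [apply/card_gt0P; exists v]; lia.
have : 1 < #|inner_edges W :\: inner_edges (W :\ v)|.
  rewrite cardsD; have := subset_leq_card (finset.subsetIr (inner_edges W) (inner_edges (W :\ v))).
  have : 0 < #|W| by apply/card_gt0P; exists v.
  by move: PW; rewrite /P; lia.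
case/card_gt1P=> e [f [eW fW ef]].
have nb g : g \in inner_edges W :\: inner_edges (W :\ v) -> exists a, [/\ g = [set v; a], a \in W & adj G v a].
  rewrite !inE => /andP[ng /andP[gG gW]]; move: ng; rewrite gG /= => ng.
  have vg : v \in g.
    apply: contraNT ng => vg; apply/fintype.subsetP => x xg; rewrite !inE (fintype.subsetP gW) // andbT.
    by apply: contraNneq vg => <-.
  have [a ga va] := adj_edge gG vg; exists a; split=> //.
  by apply: (fintype.subsetP gW); rewrite ga set22.
have [a [ea aW va]] := nb e eW; have [b [fb bW vb]] := nb f fW.
by exists a, b; split=> //; apply: contraNneq ef => ab; rewrite ea fb ab.
Qed.

End ManyEdges.

(** * Non-diagonality when edges far outnumber short cycles *)

Section ManyEdgesBound.
Set Implicit Arguments.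
Unset Strict Implicit.
Unset Printing Implicit Defensive.
Local Open Scope ring_scope.
Variables (R : realType) (n : nat).
Local Notation graph := (sgraph 'I_n).
Local Notation edge := {set 'I_n}.

Definition short_cycles (G : graph) := [set S in cycles_between n 3 4 | S \subset edges G].

(** Short cycles cover fewer than n edges, so more than n edges remain; these contain a cycle, all
    of whose edges avoid the short cycles. *)
Lemma many_edges_nondiagonal (G : graph) : (2 * n <= #|edges G|)%N ->
  (4 * #|short_cycles G| < n)%N -> ~ diagonal_graph G.
Proof.
move=> en sn; pose B := finset.cover (short_cycles G).
have Bn : (#|B| <= 4 * #|short_cycles G|)%N.
  apply: leq_trans (leq_card_cover _).1 _.
  rewrite mulnC -sum_nat_const; apply: leq_sum => S; rewrite inE => /andP[].
  move=> /cycles_betweenP[c [/andP[c3 c4] uc <-]] _; by rewrite card_cyc_edges.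
have [c cc] : exists c, is_cycle (rem_edges G B) c.
  apply: many_edges_cycle; rewrite card_ord /= cardsD.
  by have := subset_leq_card (finset.subsetIr (edges G) B); lia.
move: cc; rewrite is_cycleE => /and3P[c3 uc csub].
have cG : is_cycle G c.
  rewrite is_cycleE c3 uc /=; apply: fintype.subset_trans csub _; exact: finset.subsetDl.
case: c c3 uc csub cG => [|a c] // c3 uc csub cG.
apply: (edge_long_cycle_nondiagonal cG (mem_head _ _)) => c' cc' c4.
have : [set a; next (a :: c) a] \in edges (rem_edges G B).
  by apply: (fintype.subsetP csub); apply: imset_f; apply: mem_head.
rewrite finset.in_setD => /andP[+ _]; apply: contraNN => ec'.
apply/bigcupP; exists (cyc_edges c') => //; rewrite inE.
by have [|-> ->] := is_cycle_between (a := 3) (K := 4) cc'; first by have /andP[-> _] := is_cycle_size cc'.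
Qed.

Variable p : R.
Hypothesis p01 : 0 <= p <= 1.
Local Notation Pr := (@Gnp_prob R n p).
Local Notation w := (@Gnp_weight R n p).

(** Markov's inequality for 2 to the power minus the number of edges, whose mean is (1 - p / 2) to
    the number of pairs. *)
Lemma prob_few_edges m : Pr (fun G => (#|edges G| < m)%N) <= 2 ^+ m * (1 - p / 2) ^+ 'C(n, 2).
Proof.
have -> : 1 - p / 2 = p / 2 + (1 - p) by lra.
rewrite -sum_weight mulr_sumr probE; apply: ler_sum => G _.
have -> : \prod_(e : edge | #|e| == 2%N) (if e \in edges G then p / 2 else 1 - p) = w G * 2^-1 ^+ #|edges G|.
  rewrite /Gnp_weight -prodr_const.
  rewrite [X in _ = _ * X](_ : _ = \prod_(e : edge | #|e| == 2%N) (if e \in edges G then 2^-1 else 1)).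
    by rewrite -big_split; apply: eq_bigr => e _ /=; case: ifP; rewrite ?mulr1.
  rewrite -big_mkcondr /=; apply: eq_bigl => e.
  by case eG: (e \in edges G); rewrite ?andbF // andbT (forall_inP (edges_card G)).
rewrite mulrCA; apply: ler_wpM2l; first exact: weight_ge0.
case: asboolP => [h|_] /=; last by rewrite mulr_ge0 // exprn_ge0 // invr_ge0.
rewrite exprVn -(subnK (ltnW h)) exprD mulfK; last by rewrite expf_neq0 ?pnatr_eq0.
by rewrite exprn_ege1 // ler1n.
Qed.

(** Markov's inequality for the number of cycles of length 3 or 4. *)
Lemma prob_many_short : Pr (fun G => (n <= 4 * #|short_cycles G|)%N) * n%:R <=
  4 * (\sum_(3 <= k < 5) (n ^_ k)%:R / (2 * k)%:R * p ^+ k).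
Proof.
have [p0 p1] := andP p01.
rewrite -sum_cycles_betweenE // probE mulr_suml.
apply: (@le_trans _ _ (\sum_(G : graph) w G * (4 * #|short_cycles G|)%:R)).
  apply: ler_sum => G _; rewrite -mulrA; apply: ler_wpM2l; first exact: weight_ge0.
  by case: asboolP => [h|_]; rewrite ?mul0r ?mul1r ?ler_nat.
rewrite le_eqVlt; apply/orP; left; apply/eqP.
have E S : S \in cycles_between n 3 4 -> p ^+ #|S| = \sum_(G : graph) w G * (S \subset edges G)%:R.
  move=> SK; rewrite -(@prob_subset R n p S) ?probE; last by move=> e; apply: cycles_between2 SK.
  by apply: eq_bigr => G _; rewrite asboolb.
rewrite (eq_bigr _ E) exchange_big mulr_sumr; apply: eq_bigr => G _ /=.
rewrite -mulr_sumr natrM mulrCA; congr (_ * (_ * _)).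
rewrite -sum1_card natr_sum /short_cycles big_mkcond [RHS]big_mkcond /=.
by apply: eq_bigr => S _; rewrite inE; case: (S \in _); case: (_ \subset _).
Qed.

Lemma ffact_leq_exp k : (n ^_ k <= n ^ k)%N.
Proof.
elim: k => [|k IH] //; rewrite ffactnSr expnSr.
by apply: leq_mul => //; apply: leq_subr.
Qed.

Lemma cycle_term_le k : (n ^_ k)%:R / (2 * k)%:R * p ^+ k <= (n%:R * p) ^+ k / (2 * k)%:R.
Proof.
have [p0 p1] := andP p01.
rewrite exprMn mulrAC; apply: ler_wpM2r; first by rewrite invr_ge0.
by apply: ler_wpM2r; [apply: exprn_ge0|rewrite -natrX ler_nat ffact_leq_exp].
Qed.

Lemma cycle_term_le1 k : (n ^_ k)%:R / (2 * k)%:R * p ^+ k <= (n%:R * p) ^+ k.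
Proof.
have [p0 p1] := andP p01.
apply: le_trans (cycle_term_le k) _; case: k => [|k]; first by rewrite muln0 invr0 mulr0 exprn_ge0 ?mulr_ge0.
rewrite ler_pdivrMr ?ltr0n // ler_peMr ?exprn_ge0 ?mulr_ge0 //.
by rewrite ler1n.
Qed.

Lemma prob_dense_diagonal : (1 < n)%N -> 24 <= n%:R * p ->
  Pr (@diagonal_graph 'I_n) <= n%:R^-1 + 4 * ((n%:R * p) ^+ 3 + (n%:R * p) ^+ 4) / n%:R.
Proof.
have [p0 p1] := andP p01; move=> n2 np.
have n0 : (0 : R) < n%:R by rewrite ltr0n; lia.
apply: le_trans (_ : Pr (fun G => (#|edges G| < 2 * n)%N) + Pr (fun G => (n <= 4 * #|short_cycles G|)%N) <= _).
  apply: prob_union => // G dg; have [|h1] := ltnP #|edges G| (2 * n); first by left.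
  have [|h2] := leqP n (4 * #|short_cycles G|); first by right.
  by case: (many_edges_nondiagonal h1 h2).
apply: lerD; last first.
  rewrite ler_pdivlMr //; apply: le_trans prob_many_short _.
  rewrite big_ltn // big_nat1 ler_pM2l //; apply: lerD; exact: cycle_term_le1.
apply: le_trans (prob_few_edges _) _.
have e2 : 2 <= expR 1 :> R by have := expR_ge1Dx (1 : R); lra.
have b1 : 2 ^+ (2 * n) <= expR ((2 * n)%:R) :> R.
  by rewrite -[X in expR X]mulr1 expRM_natl; apply: lerXn2r; rewrite ?nnegrE ?expR_ge0.
have b2 : (1 - p / 2) ^+ 'C(n, 2) <= expR ('C(n, 2)%:R * - (p / 2)).
  rewrite expRM_natl; apply: lerXn2r; rewrite ?nnegrE ?expR_ge0 //; first lra.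
  exact: expR_ge1Dx.
apply: le_trans (ler_pM _ _ b1 b2) _; rewrite ?exprn_ge0 //; first lra.
rewrite -expRD.
have bin : ('C(n, 2))%:R = n%:R * (n%:R - 1) / 2 :> R.
  have := mul_bin_diag n 1; rewrite bin1 => /(congr1 (fun k => k%:R : R)).
  rewrite !natrM -subn1 natrB; last by lia.
  by move=> ->; field.
apply: le_trans (_ : expR (- n%:R) <= _); last first.
  rewrite expRN lef_pV2 ?posrE ?expR_gt0 //.
  by apply: le_trans (expR_ge1Dx _); rewrite lerDr.
(* The exponent is 2n - (n - 1) np / 4. It is at most - n when (n - 1) np >= 12 n, which np >= 24
   and n >= 2 ensure; this is the origin of the constant 24. *)
rewrite ler_expR bin natrM.
have n2' : 2 <= n%:R :> R by rewrite (ler_nat R 2 n).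
nra.
Qed.

End ManyEdgesBound.

(** * Limits *)

Section LogSeries.
Import functions.
Set Implicit Arguments.
Unset Strict Implicit.
Local Open Scope ring_scope.
Local Open Scope classical_set_scope.
Variable R : realType.

Lemma geometric_sum (x : R) m : (\sum_(0 <= k < m) x ^+ k) * (1 - x) = 1 - x ^+ m.
Proof.
elim: m => [|m IH]; first by rewrite big_nil expr0 subrr mul0r.
by rewrite big_nat_recr //= mulrDl IH exprSr; ring.
Qed.

(** A partial sum of the power series of [- ln (1 - x)]. *)
Definition log_partial m (x : R) := \sum_(0 <= k < m) x ^+ k.+1 / k.+1%:R.

Lemma is_derive_log_partial m (x : R) : is_derive x 1 (log_partial m) (\sum_(0 <= k < m) x ^+ k).
Proof.
elim: m => [|m IH].
  have -> : log_partial 0 = cst 0 by apply/funext => y; rewrite /log_partial big_nil.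
  by rewrite big_nil; apply: is_derive_cst.
have -> : log_partial m.+1 = log_partial m + m.+1%:R^-1 \*: (@id R) ^+ m.+1.
  apply/funext => y; rewrite {1}/log_partial big_nat_recr //= [_ ^+ _ / _]mulrC.
  by rewrite !fctE.
rewrite big_nat_recr //=; apply: is_deriveD.
apply: is_derive_eq; rewrite /= /GRing.scale /= mulr1 mulrA mulVf ?mul1r //.
by rewrite pnatr_eq0.
Qed.

(** The derivative of [log_partial m x + ln (1 - x)] is - x^m / (1 - x), a truncated geometric
    series minus the full one; the mean value theorem on [0, c] gives both bounds. *)
Lemma log_partial_bounds m (c : R) : 0 <= c < 1 ->
  0 <= - ln (1 - c) - log_partial m c <= c ^+ m * c / (1 - c).
Proof.
move=> /andP[c0 c1].
pose g (x : R) : R := log_partial m x + ln (1 - x).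
have dg (x : R) : x < 1 -> is_derive x 1 g (- (x ^+ m / (1 - x))).
  move=> x1; have x1' : 0 < 1 - x by rewrite subr_gt0.
  have h : is_derive x 1 ((cst 1 : R -> R) - id) (0 - 1) by apply: is_deriveB.
  have -> : g = log_partial m + (@ln R \o ((cst 1 : R -> R) - id)) by [].
  have := is_deriveD (is_derive_log_partial m x) (@is_derive1_comp R (@ln R) ((cst 1 : R -> R) - id) x _ _ (is_derive1_ln x1') h).
  move=> /is_derive_eq; apply.
  have x1n : 1 - x != 0 by rewrite gt_eqF.
  apply: (mulIf x1n); rewrite mulrDl geometric_sum sub0r mulrN1 !mulNr mulVf ?divfK //. ring.
have [||z] := @MVT_segment R g (fun x => - (x ^+ m / (1 - x))) 0 c c0.
- by move=> x; rewrite in_itv /= => /andP[_ xc]; apply: dg; apply: lt_trans xc c1.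
- apply: derivable_within_continuous => x; rewrite in_itv /= => /andP[_ xc].
  by apply: ex_derive; apply: dg; apply: le_lt_trans xc c1.
rewrite in_itv /= => /andP[z0 zc].
have -> : g 0 = 0.
  rewrite /g /log_partial subr0 ln1 addr0 big1 // => k _; by rewrite expr0n mul0r.
rewrite /g !subr0 => e.
have -> : - ln (1 - c) - log_partial m c = z ^+ m / (1 - z) * c.
  by rewrite -opprD addrC e mulNr opprK.
have z1 : 0 < 1 - z by rewrite subr_gt0; apply: le_lt_trans zc c1.
have c1' : 0 < 1 - c by rewrite subr_gt0.
rewrite mulr_ge0 ?divr_ge0 ?exprn_ge0 ?(ltW z1) //= mulrAC.
apply: ler_pM; rewrite ?mulr_ge0 ?exprn_ge0 ?invr_ge0 ?(ltW z1) //.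
  by apply: ler_wpM2r => //; apply: lerXn2r.
by rewrite lef_pV2 ?posrE // lerD2l lerN2.
Qed.

End LogSeries.

Local Open Scope ring_scope.
Local Open Scope classical_set_scope.

(** * Limits of the bounds in the four ranges of p *)

Section CycleLimits.
Set Implicit Arguments.
Unset Strict Implicit.
Local Open Scope ring_scope.
Local Open Scope classical_set_scope.
Variable R : realType.
Implicit Types (c : R) (K k n : nat).

Lemma cvg_invn : (n%:R^-1 : R) @[n --> \oo] --> (0 : R).
Proof.
apply/cvgrPdist_le => e e0; have e0' : 0 < e^-1 by rewrite invr_gt0.
near=> n; rewrite sub0r normrN ger0_norm ?invr_ge0 //.
have n0 : (e^-1 : R) < n%:R by near: n; apply: nbhs_infty_gtr.
rewrite -[X in _ <= X]invrK lef_pV2 ?posrE // ?(ltW n0) //.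
exact: lt_trans n0.
Unshelve. all: by end_near. Qed.

Lemma cvg_ffact k c : ((n ^_ k)%:R * (c / n%:R) ^+ k : R) @[n --> \oo] --> c ^+ k.
Proof.
elim: k => [|k IH].
  by under eq_fun do rewrite expr0 mulr1 ffactn0; rewrite expr0; apply: cvg_cst.
have step : ((n - k)%:R * (c / n%:R) : R) @[n --> \oo] --> c.
  have h : (c - k%:R * c * n%:R^-1 : R) @[n --> \oo] --> c - k%:R * c * 0.
    by apply: cvgB; [apply: cvg_cst|apply: cvgMr; apply: cvg_invn].
  rewrite mulr0 subr0 in h; apply: cvg_trans h; apply: near_eq_cvg.
  near=> n.
  have kn : (k < n)%N by near: n; apply: nbhs_infty_gt.
  rewrite natrB; last exact: ltnW.
  by field; rewrite pnatr_eq0; lia.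
have -> : (fun n => (n ^_ k.+1)%:R * (c / n%:R) ^+ k.+1 : R) =
  (fun n => ((n ^_ k)%:R * (c / n%:R) ^+ k) * ((n - k)%:R * (c / n%:R))).
  by apply/funext => n; rewrite ffactnSr natrM exprSr; ring.
by rewrite exprSr; apply: cvgM.
Unshelve. all: by end_near. Qed.

(** The limit of the mean number of cycles of length 5 to [K] for p = c / n; the mean itself is
    [cycle_mean_n]. *)
Definition cycle_mean K c : R := \sum_(5 <= k < K.+1) c ^+ k / (2 * k)%:R.

Definition cycle_mean_n n K c : R :=
  \sum_(5 <= k < K.+1) (n ^_ k)%:R / (2 * k)%:R * (c / n%:R) ^+ k.

Lemma cvg_cycle_mean K c : cycle_mean_n n K c @[n --> \oo] --> cycle_mean K c.
Proof.
rewrite /cycle_mean_n /cycle_mean.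
elim: K.+1 => [|m IH].
  by under eq_fun do rewrite big_geq //; rewrite big_geq //; apply: cvg_cst.
have [m5|m5] := leqP 5 m; last first.
  by under eq_fun do rewrite big_geq //; rewrite big_geq //; apply: cvg_cst.
under eq_fun do rewrite big_nat_recr //=.
rewrite big_nat_recr //=; apply: cvgD IH _.
under eq_fun do rewrite mulrAC.
by apply: cvgMl; apply: cvg_ffact.
Qed.

Lemma cvg_overlap_bound K c : overlap_bound n (c / n%:R) K @[n --> \oo] --> (0 : R).
Proof.
have h : ((K.+1 ^ 2)%:R * (c * ((2 * K).+1%:R + c) ^+ (2 * K)) * n%:R^-1 : R) @[n --> \oo] --> 
  (K.+1 ^ 2)%:R * (c * ((2 * K).+1%:R + c) ^+ (2 * K)) * 0.
  by apply: cvgMr; apply: cvg_invn.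
rewrite mulr0 in h; apply: cvg_trans h; apply: near_eq_cvg; near=> n.
have n0 : (0 < n)%N by near: n; apply: nbhs_infty_gt.
have e : n%:R * (c / n%:R) = c by field; rewrite pnatr_eq0; lia.
by rewrite /overlap_bound e; ring.
Unshelve. all: by end_near. Qed.

Definition diagonal_limit c : R :=
  Num.sqrt (1 - c) * expR (c / 2 + c ^+ 2 / 4 + c ^+ 3 / 6 + c ^+ 4 / 8).

(** For 0 <= c < 1, a closed form of the sum of c^k / (2k) over k >= 5. *)
Let Lambda c : R := (- ln (1 - c) - log_partial 4 c) / 2.

Lemma diagonal_limitE c : c < 1 -> diagonal_limit c = expR (- Lambda c).
Proof.
move=> c1; have c1' : 0 < 1 - c by rewrite subr_gt0.
rewrite /diagonal_limit -powR12_sqrt ?ltW // /powR gt_eqF // -expRD; congr expR.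
rewrite /Lambda /log_partial !big_nat_recr //= big_geq //.
by move: (ln _) => x; field.
Qed.

Lemma cycle_mean_log K c : (4 <= K)%N -> cycle_mean K c = (log_partial K c - log_partial 4 c) / 2.
Proof.
move=> K4; rewrite /cycle_mean /log_partial big_add1 /= (@big_cat_nat _ _ _ 4 0 K) //=.
rewrite addrAC subrr add0r mulr_suml; apply: eq_bigr => k _.
by rewrite natrM invfM mulrCA mulrC.
Qed.

Lemma cycle_mean_bounds K c : 0 <= c < 1 -> (4 <= K)%N ->
  cycle_mean K c <= Lambda c <= cycle_mean K c + c ^+ K * c / (1 - c).
Proof.
move=> c01 K4; rewrite cycle_mean_log // /Lambda.
have := log_partial_bounds K c01; move: (ln _) (log_partial _ _) (log_partial _ _) => x y z.
by move: (_ / _) => t /andP[h1 h2]; lra.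
Qed.

Variable p : nat -> R.
Hypothesis p01 : forall n, 0 <= p n <= 1.
Let D n := Gnp_prob (p n) (@diagonal_graph 'I_n).

Lemma prob_nondiagonal n :
  Gnp_prob (p n) (fun G : sgraph 'I_n => ~ diagonal_graph G) = 1 - D n.
Proof. exact: prob_compl. Qed.

Section Critical.
Variable c : R.
Hypothesis c0 : 0 < c.
Hypothesis pc : \forall n \near \oo, p n = c * n%:R^-1.

Lemma near_diagonal_le K e : 0 < e ->
  \forall n \near \oo, D n <= expR (- cycle_mean K c) + e.
Proof.
move=> e0.
have h : (expR (- cycle_mean_n n K c + overlap_bound n (c / n%:R) K) +
          overlap_bound n (c / n%:R) K : R) @[n --> \oo] --> expR (- cycle_mean K c + 0) + 0.
  apply: cvgD; last exact: cvg_overlap_bound.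
  apply: continuous_cvg; first exact: continuous_expR.
  by apply: cvgD; [apply: cvgN; apply: cvg_cycle_mean|apply: cvg_overlap_bound].
rewrite !addr0 in h; move/cvgrPdist_le: h => /(_ e e0) h.
near=> n.
have pn : p n = c * n%:R^-1 by near: n.
have : `|expR (- cycle_mean K c) - (expR (- cycle_mean_n n K c + overlap_bound n (c / n%:R) K) +
          overlap_bound n (c / n%:R) K)| <= e by near: n.
rewrite distrC => /(le_trans (ler_norm _)); rewrite lerBlDl => ub.
apply: le_trans ub; apply: le_trans (prob_diagonal_le n (p01 n) K) _.
by rewrite pn lerD2r; have := @prob_no_cycle_le R n (p n) (p01 n) 5 K isT; rewrite pn.
Unshelve. all: by end_near. Qed.

(** All cycle lengths up to [n] enter, so limits cannot be taken term by term. Instead each mean is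
    at most c^k / (2k), and these sum to at most [Lambda c] for every [n]; the factor 1 / (1 - p)
    from [prob_no_cycle_ge] tends to 1. *)
Lemma near_diagonal_ge e : c < 1 -> 0 < e ->
  \forall n \near \oo, diagonal_limit c - e <= D n.
Proof.
move=> c1 e0; rewrite diagonal_limitE //.
have h : (expR (- (Lambda c * (1 - c * n%:R^-1)^-1)) - overlap_bound n (c / n%:R) 4 : R) @[n --> \oo]
    --> expR (- (Lambda c * (1 - c * 0)^-1)) - 0.
  apply: cvgB; last exact: cvg_overlap_bound.
  apply: continuous_cvg; first exact: continuous_expR.
  apply: cvgN; apply: cvgMr; apply: cvgV; first by rewrite mulr0 subr0 oner_eq0.
  by apply: cvgB; [apply: cvg_cst|apply: cvgMr; apply: cvg_invn].
rewrite mulr0 !subr0 invr1 mulr1 in h; move/cvgrPdist_le: h => /(_ e e0) h.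
near=> n.
have pn : p n = c * n%:R^-1 by near: n.
have n4 : (4 < n)%N by near: n; apply: nbhs_infty_gt.
have : `|expR (- Lambda c) - (expR (- (Lambda c * (1 - c * n%:R^-1)^-1)) - overlap_bound n (c / n%:R) 4)| <= e by near: n.
move=> /(le_trans (ler_norm _)); rewrite lerBlDr -lerBlDl => lb.
apply: le_trans lb _; apply: le_trans (prob_diagonal_ge n (p01 n)).
rewrite pn lerD2r.
have n0 : (0 : R) < n%:R by rewrite ltr0n; lia.
have pn1 : p n < 1.
  by rewrite pn ltr_pdivrMr // mul1r; apply: lt_le_trans c1 _; rewrite ler1n; lia.
have := @prob_no_cycle_ge R n (p n) (p01 n) 5 n isT pn1; rewrite pn; apply: le_trans.
rewrite ler_expR lerN2 -pn; apply: ler_wpM2r; first by rewrite invr_ge0 subr_ge0 ltW.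
have c01 : 0 <= c < 1 by rewrite ltW.
have /andP[+ _] := @cycle_mean_bounds n c c01 (ltnW n4).
apply: le_trans; apply: ler_sum => k _.
apply: le_trans (cycle_term_le n (p01 n) k) _.
by have -> : n%:R * p n = c by rewrite pn; field; rewrite gt_eqF.
Unshelve. all: by end_near. Qed.

Lemma cvg_diagonal : c < 1 -> D n @[n --> \oo] --> diagonal_limit c.
Proof.
move=> c1; apply/cvgrPdist_le => e e0; have c01 : 0 <= c < 1 by rewrite ltW.
have [K [K4 Ke]] : exists K, (4 <= K)%N /\ expR (- cycle_mean K c) <= diagonal_limit c + e / 2.
  have h : (expR (- (Lambda c - c ^+ K * (c / (1 - c)))) : R) @[K --> \oo] --> expR (- (Lambda c - 0 * (c / (1 - c)))).
    apply: continuous_cvg; first exact: continuous_expR.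
    apply: cvgN; apply: cvgB; first exact: cvg_cst.
    by apply: cvgMl; apply: cvg_expr; rewrite gtr0_norm.
  rewrite mul0r subr0 -diagonal_limitE // in h; move/cvgrPdist_le: h => /(_ (e / 2)).
  move=> /(_ ltac:(by rewrite divr_gt0)) [N _ HN].
  exists (maxn N 4); split; first exact: leq_maxr.
  have := HN (maxn N 4) (leq_maxl _ _); rewrite distrC => /(le_trans (ler_norm _)).
  rewrite lerBlDl; apply: le_trans; rewrite ler_expR lerN2.
  have /andP[_ +] := @cycle_mean_bounds (maxn N 4) c c01 (leq_maxr _ _).
  by rewrite mulrA lerBlDr.
have e20 : 0 < e / 2 by rewrite divr_gt0.
near=> n; rewrite ler_distlC; apply/andP; split.
  by near: n; apply: near_diagonal_ge.
apply: (@le_trans _ _ (expR (- cycle_mean K c) + e / 2)).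
  by near: n; apply: near_diagonal_le.
by apply: le_trans (lerD Ke (lexx _)) _; rewrite -addrA -splitr.
Unshelve. all: by end_near. Qed.

Lemma cvg_supercritical : 1 < c -> D n @[n --> \oo] --> (0 : R).
Proof.
move=> c1; apply/cvgrPdist_le => e e0; have e20 : 0 < e / 2 by rewrite divr_gt0.
have [K Ke] : exists K, expR (- cycle_mean K c) <= e / 2.
  (* By Bernoulli, c^k >= 1 + k (c - 1), so each of the m terms c^k / (2k) with 5 <= k <= m + 4 is
     at least (c - 1) / 2. *)
  have cm m : m%:R * ((c - 1) / 2) <= cycle_mean (m + 4) c.
    elim: m => [|m IH]; first by rewrite mul0r /cycle_mean big_geq.
    rewrite -natr1 mulrDl mul1r /cycle_mean addSn big_nat_recr; last by lia.
    apply: lerD IH _.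
    set k := (m + 4).+1; have k0 : 0 < k%:R :> R by rewrite ltr0n.
    have : 1 + k%:R * (c - 1) <= c ^+ k.
      rewrite -[c in c ^+ _](subrKC 1); elim: (k) => [|j IHj]; first by rewrite mul0r addr0 expr0.
      rewrite exprS -natr1; apply: le_trans (_ : (1 + (c - 1)) * (1 + j%:R * (c - 1)) <= _).
        have : 0 <= j%:R * (c - 1) ^+ 2 by rewrite mulr_ge0 // sqr_ge0.
        by move: (j%:R) => x; nra.
      by apply: ler_wpM2l => //; rewrite subrKC ltW // (lt_trans ltr01).
    move=> bern; rewrite natrM ler_pdivlMr ?mulr_gt0 //.
    apply: le_trans bern; rewrite [X in X <= _](_ : _ = k%:R * (c - 1)); first by rewrite lerDr.
    by field.
  have [m hm] : exists m, (e / 2)^-1 <= m%:R * ((c - 1) / 2).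
    have c1' : 0 < (c - 1) / 2 by rewrite divr_gt0 // subr_gt0.
    have [N _ HN] := nbhs_infty_gtr ((e / 2)^-1 / ((c - 1) / 2)).
    by exists N; have := HN N (leqnn N); rewrite /= ltr_pdivrMr // => /ltW.
  exists (m + 4)%N; rewrite expRN -[X in _ <= X]invrK lef_pV2 ?posrE ?expR_gt0 ?invr_gt0 //.
  apply: le_trans hm _; apply: le_trans (cm m) _.
  by apply: le_trans (expR_ge1Dx _); rewrite lerDr.
near=> n; rewrite sub0r normrN ger0_norm; last exact: prob_ge0.
apply: (@le_trans _ _ (expR (- cycle_mean K c) + e / 2)).
  by near: n; apply: near_diagonal_le.
by apply: le_trans (lerD Ke (lexx _)) _; rewrite -splitr.
Unshelve. all: by end_near. Qed.

End Critical.

Lemma cvg_subcritical : p =o_\oo (fun n => n%:R^-1 : R) -> D n @[n --> \oo] --> (1 : R).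
Proof.
move=> /eqoP po; apply/cvgrPdist_le => e e0.
(* With x = np <= 1/2 the geometric series sums to at most 2, so the mean number of cycles is at
   most 2x, and x <= e / 2 makes this at most e. *)
pose d := Num.min (2^-1) (e / 2); have d0 : 0 < d by rewrite lt_min invr_gt0 divr_gt0 ?ltr0n.
near=> n.
have n0 : (0 : R) < n%:R by rewrite ltr0n; near: n; apply: nbhs_infty_gt.
have pn : `|p n| <= d * `|n%:R^-1 : R| by near: n; apply: po.
have /andP[pn0 pn1] := p01 n.
rewrite !ger0_norm ?invr_ge0 // ler_pdivlMr // mulrC in pn.
rewrite ger0_norm; last by rewrite subr_ge0 prob_le1.
rewrite lerBlDr -lerBlDl; apply: le_trans (prob_forest_diagonal n (p01 n)).
rewrite lerD2l lerN2.
set x := n%:R * p n in pn; have x0 : 0 <= x by rewrite mulr_ge0.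
have xd : x <= 2^-1 /\ x <= e / 2 by move: pn; rewrite /d le_min => /andP[].
apply: (@le_trans _ _ (\sum_(1 <= k < n.+1) x ^+ k)).
  apply: (@le_trans _ _ (\sum_(3 <= k < n.+1) x ^+ k)).
    by apply: ler_sum => k _; apply: cycle_term_le1.
  have [n2|n2] := leqP 2 n; last first.
    by rewrite big_geq; [apply: sumr_ge0 => k _; apply: exprn_ge0|lia].
  rewrite [X in _ <= X](@big_cat_nat _ _ _ 3) //= lerDr; apply: sumr_ge0 => k _; exact: exprn_ge0.
rewrite big_add1 /=; under eq_bigr do rewrite exprS.
rewrite -mulr_sumr; have := geometric_sum x n; move: (\sum_(_ <= _ < _) _) => s hs.
have s2 : s <= 2.
  have : s * (1 - x) <= 1 by rewrite hs gerDl oppr_le0 exprn_ge0.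
  case: xd => x2 _ h; have [s0|s0] := ltP s 0; first by apply: ltW; apply: lt_trans s0 _.
  nra.
case: xd => _ xe; nra.
Unshelve. all: by end_near. Qed.

Lemma cvg_intermediate : (fun n => n%:R^-1 : R) =o_\oo p ->
  p =o_\oo (fun n => n%:R `^ (- (3 / 4)) : R) -> D n @[n --> \oo] --> (0 : R).
Proof.
move=> /eqoP op /eqoP po; apply/cvgrPdist_le => e e0.
(* As d <= 1, (np)^4 <= d^4 n <= (e / 16) n, and (np)^3 is no larger since np >= 1. The second term
   of [prob_dense_diagonal] is then at most 4 * 2 * e / 16 = e / 2; the rest of [e] is for 1 / n. *)
pose d := Num.min 1 (e / 16); have d0 : 0 < d by rewrite lt_min ltr01 divr_gt0 ?ltr0n.
near=> n.
have n1 : (1 < n)%N by near: n; apply: nbhs_infty_gt.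
have n0 : (0 : R) < n%:R by rewrite ltr0n ltnW.
have pn : `|p n| <= d * `|n%:R `^ (- (3 / 4)) : R| by near: n; apply: po.
have np : `|n%:R^-1 : R| <= 24^-1 * `|p n| by near: n; apply: op; rewrite invr_gt0 ltr0n.
have ne : (e / 2)^-1 < n%:R by near: n; apply: nbhs_infty_gtr.
have /andP[pn0 pn1] := p01 n.
rewrite !ger0_norm ?invr_ge0 ?powR_ge0 // in pn np.
have x24 : 24 <= n%:R * p n.
  by move: np; rewrite mulrC ler_pdivlMr ?ltr0n // mulrC ler_pdivrMr // mulrC.
rewrite sub0r normrN ger0_norm; last exact: prob_ge0.
apply: le_trans (prob_dense_diagonal (p01 n) n1 x24) _.
have x4 : (n%:R * p n) ^+ 4 <= e / 16 * n%:R.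
  have hp : (n%:R `^ (- (3 / 4)) : R) ^+ 4 = n%:R ^- 3.
    rewrite -powR_mulrn ?powR_ge0 // -powRrM -powR_invn //; congr (_ `^ _); by field.
  rewrite exprMn; apply: (@le_trans _ _ (n%:R ^+ 4 * (d ^+ 4 * n%:R ^- 3))).
    rewrite ler_pM2l ?exprn_gt0 // -hp -exprMn; apply: lerXn2r; rewrite ?nnegrE ?mulr_ge0 ?powR_ge0 // ltW //.
  rewrite mulrCA (_ : n%:R ^+ 4 / n%:R ^+ 3 = n%:R); last by field; rewrite gt_eqF.
  rewrite ler_pM2r //; apply: (@le_trans _ _ d); last by rewrite /d ge_min lexx orbT.
  by rewrite -[X in _ <= X]expr1; apply: ler_wiXn2l => //; [exact: ltW|rewrite /d ge_min lexx].
have x3 : (n%:R * p n) ^+ 3 <= (n%:R * p n) ^+ 4.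
  by apply: ler_weXn2l => //; apply: le_trans x24; rewrite ler1n.
have i1 : n%:R^-1 <= e / 2 by rewrite -[X in _ <= X]invrK lef_pV2 ?posrE ?invr_gt0 ?divr_gt0 // ltW.
apply: le_trans (_ : e / 2 + e / 2 <= _); last by rewrite -splitr.
apply: lerD i1 _; rewrite ler_pdivrMr //.
move: x3 x4; move: (_ ^+ 3) (_ ^+ 4) => y3 y4; lra.
Unshelve. all: by end_near. Qed.

End CycleLimits.

Theorem theorem1p7 (R : realType) (p : nat -> R)
    (p01 : forall n, 0 <= p n <= 1) :
  [/\ (p =o_\oo (fun n => n%:R^-1 : R) ->
         aas p (fun n G => diagonal_graph G)),
      (forall c : R, 0 < c -> (\forall n \near \oo, p n = c * n%:R^-1) ->
         (c < 1 ->
            Gnp_prob (p n) (fun G : sgraph 'I_n => ~ diagonal_graph G) @[n --> \oo] -->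
              1 - Num.sqrt (1 - c) *
                  expR (c / 2 + c ^+ 2 / 4 + c ^+ 3 / 6 + c ^+ 4 / 8)) /\
         (1 < c ->
            Gnp_prob (p n) (fun G : sgraph 'I_n => ~ diagonal_graph G) @[n --> \oo] -->
              (1 : R)))
    & ((fun n => n%:R^-1 : R) =o_\oo p ->
       p =o_\oo (fun n => n%:R `^ (- (3 / 4)) : R) ->
         aas p (fun n G => ~ diagonal_graph G))].
Proof.
have nd (l : R) : Gnp_prob (p n) (@diagonal_graph 'I_n) @[n --> \oo] --> l ->
    Gnp_prob (p n) (fun G : sgraph 'I_n => ~ diagonal_graph G) @[n --> \oo] --> 1 - l.
  move=> h; under eq_fun do rewrite prob_nondiagonal //.
  by apply: cvgB h; apply: cvg_cst.
split=> [|c c0 pc|h1 h2].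
- exact: cvg_subcritical.
- split=> c1; first by apply: nd; apply: cvg_diagonal.
  by rewrite -[1]subr0; apply: nd; apply: cvg_supercritical pc c1.
- by rewrite /aas -[1]subr0; apply: nd; apply: cvg_intermediate.
Qed.
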